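(* Let $\varphi:\mathbb R^2\to[0,\infty)$ be continuous with compact support and $\int_{\mathbb R^2}\varphi=1$. Let $\lambda\in\mathbb R$ and $$\Lambda_\varepsilon=\frac{\pi}{\log\varepsilon^{-1}}+\frac{\lambda\pi}{\log^2\varepsilon^{-1}},$$ and let $\Phi^\varepsilon=\overline\varphi+\Lambda_\varepsilon\check\varphi$ and $(\Phi^\varepsilon)_\varepsilon(z)=\varepsilon^{-2}\Phi^\varepsilon(\varepsilon^{-1}z)$. Then for any bounded Borel $g:\mathbb R^2\to[0,\infty)$ and any $z\ne0$, $$\lim_{\varepsilon\to0}G_q^{\Lambda_\varepsilon(\Phi^\varepsilon)_\varepsilon}\{g\}(z)=G_q\{g\}(z)+\frac{2\pi}{\log(q/\beta)}\,G_q(z)\,G_q\{g\}(0),$$ where $q$ satisfies $q>\beta$ and is large enough, and $\beta>0$ is defined by $$\frac{\log\beta}{2}=\pi\langle\mathcal E(\varphi)\rangle+\frac{\log2}{2}+\lambda-\gamma.$$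
   Context: Identify $\mathbb R^2$ with $\mathbb C$. $\log^2x:=(\log x)^2$; $\gamma$ is the Euler–Mascheroni constant; $\langle\mathcal E(\varphi)\rangle=\iint\varphi(z)\,\frac1\pi\log\frac1{|z-z'|}\,\varphi(z')\,dz\,dz'$. $W$ is a two-dimensional standard Brownian motion with $W_0=z$ under $\mathbb P^W_z$. $A_f(t)=\int_0^tf(W_s)\,ds$, $G_q^f\{g\}(z)=\int_0^\infty e^{-qt}\,\mathbb E^W_z[e^{A_f(t)}g(W_t)]\,dt$, $G_q\{g\}=G_q^0\{g\}$, and $G_q(z)=\int_0^\infty e^{-qt}\frac1{2\pi t}e^{-|z|^2/(2t)}\,dt$. $\overline\varphi(z)=\frac1{2\pi}\int_{-\pi}^\pi\varphi(|z|e^{i\theta})\,d\theta$, $\widehat\varphi=\varphi-\overline\varphi$, and $$\check\varphi(z)=\frac1{2\pi}\int_{-\pi}^\pi\Big(-\frac1\pi\widehat\varphi(|z|e^{i\theta})\int_{\mathbb C}\widehat\varphi(z')\log\big||z|e^{i\theta}-z'\big|\,dz'\Big)d\theta.$$ *)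

(* Defs.v *)
From HB Require Import structures.
From mathcomp Require Import all_boot all_order all_algebra.
From mathcomp Require Import all_classical all_reals all_analysis.

Set Implicit Arguments.
Unset Strict Implicit.
Unset Printing Implicit Defensive.

Import Order.TTheory GRing.Theory Num.Theory.
Import numFieldNormedType.Exports.

Local Open Scope classical_set_scope.
Local Open Scope ring_scope.

(* The plane is R * R, carrying the product topology, the product (= Borel)
   sigma-algebra and the product Lebesgue measure.  The norm that the library
   puts on a product is the sup norm, hence a separate Euclidean modulus. *)
Section Plane.
Context {R : realType}.

Definition leb2 := ((@lebesgue_measure R) \x (@lebesgue_measure R))%E.

Definition modulus (z : R * R) : R := Num.sqrt (z.1 ^+ 2 + z.2 ^+ 2).

Definition polar (r theta : R) : R * R := (r * cos theta, r * sin theta).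

Definition rescale (eps : R) (f : R * R -> R) (z : R * R) : R :=
  eps ^- 2 * f (eps^-1 * z.1, eps^-1 * z.2).

Definition compactly_supported (f : R * R -> R) : Prop :=
  compact (closure [set z | f z != 0]).

Definition radial_avg (f : R * R -> R) (z : R * R) : R :=
  (2 * pi)^-1 *
    \int[lebesgue_measure]_(theta in `[- pi, pi]) f (polar (modulus z) theta).

Definition radial_hat (f : R * R -> R) (z : R * R) : R := f z - radial_avg f z.

(* On the null set z = z' the library value ln 0 = 0 is used, here and in
   [energy]. *)
Definition radial_check (f : R * R -> R) (z : R * R) : R :=
  (2 * pi)^-1 *
    \int[lebesgue_measure]_(theta in `[- pi, pi])
      (- pi^-1 * radial_hat f (polar (modulus z) theta) *
       \int[leb2]_z' (radial_hat f z' *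
                      ln (modulus (polar (modulus z) theta - z')))).

Definition energy (f : R * R -> R) : R :=
  \int[leb2]_z' \int[leb2]_z
    (f z * (pi^-1 * ln (modulus (z - z'))^-1) * f z').

End Plane.

Definition euler_mascheroni (R : realType) : R :=
  limn (fun n => \sum_(1 <= k < n.+1) k%:R^-1 - ln n%:R : R).

Section BrownianMotion.
Context {R : realType} {d : measure_display} {Omega : measurableType d}.

Definition mutually_independent {d' : measure_display} {T : measurableType d'}
    (P : probability Omega R) (n : nat) (X : 'I_n -> Omega -> T) : Prop :=
  forall B : 'I_n -> set T, (forall i, measurable (B i)) ->
    P [set w | forall i, B i (X i w)] = (\prod_(i < n) P (X i @^-1` B i))%E.

(* Centred normal law on the plane with covariance s times the identity; the
   second argument of [normal_prob] is the standard deviation. *)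
Definition normal2 (s : R) : set (R * R) -> \bar R :=
  (normal_prob 0 (Num.sqrt s) \x normal_prob 0 (Num.sqrt s))%E.

(* Only the times t >= 0 are relevant. *)
Record is_brownian2 (P : probability Omega R) (z : R * R)
    (W : R -> Omega -> R * R) : Prop := IsBrownian2 {
  brownian2_measurable : forall t, 0 <= t -> measurable_fun setT (W t);
  brownian2_start : {ae P, forall w, W 0 w = z};
  brownian2_continuous :
    forall w, {within `[0, +oo[, continuous (fun t => W t w)};
  brownian2_increment_law : forall s t, 0 <= s -> s < t ->
    forall B, measurable B ->
      P ((fun w => W t w - W s w) @^-1` B) = normal2 (t - s) B;
  brownian2_increment_indep : forall (n : nat) (t : nat -> R),
    0 <= t 0%N -> (forall i, t i < t i.+1) ->
    mutually_independent P
      (fun (i : 'I_n) w => W (t i.+1) w - W (t i) w) }.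

Definition additive_functional (W : R -> Omega -> R * R) (f : R * R -> R)
    (t : R) (w : Omega) : R :=
  \int[lebesgue_measure]_(s in `[0, t]) f (W s w).

Definition resolvent (P : R * R -> probability Omega R)
    (W : R -> Omega -> R * R) (q : R) (f g : R * R -> R) (z : R * R) : \bar R :=
  (\int[lebesgue_measure]_(t in `[0%R, +oo[)
     ((expR (- (q * t)))%:E *
      'E_(P z)[fun w => (expR (additive_functional W f t w) * g (W t w))%R]))%E.

End BrownianMotion.

Definition green {R : realType} (q : R) (z : R * R) : \bar R :=
  (\int[lebesgue_measure]_(t in `[0%R, +oo[)
     (expR (- (q * t)) * (2 * pi * t)^-1 *
      expR (- (modulus z ^+ 2 / (2 * t))))%:E)%E.

Definition coupling {R : realType} (lambda eps : R) : R :=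
  pi / ln eps^-1 + lambda * pi / (ln eps^-1) ^+ 2.

Definition corrected_profile {R : realType} (phi : R * R -> R) (lambda eps : R)
    (z : R * R) : R :=
  radial_avg phi z + coupling lambda eps * radial_check phi z.

(* Main.v *)
(* Write L = log(1/eps), V for the potential at scale eps, R h for the mean of
   the integral of exp(-q t + A_V(t)) h(W_t) dt, G for the free resolvent and
   N f for the logarithmic potential of f.  Duhamel's formula and the Markov
   property give R h = G h + R (V G h).  Applied to h = g + V k this becomes
     R g = G g + G (V k) + R (V (G g + G (V k) - k)),
   so it suffices to find a bounded k on the support of V for which the last
   bracket is uniformly small, as long as R |V| stays bounded.

   At scale eps the Green kernel is pi^-1 (L - log |x - y| + const) + o(1), so
   G V = 1 + O(1/L) on the support of V and the equation k = G g + G (V k) is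
   nearly resonant.  The ansatz k(eps x) = m (L + N(phi_avg)(x)), where phi_avg is
   the radial average, cancels the terms of order L and the x-dependent terms of
   order one; the remaining constant vanishes for m = 2 G g (0) / log (q / beta),
   where log beta collects pi int phi_check + int phi_avg N(phi_avg), lambda,
   Euler's constant and log 2.  The first two integrals add up to pi times the
   energy of phi because the potential of a radial function is radial.  Then
   G (V k) (z) converges to pi m G_q (z).

   For q large, G |V| <= 1 - c / L on the support of V, and iterating Duhamel's
   formula, first on a finite time horizon, bounds R |V|. *)
Require Import Defs.
From HB Require Import structures.
From mathcomp Require Import all_boot all_order all_algebra.
From mathcomp Require Import all_classical all_reals all_analysis.
From mathcomp Require Import measurable_realfun ring lra.

Import Order.TTheory GRing.Theory Num.Theory.
Import numFieldNormedType.Exports.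

Local Open Scope classical_set_scope.
Local Open Scope ring_scope.

Set Implicit Arguments.
Unset Strict Implicit.
Unset Printing Implicit Defensive.

(** * Joint measurability of processes with continuous paths *)

Section JointMeasurability.
Context {R : realType} {d : measure_display} {T : measurableType d}.

(** The corrected profile is signed, and before the smallness of G |V| is exploited nothing excludes
    infinite expectations. Duhamel's formula is therefore proved for nonnegative functions in the
    extended reals, with the terms of the positive and negative parts of V on opposite sides; it
    becomes a subtraction only once the total mass is known to be finite.

    A margin of order 1 / L in the bound of G |V| costs a factor L in the bound of R |V|. The
    starting point pays for it: z is fixed and nonzero, so G |V| (z) is itself of order 1 / L.
    Largeness of q beyond [beta] serves this margin alone, since [log_const q] tends to minus
    infinity.

    The Green kernel is a Bessel function K_0. The involution [t -> s ^+ 2 / t] reduces its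
    expansion to an exponential integral, and replacing the exponential by [(1 - v / n) ^+ n] lets
    the harmonic sums of Euler's constant appear. At rate 2 the same kernel dominates the logarithm,
    which yields all bounds on potentials. Integration in polar coordinates is avoided: rotations
    are products of shears, and angular averages are exchanged with plane integrals. *)

Lemma cvg_floor_grid (t : R) :
  (Num.floor (t * n.+1%:R))%:~R / n.+1%:R @[n --> \oo] --> t.
Proof.
apply/cvgrPdist_le => e e0; near=> n.
have n0 : 0 < n.+1%:R :> R by [].
have -> : t - (Num.floor (t * n.+1%:R))%:~R / n.+1%:R =
    (t * n.+1%:R - (Num.floor (t * n.+1%:R))%:~R) / n.+1%:R.
  by rewrite mulrBl mulfK ?gt_eqF.
rewrite normf_div (gtr0_norm n0) ler_pdivrMr//.
have [/andP[h1 h2]] := (floor_itv (t * n.+1%:R)); rewrite intrD in h2.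
apply: (@le_trans _ _ 1).
  by rewrite ger0_norm ?subr_ge0// lerBlDr addrC ltW.
rewrite -ler_pdivrMl// mulr1 (le_trans (ltW (truncnS_gt _)))//.
rewrite ler_nat; near: n; exact: nbhs_infty_ge.
Unshelve. all: by end_near. Qed.

(** Freezing the time at the grid point to its left gives maps whose preimages are countable unions
    of rectangles, one for each grid cell; continuity in time makes these maps converge pointwise to
    [X]. *)
Lemma measurable_fun_caratheodory (X : R -> T -> R) :
  (forall t, measurable_fun setT (X t)) ->
  (forall w, continuous (fun t => X t w)) ->
  measurable_fun setT (fun p : R * T => X p.1 p.2).
Proof.
move=> mX cX.
pose h (n : nat) (p : R * T) := X ((Num.floor (p.1 * n.+1%:R))%:~R / n.+1%:R) p.2.
apply: (@measurable_fun_cvg _ _ _ _ h) => [n|[t w] _] /=.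
- move=> _ B mB; rewrite setTI.
  have -> : h n @^-1` B = \bigcup_(k in [set: int])
      ((fun t : R => Num.floor (t * n.+1%:R)) @^-1` [set k] `*`
       (X (k%:~R / n.+1%:R) @^-1` B)).
    apply/seteqP; split => [[t w] /= Bt|[t w] [k _] [/= <-]] //.
    by exists (Num.floor (t * n.+1%:R)).
  apply: countable_bigcupT_measurable => [|k]; first exact: countableP.
  apply: measurableX; last by rewrite -[X in measurable X]setTI; exact: mX.
  rewrite (_ : _ @^-1` _ = `[k%:~R / n.+1%:R, (k + 1)%:~R / n.+1%:R[%classic).
    exact: measurable_itv.
  apply/seteqP; split => t /=; rewrite in_itv/= ler_pdivrMr// ltr_pdivlMr//.
    by move=> <-; rewrite floor_le/= floorD1_gt.
  by move=> kt; apply: floor_def.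
- exact: (cvg_comp _ _ (@cvg_floor_grid t) (cX w t)).
Qed.
End JointMeasurability.

(** * Independence, the past of a Brownian motion and the Markov property *)

Section Independence.
Context {R : realType} {d d' : measure_display} {Omega : measurableType d} {S : measurableType d'}.
Variables (P : probability Omega R) (nu : probability S R).

(** Freezing lemma: independence says that the joint law of the past and of [xi] is a product, and
    Tonelli's theorem does the rest. The past is the sigma-algebra generated by [G], carried by the
    type of the first argument of [H]. *)
Lemma ge0_integral_indep (G : set (set Omega)) (xi : Omega -> S) :
  G `<=` measurable -> measurable_fun setT xi ->
  (forall E B, <<s G >> E -> measurable B ->
     P (E `&` xi @^-1` B) = (P E * nu B)%E) ->
  forall H : g_sigma_algebraType G * S -> \bar R,
    measurable_fun setT H -> (forall p, (0 <= H p)%E) ->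
  (\int[P]_w H (w, xi w) = \int[P]_w \int[nu]_y H (w, y))%E.
Proof.
move=> Gm mxi PI H mH H0.
have sGm : <<s G >> `<=` measurable by apply: smallest_sub => //; exact: sigma_algebra_measurable.
(* The identity, read as a map into the coarser sigma-algebra, is a random variable whose law is the
   restriction of [P] to the past. *)
have mid : measurable_fun setT (idfun : Omega -> g_sigma_algebraType G).
  by move=> _ B mB; rewrite setTI preimage_id; exact: sGm.
have mpr : measurable_fun setT (fun w : Omega => ((w : g_sigma_algebraType G), xi w)).
  exact: measurable_fun_pair.
pose idm : {mfun Omega >-> g_sigma_algebraType G} :=
  HB.pack (idfun : Omega -> g_sigma_algebraType G) (isMeasurableFun.Build _ _ _ _ _ mid).
pose prm : {mfun Omega >-> (g_sigma_algebraType G * S)%type} :=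
  HB.pack (fun w : Omega => ((w : g_sigma_algebraType G), xi w)) (isMeasurableFun.Build _ _ _ _ _ mpr).
pose P' := distribution P idm. pose Q := distribution P prm.
have QE A : measurable A -> (P' \x nu)%E A = Q A.
  apply: (@product_measure_unique _ _ _ _ _ P' nu Q) => E B mE mB.
  rewrite -(PI E B mE mB).
  by rewrite /Q /distribution /pushforward; congr (P _); apply/seteqP; split => w.
transitivity (\int[Q]_p H p)%E.
  by rewrite /Q /distribution ge0_integral_pushforward// preimage_setT.
rewrite (@eq_measure_integral _ _ _ _ (P' \x nu)%E); last by move=> A mA _; apply/esym/QE.
rewrite fubini_tonelli1//.
rewrite ge0_integral_pushforward//=.
- exact: measurable_fun_fubini_tonelli_F.
- by move=> w _; apply: integral_ge0 => y _; exact: H0.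
Qed.
End Independence.

Section PiLambda.
Context {R : realType} {d : measure_display} {Omega : measurableType d}.
Variable P : probability Omega R.

(** For fixed [B] the events independent of [B] form a Dynkin system, and a Dynkin system that
    contains an intersection-stable family contains the sigma-algebra it generates. *)
Lemma indep_sigma_algebra (C : set (set Omega)) (B : set Omega) :
  setI_closed C -> C `<=` measurable -> measurable B ->
  (forall E, C E -> P (E `&` B) = (P E * P B)%E) ->
  forall E, <<s C >> E -> P (E `&` B) = (P E * P B)%E.
Proof.
move=> CI Cm mB CB E; rewrite -setI_closed_g_dynkin_g_sigma_algebra//.
suff /[apply] : <<d C >> `<=` [set E | measurable E /\ P (E `&` B) = (P E * P B)%E] by case.
apply: smallest_sub; last by move=> A CA; split; [exact: Cm|exact: CB].
split => [|A [mA AB]|F tF FB] /=.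
- by rewrite setTI probability_setT mul1e.
- split; first exact: measurableC.
  have -> : P (~` A `&` B) = (P B - P (A `&` B))%E.
    by rewrite setIC -setDE measureD// ?(setIC A)// ltey_eq fin_num_measure.
  have -> : P (~` A) = (1 - P A)%E by exact: probability_setC.
  by rewrite AB muleBl ?fin_num_measure ?mul1e// fin_num_adde_defr.
- have mF i : measurable (F i) by case: (FB i).
  split; first exact: bigcup_measurable.
  have -> : P (\bigcup_k F k `&` B) = (\sum_(0 <= i <oo) P (F i `&` B))%E.
    rewrite setI_bigcupl measure_semi_bigcup//.
    + by move=> i; exact: measurableI.
    + exact: trivIset_setIr.
    + by apply: bigcup_measurable => i _; exact: measurableI.
  have -> : P (\bigcup_k F k) = (\sum_(0 <= i <oo) P (F i))%E.
    by rewrite measure_semi_bigcup//; exact: bigcup_measurable.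
  rewrite -(fineK (fin_num_measure P B mB)) muleC -nneseriesZl//.
  by apply: eq_eseriesr => i _; rewrite muleC fineK ?fin_num_measure//; case: (FB i).
Qed.
End PiLambda.

Section BrownianPast.
Context {R : realType} {d : measure_display} {Omega : measurableType d}.
Variables (P : probability Omega R) (z : R * R) (W : R -> Omega -> R * R).
Hypothesis WB : is_brownian2 P z W.

Definition grid (s : R) (n i : nat) : R := s * (i%:R / 2 ^+ n).

Definition grid_increment (s : R) (n i : nat) (w : Omega) : R * R :=
  W (grid s n i.+1) w - W (grid s n i) w.

(** All increments of level [n] are constrained at once: this makes the family stable under
    intersections and matches the form of [mutually_independent]. *)
Definition grid_cylinders (s : R) (n : nat) : set (set Omega) :=
  [set E | exists2 B : 'I_(2 ^ n) -> set (R * R), forall i, measurable (B i)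
         & E = [set w | forall i : 'I_(2 ^ n), B i (grid_increment s n i w)]].

(** Only increments enter, because these are what the independence clause controls. The union over
    the levels need not be a sigma-algebra, but it is stable under intersections since the levels
    are nested. *)
Definition past_events (s : R) : set (set Omega) :=
  \bigcup_n <<s grid_cylinders s n >>.

Lemma grid0 s n : grid s n 0 = 0. Proof. by rewrite /grid mul0r mulr0. Qed.

Lemma grid_top s n : grid s n (2 ^ n) = s.
Proof. by rewrite /grid natrX divff ?mulr1// expf_neq0. Qed.

Lemma grid_ge0 s n i : 0 <= s -> 0 <= grid s n i.
Proof. by move=> s0; rewrite mulr_ge0// divr_ge0// exprn_ge0. Qed.

Lemma grid_lt s n i : 0 < s -> grid s n i < grid s n i.+1.
Proof. by move=> s0; rewrite ltr_pM2l// ltr_pM2r ?ltr_nat// invr_gt0 exprn_gt0. Qed.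

Lemma grid_double s n i : grid s n i = grid s n.+1 i.*2.
Proof.
rewrite /grid -muln2 natrM exprS; congr (_ * _); field.
by rewrite expf_neq0.
Qed.

Lemma measurable_increment u v : 0 <= u -> 0 <= v ->
  measurable_fun setT (fun w => W u w - W v w).
Proof.
move=> u0 v0.
have /measurable_fun_pairP[mu1 mu2] := brownian2_measurable WB u0.
have /measurable_fun_pairP[mv1 mv2] := brownian2_measurable WB v0.
by apply/measurable_fun_pairP; split; apply: measurable_funB.
Qed.

Lemma measurable_past_event s E : 0 <= s -> past_events s E -> measurable E.
Proof.
move=> s0 [n _]; apply: smallest_sub E => [|E [B mB ->]].
  exact: sigma_algebra_measurable.
rewrite (_ : [set _ | _] = \bigcap_(i in [set: 'I_(2 ^ n)])
  (grid_increment s n i @^-1` B i)); last first.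
  by apply/seteqP; split => w /= h i; [move=> _|]; exact: h.
apply: fin_bigcap_measurable => // i _; rewrite -[X in measurable X]setTI.
by apply: measurable_increment => //; exact: grid_ge0.
Qed.

Lemma grid_cylinders_setI s n : setI_closed (grid_cylinders s n).
Proof.
move=> _ _ [A mA ->] [B mB ->]; exists (fun i => A i `&` B i).
  by move=> i; exact: measurableI.
by apply/seteqP; split => [w [hA hB] i|w h]; split=> // i; case: (h i).
Qed.

Lemma measurable_grid_increment s n (i : nat) : (i < 2 ^ n)%N ->
  measurable_fun setT (grid_increment s n i : g_sigma_algebraType (grid_cylinders s n) -> R * R).
Proof.
move=> ni _ B mB; rewrite setTI; apply: sub_gen_smallest.
exists (fun j : 'I_(2 ^ n) => if val j == i then B else setT).
  by move=> j; case: ifP.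
apply/seteqP; split => [w Bw j|w /(_ (Ordinal ni))]/=; last by rewrite eqxx.
by case: ifPn => // /eqP ->.
Qed.

(** Each dyadic increment is the sum of its two halves at the next level. *)
Lemma grid_cylinders_refine s n :
  <<s grid_cylinders s n >> `<=` <<s grid_cylinders s n.+1 >>.
Proof.
apply: smallest_sub; first exact: smallest_sigma_algebra.
move=> _ [B mB ->].
rewrite (_ : [set _ | _] = \bigcap_(i in [set: 'I_(2 ^ n)])
  (grid_increment s n i @^-1` B i)); last first.
  by apply/seteqP; split => w /= h i; [move=> _|]; exact: h.
apply: (@fin_bigcap_measurable _ (g_sigma_algebraType (grid_cylinders s n.+1))) => // i _.
rewrite -[X in measurable X]setTI.
have i1 : (i.*2.+1 < 2 ^ n.+1)%N by rewrite expnS mul2n -doubleS leq_double.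
have i0 : (i.*2 < 2 ^ n.+1)%N by exact: ltnW.
have /measurable_fun_pairP[m11 m12] := @measurable_grid_increment s n.+1 _ i1.
have /measurable_fun_pairP[m01 m02] := @measurable_grid_increment s n.+1 _ i0.
have iE w : grid_increment s n i w =
    grid_increment s n.+1 i.*2 w + grid_increment s n.+1 i.*2.+1 w.
  by rewrite /grid_increment !(grid_double s n) doubleS [RHS]addrC addrA subrK.
suff mi : measurable_fun setT (grid_increment s n i :
    g_sigma_algebraType (grid_cylinders s n.+1) -> R * R) by exact: mi.
apply/measurable_fun_pairP; split.
  rewrite (_ : _ \o _ = (fst \o grid_increment s n.+1 i.*2) \+
     (fst \o grid_increment s n.+1 i.*2.+1)); first exact: measurable_funD.
  by apply/funext => w; rewrite /comp iE.
rewrite (_ : _ \o _ = (snd \o grid_increment s n.+1 i.*2) \+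
   (snd \o grid_increment s n.+1 i.*2.+1)); first exact: measurable_funD.
by apply/funext => w; rewrite /comp iE.
Qed.

Lemma grid_cylinders_nondecreasing s m n : (m <= n)%N ->
  <<s grid_cylinders s m >> `<=` <<s grid_cylinders s n >>.
Proof.
move=> /subnK <-; elim: (n - m)%N => // k IH.
by rewrite addSn; apply: subset_trans IH _; exact: grid_cylinders_refine.
Qed.

Lemma past_events_setI s : setI_closed (past_events s).
Proof.
move=> A B [m _ mA] [n _ nB]; exists (maxn m n) => //.
apply: (@measurableI _ (g_sigma_algebraType (grid_cylinders s (maxn m n)))).
  by apply: grid_cylinders_nondecreasing mA; exact: leq_maxl.
by apply: grid_cylinders_nondecreasing nB; exact: leq_maxr.
Qed.

(** Two pi-lambda arguments: from the cylinders of one level to the sigma-algebra of that level,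
    then from the union of the levels to what it generates. For a cylinder, the step from [s] to [t]
    is one more independent increment after those of the grid. *)
Lemma past_events_indep s t E B : 0 < s -> s < t -> measurable B ->
  <<s past_events s >> E ->
  P (E `&` (fun w => W t w - W s w) @^-1` B) = (P E * normal2 (t - s) B)%E.
Proof.
move=> s0 st mB.
have mxiB : measurable ((fun w => W t w - W s w) @^-1` B).
  rewrite -[X in measurable X]setTI; apply: measurable_increment => //.
    exact: ltW (lt_trans s0 st). exact: ltW.
rewrite -(brownian2_increment_law WB (ltW s0) st mB).
apply: indep_sigma_algebra => //; first exact: past_events_setI.
  by move=> A /measurable_past_event; apply; exact: ltW.
move=> {}E [n _]; apply: indep_sigma_algebra => //.
- exact: grid_cylinders_setI.
- by move=> A CA; apply: (@measurable_past_event s); [exact: ltW|exists n => //; exact: sub_gen_smallest].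
move=> _ [A mA ->].
(* The independence clause speaks of infinite increasing sequences of times, so the grid is
   continued by [t], [t + 1] and so on; the increment of index [2 ^ n] is then the one from [s] to
   [t]. *)
pose tau (i : nat) : R := if (i <= 2 ^ n)%N then grid s n i else t + (i - (2 ^ n).+1)%:R.
have tau_lt i : tau i < tau i.+1.
  rewrite /tau; case: (ltnP i (2 ^ n)) => ni.
    by rewrite (ltnW ni); exact: grid_lt.
  case: ifPn => [ni'|ni'].
    have -> : i = (2 ^ n)%N by apply/eqP; rewrite eqn_leq ni'.
    by rewrite grid_top subnn addr0.
  by rewrite ltrD2l ltr_nat subSS subnS ltn_predL subn_gt0 ltnNge.
have tau0 : 0 <= tau 0%N by rewrite /tau leq0n grid0.
pose A' (i : 'I_(2 ^ n).+1) := if unlift ord_max i is Some j then A j else B.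
have mA' i : measurable (A' i) by rewrite /A'; case: unlift.
(* The clause is used with and without the last increment, and the two products are compared. *)
have /= := brownian2_increment_indep WB tau0 tau_lt mA'.
rewrite big_ord_recr/=.
have := brownian2_increment_indep WB tau0 tau_lt mA.
have incE (i : nat) w : (i < 2 ^ n)%N -> W (tau i.+1) w - W (tau i) w = grid_increment s n i w.
  by move=> ni; rewrite /tau ni (ltnW ni).
have inc_top w : W (tau (2 ^ n).+1) w - W (tau (2 ^ n)%N) w = W t w - W s w.
  by rewrite /tau ltnn leqnn grid_top subnn addr0.
rewrite (_ : [set _ | _] = [set w | forall i : 'I_(2 ^ n), A i (grid_increment s n i w)]); last first.
  by apply/seteqP; split => w /= h i; move: (h i); rewrite incE.
rewrite (_ : [set w : Omega | forall i : 'I_(2 ^ n).+1, _] =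
   [set w | forall i : 'I_(2 ^ n), A i (grid_increment s n i w)] `&`
   (fun w => W t w - W s w) @^-1` B); last first.
  apply/seteqP; split => [w /= h|w /= [hA hB] i].
    split=> [i|]; last by have := h ord_max; rewrite /A' unlift_none inc_top.
    by have := h (lift ord_max i); rewrite /A' liftK lift_max incE.
  rewrite /A'; case: unliftP => [j ->|->]; last by rewrite inc_top.
  by rewrite lift_max incE.
move=> -> ->; congr (_ * _)%E; last first.
  by rewrite /A' unlift_none; congr (P _); apply/seteqP; split => w /=; rewrite inc_top.
apply: eq_bigr => i _; congr (P _).
have wi : widen_ord (leqnSn (2 ^ n)) i = lift ord_max i.
  by apply: val_inj => /=; rewrite /bump leqNgt ltn_ord.
by rewrite /A' wi liftK.
Qed.

End BrownianPast.

Section Trajectory.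
Context {R : realType} {d : measure_display} {Omega : measurableType d}.
Variables (P : probability Omega R) (z : R * R) (W : R -> Omega -> R * R).
Hypothesis WB : is_brownian2 P z W.

(* A version of the Brownian motion that starts at z for every outcome and is
   constant at negative times. *)
Definition trajectory (t : R) (w : Omega) : R * R :=
  z + (W (Num.max t 0) w - W 0 w).

(** Paths are continuous only relative to the nonnegative times; freezing negative times at 0 gives
    continuity on the whole line, which the joint measurability lemma asks for. *)
Lemma continuous_at_max0 w : continuous (fun t : R => W (Num.max t 0) w).
Proof.
move=> t.
have /subspace_continuousP cW := @brownian2_continuous _ _ _ _ _ _ WB w.
have m0 : Num.max t 0 \in `[0, +oo[%R by rewrite in_itv/= andbT le_max lexx orbT.
have := cW _ m0; apply: cvg_comp => U /=; rewrite /within/= => hU.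
have cm : {for t, continuous (fun x : R => Num.max x 0)}.
  by apply: continuous_max; [exact: cvg_id|exact: cvg_cst].
have H : \forall x \near t, `[0, +oo[%classic (Num.max x 0) -> U (Num.max x 0) := cm _ hU.
suff : \forall x \near t, U (Num.max x 0) by [].
apply: filterS H => x /=; apply.
by rewrite in_itv/= andbT le_max lexx orbT.
Qed.

Lemma continuous_trajectory w :
  continuous (fun t => (trajectory t w).1) /\ continuous (fun t => (trajectory t w).2).
Proof.
have c1 : continuous (fun t : R => (W (Num.max t 0) w).1).
  by move=> t; exact: (cvg_comp _ _ (@continuous_at_max0 w t) cvg_fst).
have c2 : continuous (fun t : R => (W (Num.max t 0) w).2).
  by move=> t; exact: (cvg_comp _ _ (@continuous_at_max0 w t) cvg_snd).
split => t /=; apply: cvgD (cvg_cst _) _; apply: cvgB (cvg_cst _).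
  exact: c1.
exact: c2.
Qed.

Lemma measurable_trajectory t : measurable_fun setT (trajectory t).
Proof.
have t0 : 0 <= Num.max t 0 by rewrite le_max lexx orbT.
have /measurable_fun_pairP[m1 m2] := measurable_increment WB t0 (lexx 0).
by apply/measurable_fun_pairP; split; apply: measurable_funD.
Qed.

(** At a dyadic time the position is the constant [z] plus finitely many increments of the past;
    every other time up to [s] is a limit of dyadic ones, and paths are continuous. *)
Lemma measurable_trajectory_past s t : 0 < s -> t <= s ->
  measurable_fun setT (trajectory t : g_sigma_algebraType (past_events W s) -> R * R).
Proof.
move=> s0 ts.
have mgrid n k : (k <= 2 ^ n)%N ->
    measurable_fun setT (trajectory (grid s n k) : g_sigma_algebraType (past_events W s) -> R * R).
  elim: k => [_|k IH kn].
    rewrite (_ : trajectory _ = cst z)//.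
    by apply/funext => w; rewrite /trajectory grid0 maxxx subrr addr0.
  have /measurable_fun_pairP[m1 m2] := IH (ltnW kn).
  have mi : measurable_fun setT (grid_increment W s n k : g_sigma_algebraType (past_events W s) -> R * R).
    move=> _ B mB; apply: sub_gen_smallest; exists n => //.
    exact: (@measurable_grid_increment _ _ _ W s n k kn measurableT B mB).
  move/measurable_fun_pairP : mi => [i1 i2].
  have trE w : trajectory (grid s n k.+1) w = trajectory (grid s n k) w + grid_increment W s n k w.
    rewrite /trajectory /grid_increment !max_l ?grid_ge0 ?(ltW s0)// -!addrA; congr (_ + _).
    by rewrite [RHS]addrCA (addrC (W (grid s n k) w)) subrK addrC.
  apply/measurable_fun_pairP; split.
    rewrite (_ : _ \o _ = (fst \o trajectory (grid s n k)) \+ (fst \o grid_increment W s n k)).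
      exact: measurable_funD.
    by apply/funext => w; rewrite /comp trE.
  rewrite (_ : _ \o _ = (snd \o trajectory (grid s n k)) \+ (snd \o grid_increment W s n k)).
    exact: measurable_funD.
  by apply/funext => w; rewrite /comp trE.
have [t0|t0] := leP t 0.
  rewrite (_ : trajectory _ = cst z)//.
  by apply/funext => w; rewrite /trajectory max_r// subrr addr0.
pose k n := Num.trunc (t / s * 2 ^+ n).
have ts0 n : 0 <= t / s * 2 ^+ n by rewrite mulr_ge0 ?exprn_ge0// divr_ge0 ?ltW.
have kn n : (k n <= 2 ^ n)%N.
  rewrite -(ler_nat R) (le_trans _ (_ : t / s * 2 ^+ n <= _))//.
    by have /andP[] := truncn_itv (ts0 n).
  by rewrite natrX ger_pMl ?exprn_gt0// ler_pdivrMr// mul1r.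
have gt : grid s n (k n) @[n --> \oo] --> t.
  (* [cvg_floor_grid] divides by [n.+1], so its subsequence along [(2 ^ n).-1] is the dyadic
     grid. *)
  have cN : (2 ^ n).-1 @[n --> \oo] --> \oo.
    apply/cvgnyPge => A; near=> n; apply: (@leq_trans n).
      by near: n; exact: nbhs_infty_ge.
    by rewrite -ltnS prednK ?expn_gt0// ltn_expl.
  have := cvg_comp _ _ cN (@cvg_floor_grid R (t / s)).
  move=> /(cvgM (cvg_cst s)); rewrite mulrCA divff ?gt_eqF// mulr1.
  apply: cvg_trans; apply: near_eq_cvg; near=> n.
  rewrite /grid /k truncn_floor ts0 /= prednK ?expn_gt0// natrX natr_absz ger0_norm//.
  by rewrite floor_ge0.
have mk n := iffLR (measurable_fun_pairP _) (mgrid n _ (kn n)).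
apply/measurable_fun_pairP; split.
  apply: (@measurable_fun_cvg _ (g_sigma_algebraType (past_events W s)) R setT
    (fun n => fst \o trajectory (grid s n (k n))) (fst \o trajectory t)).
    by move=> n; case: (mk n).
  by move=> w _; exact: (cvg_comp _ _ gt ((continuous_trajectory w).1 t)).
apply: (@measurable_fun_cvg _ (g_sigma_algebraType (past_events W s)) R setT
    (fun n => snd \o trajectory (grid s n (k n))) (snd \o trajectory t)).
  by move=> n; case: (mk n).
by move=> w _; exact: (cvg_comp _ _ gt ((continuous_trajectory w).2 t)).
Unshelve. all: by end_near. Qed.
End Trajectory.

Definition heat {R : realType} (r : R) (h : R * R -> \bar R) (x : R * R) : \bar R :=
  (\int[normal_prob 0 (Num.sqrt r) \x normal_prob 0 (Num.sqrt r)]_y h (x + y)%R)%E.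

Section Markov.
Context {R : realType} {d : measure_display} {Omega : measurableType d}.
Variables (P : probability Omega R) (z : R * R) (W : R -> Omega -> R * R).
Hypothesis WB : is_brownian2 P z W.
Local Notation X := (trajectory z W).

Lemma trajectory_ae : {ae P, forall w, forall t, 0 <= t -> X t w = W t w}.
Proof.
apply: filterS (brownian2_start WB) => w W0 t t0.
by rewrite /trajectory max_l// W0 addrC subrK.
Qed.

Lemma measurable_trajectory2 : measurable_fun setT (fun p : R * Omega => X p.1 p.2).
Proof.
have m t := iffLR (measurable_fun_pairP _) (measurable_trajectory WB t).
apply/measurable_fun_pairP; split.
  apply: (measurable_fun_caratheodory (X := fun t w => (X t w).1)).
    by move=> t; exact: (m t).1.
  by move=> w; exact: (continuous_trajectory WB w).1.
apply: (measurable_fun_caratheodory (X := fun t w => (X t w).2)).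
  by move=> t; exact: (m t).2.
by move=> w; exact: (continuous_trajectory WB w).2.
Qed.

(** Stopping the clock at [s] keeps every time within the past. The integral that defines the weight
    at time [s] only sees the stopped path, which is how the weight becomes measurable for the
    past. *)
Lemma measurable_trajectory2_past s : 0 < s ->
  measurable_fun setT
   (fun p : R * g_sigma_algebraType (past_events W s) => X (Num.min p.1 s) p.2).
Proof.
move=> s0.
have ms t : Num.min t s <= s by rewrite ge_min lexx orbT.
have m t := iffLR (measurable_fun_pairP _) (measurable_trajectory_past WB s0 (ms t)).
have cm : continuous (fun t : R => Num.min t s).
  by move=> t; apply: continuous_min; [exact: cvg_id|exact: cvg_cst].
apply/measurable_fun_pairP; split.
  apply: (measurable_fun_caratheodory
    (X := fun t (w : g_sigma_algebraType (past_events W s)) => (X (Num.min t s) w).1)).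
    by move=> t; exact: (m t).1.
  by move=> w t; exact: (cvg_comp _ _ (cm t) ((continuous_trajectory WB w).1 _)).
apply: (measurable_fun_caratheodory
  (X := fun t (w : g_sigma_algebraType (past_events W s)) => (X (Num.min t s) w).2)).
  by move=> t; exact: (m t).2.
by move=> w t; exact: (cvg_comp _ _ (cm t) ((continuous_trajectory WB w).2 _)).
Qed.

Lemma measurable_fun_addpair d' (T : measurableType d') (f g : T -> R * R) :
  measurable_fun setT f -> measurable_fun setT g ->
  measurable_fun setT (fun x => f x + g x).
Proof.
move=> /measurable_fun_pairP[f1 f2] /measurable_fun_pairP[g1 g2].
by apply/measurable_fun_pairP; split; apply: measurable_funD.
Qed.

(** The increment from [s] to [t] is independent of the past, so it is integrated out with [Y] and
    the position at time [s] frozen; the inner Gaussian integral is [heat]. *)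
Lemma markov_property s t (Y : g_sigma_algebraType (past_events W s) -> \bar R)
    (h : R * R -> \bar R) : 0 < s -> s < t ->
  measurable_fun setT Y -> (forall w, (0 <= Y w)%E) ->
  measurable_fun setT h -> (forall x, (0 <= h x)%E) ->
  (\int[P]_w (Y w * h (X t w)) = \int[P]_w (Y w * heat (t - s) h (X s w)))%E.
Proof.
move=> s0 st mY Y0 mh h0.
pose nu : probability (measurableTypeR R * measurableTypeR R)%type R :=
  [the probability _ _ of (normal_prob 0 (Num.sqrt (t - s)) \x
                           normal_prob 0 (Num.sqrt (t - s)))%E].
have mX := measurable_trajectory_past WB s0 (lexx s).
pose H (p : g_sigma_algebraType (past_events W s) *
   (measurableTypeR R * measurableTypeR R)) := (Y p.1 * h (X s p.1 + p.2)%R)%E.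
have XE w : X t w = X s w + (W t w - W s w).
  have t0 := lt_trans s0 st.
  rewrite /trajectory !max_l ?ltW// -!addrA; congr (_ + _).
  by rewrite [RHS]addrCA (addrC (W s w)) subrK addrC.
transitivity (\int[P]_w H (w, (W t w - W s w)%R))%E.
  by apply: eq_integral => w _; rewrite /H XE.
rewrite (@ge0_integral_indep _ _ _ _ _ P nu (past_events W s)).
- apply: eq_integral => w _; rewrite /H/= ge0_integralZl//.
  exact: (measurableT_comp mh (measurable_fun_addpair
    (measurable_cst (X s w)) (@measurable_id _ (R * R)%type setT))).
- by move=> E; apply: (measurable_past_event WB); exact: ltW.
- by apply: (measurable_increment WB); apply: ltW => //; exact: lt_trans st.
- move=> E B EG mB; exact: (past_events_indep WB s0 st mB EG).
- apply: emeasurable_funM; first exact: measurableT_comp measurable_fst.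
  apply: (measurableT_comp mh); apply: measurable_fun_addpair.
    exact: measurableT_comp mX measurable_fst.
  exact: measurable_snd.
- by move=> [w y]; exact: mule_ge0.
Qed.
End Markov.

(** * The exponential of a bounded additive functional *)

Section BoundedIntegrand.
Context {d : measure_display} {T : measurableType d} {R : realType}.
Variables (mu : {measure set T -> \bar R}) (D : set T).
Hypotheses (mD : measurable D) (muD : (mu D < +oo)%E).

Lemma integrable_le_cst (f : T -> R) (C : R) : measurable_fun D f ->
  (forall x, D x -> `|f x| <= C) -> mu.-integrable D (EFin \o f).
Proof.
move=> mf fC; apply: measurable_bounded_integrable => //.
exists C; split; first exact: num_real.
by move=> y Cy x Dx; exact: le_trans (fC x Dx) (ltW Cy).
Qed.

Lemma normr_Rintegral_le_cst (f : T -> R) (C : R) : measurable_fun D f ->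
  (forall x, D x -> `|f x| <= C) -> `|\int[mu]_(x in D) f x| <= C * fine (mu D).
Proof.
move=> mf fC; have fi := integrable_le_cst mf fC.
apply: le_trans (le_normr_Rintegral mD fi) _.
rewrite -(Rintegral_cst mu mD); apply: le_Rintegral => //.
  exact: integrable_norm.
have C0 x : D x -> 0 <= C by move=> /fC; exact: le_trans.
apply: (@integrable_le_cst _ C) => // x Dx.
by rewrite ger0_norm// (C0 x).
Qed.

End BoundedIntegrand.

Section ExponentialTaylor.
Context {R : realType}.

Lemma expR_dist_le (a b M : R) : a <= M -> b <= M ->
  `|expR a - expR b| <= expR M * `|a - b|.
Proof.
wlog ba : a b / b <= a.
  move=> wl aM bM; have [ba|/ltW ab] := leP b a; first exact: wl.
  by rewrite distrC (distrC a); exact: wl.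
move=> aM bM; rewrite !ger0_norm ?subr_ge0 ?ler_expR//.
apply: (@le_trans _ _ (expR a * (a - b))).
  have -> : expR b = expR a * expR (b - a) by rewrite -expRD addrC subrK.
  rewrite -[X in X - _]mulr1 -mulrBr ler_wpM2l ?expR_ge0//.
  by have := expR_ge1Dx (b - a); lra.
by rewrite ler_wpM2r ?subr_ge0// ler_expR.
Qed.

Lemma expR_taylor1_le (a b M : R) : a <= M -> b <= M ->
  `|expR a - expR b - expR b * (a - b)| <= expR M * `|a - b| ^+ 2.
Proof.
move=> aM bM; set x := a - b.
have -> : expR a = expR b * expR x by rewrite -expRD /x addrC subrK.
have h1 : 0 <= expR x - 1 - x.
  by rewrite subr_ge0 lerBrDl expR_ge1Dx.
(* Equivalent to [(1 - x) * expR x <= 1], whatever the sign of [x]. It reduces the second-order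
   remainder to [x] times a first-order difference. *)
have h2 : expR x - 1 - x <= x * (expR x - 1).
  have := expR_ge1Dx (- x); rewrite expRN => h3.
  have h4 : (1 - x) * expR x <= 1.
    by rewrite -ler_pdivlMr ?expR_gt0// div1r.
  nra.
have -> : expR b * expR x - expR b - expR b * x = expR b * (expR x - 1 - x) by ring.
rewrite normrM (ger0_norm (expR_ge0 _)) (ger0_norm h1).
apply: (@le_trans _ _ (expR b * (`|x| * `|expR x - 1|))).
  by rewrite ler_wpM2l ?expR_ge0// (le_trans h2)// -normrM ler_norm.
rewrite mulrCA expr2 [leRHS]mulrCA ler_wpM2l//.
rewrite -{1}(ger0_norm (expR_ge0 b)) -normrM mulrBr mulr1 -expRD /x (addrC b) subrK.
exact: expR_dist_le.
Qed.
End ExponentialTaylor.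

Section ExponentialPrimitive.
Context {R : realType}.
Variables (v : R -> R) (K : R).
Hypotheses (mv : measurable_fun setT v) (vK : forall s, `|v s| <= K).
Local Notation mu := (@lebesgue_measure R).

Let K0 : 0 <= K. Proof. exact: le_trans (vK 0). Qed.

Definition primitive (t : R) : R := \int[mu]_(s in `[0, t]) v s.

Lemma fine_lebesgue_oc (s t : R) : s <= t -> fine (mu `]s, t]%classic) = t - s.
Proof.
move=> st; rewrite lebesgue_measure_itv/= lte_fin; case: ltP => //= ts.
by have -> : s = t by [apply/eqP; rewrite eq_le st ts]; rewrite subrr.
Qed.

Lemma Rintegral_increment (f : R -> R) (C s t : R) : measurable_fun setT f ->
  (forall x, x <= t -> `|f x| <= C) -> 0 <= s -> s <= t ->
  \int[mu]_(x in `[0, t]) f x - \int[mu]_(x in `[0, s]) f x =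
    \int[mu]_(x in `]s, t]) f x.
Proof.
move=> mf fC s0 st; rewrite Rintegral_itvB ?bnd_simp//.
apply: (@integrable_le_cst _ _ _ _ _ _ _ _ C) => //.
- by rewrite /= lebesgue_measure_itv/=; case: ifP => _; rewrite ?ltry// -EFinB ltry.
- exact: measurable_funTS.
- by move=> x /=; rewrite in_itv/= => /andP[_ /fC].
Qed.

Lemma normr_Rintegral_oc (f : R -> R) (C s t : R) : measurable_fun setT f ->
  (forall x, s < x -> x <= t -> `|f x| <= C) -> s <= t ->
  `|\int[mu]_(x in `]s, t]) f x| <= C * (t - s).
Proof.
move=> mf fC st; rewrite -(fine_lebesgue_oc st).
apply: normr_Rintegral_le_cst => //.
- by rewrite /= lebesgue_measure_itv/=; case: ifP => _; rewrite ?ltry// -EFinB ltry.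
- exact: measurable_funTS.
- by move=> x /=; rewrite in_itv/= => /andP[sx xt]; exact: fC.
Qed.

Lemma primitive_neg t : t < 0 -> primitive t = 0.
Proof. by move=> t0; rewrite /primitive set_itv_ge ?Rintegral_set0// bnd_simp -ltNge. Qed.

Lemma primitive0 : primitive 0 = 0.
Proof. by rewrite /primitive set_itv1 Rintegral_set1. Qed.

Lemma primitive_lipschitz s t : s <= t -> `|primitive t - primitive s| <= K * (t - s).
Proof.
have pos r u : 0 <= r -> r <= u -> `|primitive u - primitive r| <= K * (u - r).
  move=> r0 ru; rewrite /primitive (@Rintegral_increment v K)//.
  exact: normr_Rintegral_oc.
move=> st; have [s0|s0] := leP 0 s; first exact: pos.
rewrite (primitive_neg s0); have [t0|t0] := leP 0 t.
  by rewrite -primitive0 (le_trans (pos 0 t _ _))// ler_wpM2l// lerD2l lerN2 ltW.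
by rewrite (primitive_neg t0) subrr normr0 mulr_ge0// subr_ge0.
Qed.

Lemma primitive_le t : 0 <= t -> primitive t <= K * t.
Proof.
move=> t0; apply: le_trans (ler_norm _) _.
by have := primitive_lipschitz t0; rewrite primitive0 !subr0.
Qed.

Lemma continuous_primitive : continuous primitive.
Proof.
have lip t s : `|primitive t - primitive s| <= (K + 1) * `|t - s|.
  wlog st : s t / s <= t.
    move=> wl; have [|/ltW] := leP s t; first exact: wl.
    by move=> /wl; rewrite distrC (distrC t).
  apply: (le_trans (primitive_lipschitz st)).
  by rewrite ger0_norm ?subr_ge0// ler_wpM2r ?subr_ge0// lerDl.
move=> t; apply/cvgrPdist_le => e e0.
have K1 : 0 < K + 1 by rewrite ltr_wpDl.
near=> s; apply: (le_trans (lip t s)).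
rewrite -ler_pdivlMl//; near: s.
by apply: cvgr_dist_le; rewrite ?mulr_gt0 ?invr_gt0//; exact: cvg_id.
Unshelve. all: by end_near. Qed.

Lemma measurable_expR_primitive : measurable_fun setT (fun s => expR (primitive s)).
Proof.
by apply: measurableT_comp => //; apply: continuous_measurable_fun; exact: continuous_primitive.
Qed.

End ExponentialPrimitive.

Section ExponentialIdentity.
Context {R : realType}.
Variables (v : R -> R) (K : R).
Hypotheses (mv : measurable_fun setT v) (vK : forall s, `|v s| <= K).
Local Notation mu := (@lebesgue_measure R).
Local Notation A := (primitive v).

Let K0 : 0 <= K. Proof. exact: le_trans (vK 0). Qed.

Let mA := measurable_expR_primitive mv vK.

Let mvA : measurable_fun setT (fun s => v s * expR (A s)).
Proof. exact: measurable_funM. Qed.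

Let mcv c : measurable_fun setT (fun x => c * v x).
Proof. exact: measurable_funM (measurable_cst _) mv. Qed.

(** The quantity that has to vanish. As [v] is merely measurable, [A] need not be differentiable at
    every point, and the proof works with increments instead of derivatives. *)
Let defect (t : R) := expR (A t) - 1 - \int[mu]_(s in `[0, t]) (v s * expR (A s)).

Let A_le t x : 0 <= t -> x <= t -> A x <= K * t.
Proof.
move=> t0 xt; have [x0|x0] := leP 0 x.
  by apply: (le_trans (primitive_le mv vK x0)); rewrite ler_wpM2l.
by rewrite primitive_neg// mulr_ge0.
Qed.

Let vA_le t x : 0 <= t -> x <= t -> `|v x * expR (A x)| <= K * expR (K * t).
Proof.
move=> t0 xt; rewrite normrM (ger0_norm (expR_ge0 _)) ler_pM ?expR_ge0//.
by rewrite ler_expR A_le.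
Qed.

Let defect_quadratic t s u : 0 <= t -> 0 <= s -> s <= u -> u <= t ->
  `|defect u - defect s| <= expR (K * t) * (K ^+ 2 *+ 2) * (u - s) ^+ 2.
Proof.
move=> t0 s0 su ut; have st := le_trans su ut.
have us0 : 0 <= u - s by rewrite subr_ge0.
have int_oc (f : R -> R) C : measurable_fun setT f ->
   (forall x, s < x -> x <= u -> `|f x| <= C) -> mu.-integrable `]s, u] (EFin \o f).
  move=> mf fC; apply: (@integrable_le_cst _ _ _ _ _ _ _ _ C) => //.
  - by rewrite /= lebesgue_measure_itv/=; case: ifP => _; rewrite ?ltry// -EFinB ltry.
  - exact: measurable_funTS.
  - by move=> x /=; rewrite in_itv/= => /andP[sx xu]; exact: fC.
have dA : A u - A s = \int[mu]_(x in `]s, u]) v x by exact: (@Rintegral_increment _ v K).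
have dvA : \int[mu]_(x in `[0, u]) (v x * expR (A x)) - \int[mu]_(x in `[0, s]) (v x * expR (A x)) =
   \int[mu]_(x in `]s, u]) (v x * expR (A x)).
  apply: (@Rintegral_increment _ _ (K * expR (K * t))) => // x xu.
  by apply: vA_le => //; exact: le_trans xu ut.
(* The first order in [A u - A s] cancels. What remains is the Taylor remainder of the exponential
   and the error of freezing [expR (A x)] at [x = s], each at most
   [expR (K * t) * K ^+ 2 * (u - s) ^+ 2]. *)
have -> : defect u - defect s = (expR (A u) - expR (A s) - expR (A s) * (A u - A s)) -
   \int[mu]_(x in `]s, u]) (v x * expR (A x) - expR (A s) * v x).
  rewrite RintegralB//; last 2 first.
  - apply: (int_oc _ (K * expR (K * t))) => // x _ xu.
    by apply: vA_le => //; exact: le_trans xu ut.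
  - apply: (int_oc _ (expR (A s) * K)); first exact: mcv.
    by move=> x _ _; rewrite normrM (ger0_norm (expR_ge0 _)) ler_wpM2l ?expR_ge0.
  rewrite RintegralZl//; last by apply: (int_oc _ K).
  rewrite -dA -dvA /defect; move: (expR (A u)) (expR (A s)) (Rintegral _ _ _) (Rintegral _ _ _) => a b c e.
  ring.
apply: (le_trans (ler_normB _ _)).
have -> : expR (K * t) * (K ^+ 2 *+ 2) * (u - s) ^+ 2 =
  expR (K * t) * (K * (u - s)) ^+ 2 + K * (expR (K * t) * (K * (u - s))) * (u - s) by ring.
apply: lerD.
  apply: (le_trans (@expR_taylor1_le _ _ _ (K * t) _ _)); try exact: A_le.
  by rewrite ler_wpM2l ?expR_ge0// lerXn2r ?nnegrE ?mulr_ge0//; exact: (primitive_lipschitz mv vK).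
apply: normr_Rintegral_oc => //.
  exact: (measurable_funB mvA (mcv _)).
move=> x sx xu; have xt := le_trans xu ut.
rewrite mulrC -mulrBl normrM mulrC ler_pM//.
apply: (le_trans (@expR_dist_le _ _ _ (K * t) _ _)); try exact: A_le.
rewrite ler_wpM2l ?expR_ge0// (le_trans (primitive_lipschitz mv vK (ltW sx)))//.
by rewrite ler_wpM2l// lerD2r.
Qed.

(** Quadratic increments over [n.+1] equal steps add up to a quantity of order [n.+1%:R^-1]. *)
Let defect0 t : 0 <= t -> defect t = 0.
Proof.
move=> t0; set C := expR (K * t) * (K ^+ 2 *+ 2).
have d0 : defect 0 = 0 by rewrite /defect primitive0 expR0 set_itv1 Rintegral_set1 !subrr.
have C0 : 0 <= C by rewrite mulr_ge0 ?expR_ge0// mulrn_wge0 ?sqr_ge0.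
have bound n : `|defect t| <= C * t ^+ 2 / n.+1%:R.
  pose p (i : nat) := t * (i%:R / n.+1%:R).
  have p0 : p 0%N = 0 by rewrite /p mul0r mulr0.
  have pn : p n.+1 = t by rewrite /p divff ?mulr1.
  have -> : defect t = \sum_(0 <= i < n.+1) (defect (p i.+1) - defect (p i)).
    by rewrite telescope_sumr// pn p0 d0 subr0.
  have pS i : p i.+1 - p i = t / n.+1%:R by rewrite /p -mulrBr -mulrBl -natr1 addrAC subrr add0r mul1r.
  apply: (le_trans (ler_norm_sum _ _ _)).
  apply: (@le_trans _ _ (\sum_(0 <= i < n.+1) C * (t / n.+1%:R) ^+ 2)).
    rewrite !big_nat; apply: ler_sum => i /andP[_ ni].
    rewrite -(pS i); apply: defect_quadratic => //.
    - by rewrite mulr_ge0// divr_ge0.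
    - by rewrite -subr_ge0 pS divr_ge0.
    - by rewrite ler_piMr// ler_pdivrMr// mul1r ler_nat.
  rewrite sumr_const_nat subn0 -mulr_natr; rewrite le_eqVlt; apply/orP; left; apply/eqP.
  have : n.+1%:R != 0 :> R by rewrite pnatr_eq0.
  move=> N0; rewrite ?mul1r -[LHS]mulr_natr.
  have fld (a b N : R) : N != 0 -> a * (b / N) ^+ 2 * N = a * b ^+ 2 / N by move=> h; field.
  exact: fld.
apply/eqP; rewrite -normr_le0; apply/ler_addgt0Pr => e e0; rewrite add0r.
pose n := Num.trunc (C * t ^+ 2 / e).
apply: (le_trans (bound n)); rewrite ler_pdivrMr// -ler_pdivrMl// mulrC.
exact: ltW (truncnS_gt _).
Qed.

(** The negative part of [v] stands on the left, so that both sides are sums of nonnegative terms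
    and can be multiplied and integrated in the extended reals without any subtraction. *)
Lemma expR_primitiveE t : 0 <= t ->
  ((expR (A t))%:E + \int[mu]_(s in `[0%R, t]) (Num.max (- v s) 0 * expR (A s))%R%:E =
   1 + \int[mu]_(s in `[0%R, t]) (Num.max (v s) 0 * expR (A s))%R%:E)%E.
Proof.
move=> t0; have := defect0 t0; rewrite /defect.
have mtop : (mu `[0%R, t]%classic < +oo)%E.
  by rewrite /= lebesgue_measure_itv/=; case: ifP => _; rewrite ?ltry// -EFinB ltry.
have int_pos (f : R -> R) : measurable_fun setT f -> (forall x, `|f x| <= K) ->
   mu.-integrable `[0, t] (fun s => (f s * expR (A s))%:E).
  move=> mf fK; apply: (@integrable_le_cst _ _ _ _ _ _ _ _ (K * expR (K * t))) => //.
    by apply: measurable_funTS; exact: measurable_funM.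
  move=> x /=; rewrite in_itv/= => /andP[_ xt].
  by rewrite normrM (ger0_norm (expR_ge0 _)) ler_pM ?expR_ge0// ler_expR A_le.
have mp : measurable_fun setT (fun s => Num.max (v s) 0) by apply: measurable_maxr.
have mn : measurable_fun setT (fun s => Num.max (- v s) 0).
  by apply: measurable_maxr => //; exact: measurableT_comp.
have bp x : `|Num.max (v x) 0| <= K.
  by rewrite ger0_norm ?le_max ?lexx ?orbT// ge_max K0 (le_trans (ler_norm _)).
have bn x : `|Num.max (- v x) 0| <= K.
  rewrite ger0_norm ?le_max ?lexx ?orbT// ge_max K0 andbT.
  by rewrite (le_trans (ler_norm _))// normrN.
have ip := int_pos _ mp bp; have i_n := int_pos _ mn bn.
rewrite -(fineK (integrable_fin_num _ ip))// -(fineK (integrable_fin_num _ i_n))//.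
rewrite -EFinD => h; rewrite -EFinD; congr EFin.
have : \int[mu]_(s in `[0, t]) (v s * expR (A s)) =
   \int[mu]_(s in `[0, t]) (Num.max (v s) 0 * expR (A s)) -
   \int[mu]_(s in `[0, t]) (Num.max (- v s) 0 * expR (A s)).
  rewrite -RintegralB//; apply: eq_Rintegral => s _; rewrite -mulrBl; congr (_ * _).
  by have [h1|h1] := leP (v s) 0; [rewrite max_l ?oppr_ge0// opprK add0r|rewrite max_r ?subr0// oppr_le0 ltW].
rewrite /Rintegral => h'; move: h; rewrite /Rintegral h'; lra.
Qed.
End ExponentialIdentity.

(** * Affine changes of variables, variants of Tonelli's theorem, densities and the Gaussian
    kernel *)

Lemma pushforward_measureP {d1 d2 : measure_display} {T1 : measurableType d1}
    {T2 : measurableType d2} {R : realType} (m : {measure set T1 -> \bar R}) (f : T1 -> T2) :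
  measurable_fun setT f ->
  {nu : {measure set T2 -> \bar R} | nu = pushforward m f :> (set T2 -> \bar R)}.
Proof. by move=> mf; unshelve eexists (pushforward m f). Qed.

Section LebesgueAffine.
Context {R : realType}.
Local Notation mR := (measurableTypeR R).
Local Notation mu := (@lebesgue_measure R).
Local Open Scope ereal_scope.

Lemma measurable_affine (a b : R) : measurable_fun [set: mR] (fun x : mR => (a * x + b)%R : mR).
Proof.
have h : measurable_fun [set: R] (fun x : R => (a * x + b)%R).
  by apply: measurable_funD => //; exact: mulrl_measurable.
exact: h.
Qed.

(** Both sides are measures, and they agree on half-open intervals, which determine Lebesgue
    measure. *)
Lemma lebesgue_measure_affine (a b : R) (A : set mR) : (0 < a)%R -> measurable A ->
  mu A = (a%:E * pushforward mu (fun x : mR => (a * x + b)%R : mR) A).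
Proof.
move=> a0 mA.
have [nu0 nu0E] := pushforward_measureP mu (measurable_affine a b).
pose nu := mscale (NngNum (ltW a0)) nu0.
rewrite (_ : _ * _ = nu A); last by rewrite /nu /mscale nu0E.
apply: lebesgue_measure_unique mA => _ [[c e]] _ <-.
rewrite /= /mscale/= nu0E /pushforward.
have -> : (fun x : mR => (a * x + b)%R) @^-1` `]c, e] = `]((c - b) / a)%R, ((e - b) / a)%R]%classic.
  by apply/seteqP; split => x /=; rewrite !in_itv/= ltr_pdivrMr// ler_pdivlMr// ltrBlDr lerBrDr (mulrC x).
rewrite /= !lebesgue_measure_itv/= !lte_fin ltr_pM2r ?invr_gt0// ltrD2r.
case: ifP => _; last by rewrite mule0.
by rewrite -!EFinB -EFinM; congr EFin; field; rewrite gt_eqF.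
Qed.

Lemma ge0_integral_affine (a b : R) (f : R -> \bar R) : (0 < a)%R ->
  measurable_fun setT f -> (forall x, 0 <= f x) ->
  \int[mu]_x f x = a%:E * \int[mu]_x f (a * x + b)%R.
Proof.
move=> a0 mf f0.
have [nu0 nu0E] := pushforward_measureP mu (measurable_affine a b).
have := ge0_integral_pushforward (measurable_affine a b) mu measurableT mf (fun y _ => f0 y).
rewrite preimage_setT => <-.
rewrite -nu0E -(ge0_integral_mscale nu0 measurableT (NngNum (ltW a0)) mf)//.
by apply: eq_measure_integral => A mA _; rewrite /= /mscale/= nu0E; apply: (lebesgue_measure_affine b a0 mA).
Qed.

Lemma ge0_integral_shift (b : R) (f : R -> \bar R) :
  measurable_fun setT f -> (forall x, 0 <= f x) ->
  \int[mu]_x f (x + b)%R = \int[mu]_x f x.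
Proof.
move=> mf f0; rewrite [RHS](@ge0_integral_affine 1%R b)// mul1e.
by apply: eq_integral => x _; rewrite mul1r.
Qed.

End LebesgueAffine.

Section TonelliVariants.
Local Open Scope ereal_scope.
Context {d1 d2 : measure_display} {T1 : measurableType d1} {T2 : measurableType d2} {R : realType}.
Variables (m1 : {sigma_finite_measure set T1 -> \bar R})
          (m2 : {sigma_finite_measure set T2 -> \bar R}).

Lemma ge0_fubini_domain (D : set T1) (E : set T2) (f : T1 * T2 -> \bar R) :
  measurable D -> measurable E -> measurable_fun setT f -> (forall p, 0 <= f p) ->
  \int[m1]_(x in D) \int[m2]_(y in E) f (x, y) =
  \int[m2]_(y in E) \int[m1]_(x in D) f (x, y).
Proof.
move=> mD mE mf f0; pose g := f \_ (D `*` E).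
have mg : measurable_fun setT g.
  by apply/(measurable_restrictT _ _).1; [exact: measurableX|exact: measurable_funTS].
have g0 p : 0 <= g p by rewrite /g patchE; case: ifP.
have E1 : \int[m1]_(x in D) \int[m2]_(y in E) f (x, y) = \int[m1]_x \int[m2]_y g (x, y).
  rewrite integral_mkcond; apply: eq_integral => x _; rewrite patchE.
  case: ifPn => xD.
    rewrite integral_mkcond; apply: eq_integral => y _.
    by rewrite /g !patchE in_setX xD.
  by rewrite integral0_eq// => y _; rewrite /g patchE in_setX (negbTE xD).
have E2 : \int[m2]_(y in E) \int[m1]_(x in D) f (x, y) = \int[m2]_y \int[m1]_x g (x, y).
  rewrite integral_mkcond; apply: eq_integral => y _; rewrite patchE.
  case: ifPn => yE.
    rewrite integral_mkcond; apply: eq_integral => x _.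
    by rewrite /g !patchE in_setX yE andbT.
  by rewrite integral0_eq// => x _; rewrite /g patchE in_setX (negbTE yE) andbF.
by rewrite E1 E2 fubini_tonelli.
Qed.

Lemma measurable_ge0_integral (E : set T2) (f : T1 * T2 -> \bar R) :
  measurable E -> measurable_fun setT f -> (forall p, 0 <= f p) ->
  measurable_fun setT (fun x => \int[m2]_(y in E) f (x, y)).
Proof.
move=> mE mf f0; pose g := f \_ (setT `*` E).
have mg : measurable_fun setT g.
  by apply/(measurable_restrictT _ _).1; [exact: measurableX|exact: measurable_funTS].
have g0 p : 0 <= g p by rewrite /g patchE; case: ifP.
rewrite (_ : (fun _ => _) = fubini_F m2 g); first exact: measurable_fun_fubini_tonelli_F.
apply/funext => x; rewrite integral_mkcond; apply: eq_integral => y _.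
by rewrite /g !patchE in_setX in_setT.
Qed.

Lemma measurable_Rintegral (E : set T2) (f : T1 * T2 -> R) :
  measurable E -> measurable_fun setT f ->
  measurable_fun setT (fun x => (\int[m2]_(y in E) f (x, y))%R).
Proof.
move=> mE mf; apply: (measurableT_comp (@fine_measurable R setT measurableT)).
have mEf : measurable_fun setT (EFin \o f) by exact/measurable_EFinP.
rewrite (_ : (fun _ => _) = (fun x => \int[m2]_(y in E) (fun p => (EFin \o f)^\+ p) (x, y)) \-
   (fun x => \int[m2]_(y in E) (fun p => (EFin \o f)^\- p) (x, y))).
  apply: emeasurable_funB; apply: measurable_ge0_integral => //.
  - exact: measurable_funepos.
  - exact: measurable_funeneg.
by apply/funext => x; rewrite integralE; congr (_ - _); apply: eq_integral => y _; rewrite ?funeposE ?funenegE.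
Qed.
End TonelliVariants.

Section DensityIntegral.
Local Open Scope ereal_scope.
Context {d : measure_display} {T : measurableType d} {R : realType}.
Variables (m nu : {sigma_finite_measure set T -> \bar R}) (p : T -> R).
Hypotheses (mp : measurable_fun setT p) (p0 : forall x, (0 <= p x)%R)
  (nuE : forall A, measurable A -> nu A = \int[m]_(x in A) (p x)%:E).

(** Layer cake: [h x] is the Lebesgue measure of the [s >= 0] with [s < h x]. After Tonelli's
    theorem both sides integrate over [s] the [nu]-measure of a superlevel set of [h], and for sets
    the density formula is the hypothesis [nuE]. *)
Lemma ge0_integral_density (h : T -> \bar R) : measurable_fun setT h ->
  (forall x, 0 <= h x) -> \int[nu]_x h x = \int[m]_x ((p x)%:E * h x).
Proof.
move=> mh h0.
pose A : set (T * measurableTypeR R) := [set q | q.2%:E < h q.1].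
have mA : measurable A.
  have -> : A = (fun q : T * measurableTypeR R => h q.1 - q.2%:E) @^-1` `]0, +oo[.
    by apply/seteqP; split => q /=; rewrite in_itv/= andbT EFinN sube_gt0.
  rewrite -[X in measurable X]setTI; apply: emeasurable_funB => //.
  - exact: measurableT_comp mh measurable_fst.
  - by apply/measurable_EFinP; exact: measurable_snd.
  - exact: emeasurable_itv.
pose f (q : T * measurableTypeR R) : \bar R := (\1_A q)%:E.
have mf : measurable_fun setT f by apply/measurable_EFinP; exact: measurable_indic.
have f0 q : 0 <= f q by rewrite lee_fin.
have layer x : h x = \int[lebesgue_measure]_(s in `[0%R, +oo[) f (x, s).
  rewrite (_ : (fun s => f (x, s)) = (fun s => (\1_(xsection A x) s)%:E)); last first.
    by apply/funext => s; rewrite /f !indicE mem_xsection.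
  rewrite integral_indic//; last exact: measurable_xsection.
  have -> : xsection A x = [set s | s%:E < h x].
    by apply/seteqP; split => s; rewrite /xsection/= inE.
  have := h0 x; case: (h x) => [r| |]// r0.
    rewrite (_ : _ `&` _ = `[0%R, r[%classic).
      rewrite /= lebesgue_measure_itv/= lte_fin; case: ltP => [|r0']; rewrite ?sube0//.
      by congr EFin; apply/eqP; rewrite eq_le r0' -lee_fin r0.
    by apply/seteqP; split => s /=; rewrite !in_itv/= ?andbT lte_fin;
      [move=> [-> ->]|move=> /andP[-> ->]].
  rewrite (_ : _ `&` _ = `[0%R, +oo[%classic).
    by rewrite /= lebesgue_measure_itv/= ltry.
  by apply/seteqP; split => s /=; rewrite ltry; [case|].
pose As (s : R) := [set x | s%:E < h x].
have mAs s : measurable (As s).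
  rewrite (_ : As s = ysection A s); first exact: measurable_ysection.
  by apply/seteqP; split => x; rewrite /ysection/= inE.
transitivity (\int[nu]_x \int[lebesgue_measure]_(s in `[0%R, +oo[) f (x, s)).
  by apply: eq_integral => x _; exact: layer.
transitivity (\int[m]_x \int[lebesgue_measure]_(s in `[0%R, +oo[) ((p x)%:E * f (x, s))); last first.
  apply: eq_integral => x _; rewrite layer ge0_integralZl//.
  - by apply: measurable_funTS; exact: measurableT_comp.
  - by rewrite lee_fin.
rewrite ge0_fubini_domain// (@ge0_fubini_domain _ _ _ _ _ m lebesgue_measure setT _ (fun q => (p q.1)%:E * f q))//.
- apply: eq_integral => s _.
  rewrite (_ : (fun x => f (x, s)) = (fun x => (\1_(As s) x)%:E)); last first.
    by apply/funext => x; rewrite /f !indicE; congr (_%:R%:E); apply/idP/idP; rewrite !inE.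
  transitivity (nu (As s)); first by rewrite integral_indic// setIT.
  rewrite nuE// [LHS]integral_mkcond; apply: eq_integral => x _.
  rewrite patchE/= /f indicE; case: ifPn => xA.
    by rewrite (_ : (x, s) \in A) ?mule1// inE; rewrite inE in xA.
  rewrite (_ : (x, s) \in A = false) ?mule0//; apply/negbTE; move: xA; apply: contra.
  by rewrite !inE.
- apply: emeasurable_funM => //; apply/measurable_EFinP; exact: measurableT_comp mp measurable_fst.
- by move=> q; rewrite mule_ge0// lee_fin.
Qed.
End DensityIntegral.

Section SigmaFiniteProduct.
Context {d1 d2 : measure_display} {T1 : measurableType d1} {T2 : measurableType d2}
  {R : realType}.
Variables (m1 : {sigma_finite_measure set T1 -> \bar R})
          (m2 : {sigma_finite_measure set T2 -> \bar R}).

Lemma sigma_finite_product : sigma_finite setT (m1 \x m2)%E.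
Proof.
have [F FT Foo] := sigma_finiteT m1; have [G GT Goo] := sigma_finiteT m2.
pose H (k : nat) := let p := odflt (0, 0)%N (unpickle k) in F p.1 `*` G p.2.
exists H => [|k].
  apply/esym; rewrite -subTset => -[x y] _.
  have [i _ Fi] : (\bigcup_n F n) x by rewrite -FT.
  have [j _ Gj] : (\bigcup_n G n) y by rewrite -GT.
  by exists (pickle (i, j)) => //; rewrite /H pickleK.
rewrite /H; case: (odflt _ _) => i j /=.
have [mF Fy] := Foo i; have [mG Gy] := Goo j.
split; first exact: measurableX.
by rewrite product_measure1E// lte_mul_pinfty// ge0_fin_numE.
Qed.

Definition sigma_finite_prod : {sigma_finite_measure set (T1 * T2)%type -> \bar R} :=
  HB.pack (m1 \x m2)%E (Measure_isSigmaFinite.Build _ _ _ (m1 \x m2)%E sigma_finite_product).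

End SigmaFiniteProduct.

Section PlaneMeasurability.
Context {R : realType}.

Lemma measurable_inv : measurable_fun [set: R] (fun x : R => x^-1).
Proof.
rewrite -(setvU [set 0 : R]); apply/measurable_funU => //; first exact: measurableC.
split; last exact: measurable_fun_set1.
apply: open_continuous_measurable_fun; first by rewrite openC; exact: closed_eq.
by move=> x; rewrite inE/= => /eqP x0; exact: inv_continuous.
Qed.

Lemma modulus_sqr (z : R * R) : modulus z ^+ 2 = z.1 ^+ 2 + z.2 ^+ 2.
Proof. by rewrite sqr_sqrtr// addr_ge0// sqr_ge0. Qed.

Lemma modulus_ge0 (z : R * R) : 0 <= modulus z. Proof. exact: sqrtr_ge0. Qed.

Lemma measurable_modulus : measurable_fun [set: R * R] (@modulus R).
Proof.
apply: (@measurableT_comp _ _ _ _ _ _ (@Num.sqrt R)).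
  by apply: continuous_measurable_fun; exact: sqrt_continuous.
by apply: measurable_funD; apply: measurable_funX; [exact: measurable_fst|exact: measurable_snd].
Qed.

Definition gauss2 (t : R) (y : R * R) : R :=
  (2 * pi * t)^-1 * expR (- (modulus y ^+ 2 / (2 * t))).

Lemma gauss2_ge0 t y : 0 <= t -> 0 <= gauss2 t y.
Proof. by move=> t0; rewrite mulr_ge0 ?expR_ge0// invr_ge0 !mulr_ge0// pi_ge0. Qed.

Lemma measurable_gauss2 : measurable_fun setT (fun p : R * (R * R) => gauss2 p.1 p.2).
Proof.
have m1 : measurable_fun [set: R * (R * R)] (fun p : R * (R * R) => p.1) by exact: measurable_fst.
have m2 : measurable_fun [set: R * (R * R)] (fun p : R * (R * R) => modulus p.2).
  exact: measurableT_comp measurable_modulus measurable_snd.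
apply: measurable_funM.
  apply: (measurableT_comp measurable_inv).
  exact: measurable_funM (measurable_cst _) m1.
apply: measurableT_comp => //; apply: measurableT_comp => //.
apply: measurable_funM; first exact: measurable_funX.
apply: (measurableT_comp measurable_inv).
exact: measurable_funM (measurable_cst _) m1.
Qed.

Lemma normal_pdf_prod t (y : R * R) : 0 < t ->
  normal_pdf 0 (Num.sqrt t) y.1 * normal_pdf 0 (Num.sqrt t) y.2 = gauss2 t y.
Proof.
move=> t0; have s0 : Num.sqrt t != 0 by rewrite gt_eqF// sqrtr_gt0.
rewrite !normal_pdfE// /normal_peak /normal_fun !subr0 sqr_sqrtr ?(ltW t0)//.
rewrite mulrACA -expr2 exprVn sqr_sqrtr; last first.
  by rewrite mulrn_wge0// mulr_ge0 ?pi_ge0// ltW.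
rewrite -expRD /gauss2 modulus_sqr; congr (_^-1 * expR _); first by rewrite -mulr_natl; ring.
by field; rewrite gt_eqF.
Qed.

Local Notation mu := (@lebesgue_measure R).

(* [leb2] bundled with its sigma-finite measure structure. *)
Definition leb2_sfm :
    {sigma_finite_measure set (measurableTypeR R * measurableTypeR R)%type -> \bar R} :=
  sigma_finite_prod mu mu.

Lemma ge0_leb2E (f : R * R -> \bar R) : measurable_fun setT f -> (forall x, (0 <= f x)%E) ->
  (\int[leb2]_z f z = \int[mu]_x \int[mu]_y f (x, y))%E.
Proof. by move=> mf f0; rewrite /leb2 fubini_tonelli1. Qed.

Lemma heatE t (h : R * R -> \bar R) (x : R * R) : 0 < t ->
  measurable_fun setT h -> (forall x, (0 <= h x)%E) ->
  (heat t h x = \int[leb2]_y ((gauss2 t y)%:E * h (x + y)%R))%E.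
Proof.
move=> t0 mh h0; rewrite /heat.
have mhx : measurable_fun [set: R * R] (fun y => h (x + y)).
  exact: (measurableT_comp mh (measurable_fun_addpair
    (measurable_cst x) (@measurable_id _ (R * R)%type setT))).
have mg : measurable_fun [set: R * R] (fun y => ((gauss2 t y)%:E * h (x + y)%R)%E).
  apply: emeasurable_funM => //; apply/measurable_EFinP.
  exact: (measurableT_comp measurable_gauss2 (pair1_measurable t)).
rewrite ge0_leb2E//; last by move=> y; rewrite mule_ge0// lee_fin gauss2_ge0// ltW.
pose p := normal_pdf 0 (Num.sqrt t).
have mp : measurable_fun setT p by exact: measurable_normal_pdf.
have p0 (y : R) : 0 <= p y by exact: normal_pdf_ge0.
have dens (f : R -> \bar R) : measurable_fun setT f -> (forall x, (0 <= f x)%E) ->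
   (\int[normal_prob 0 (Num.sqrt t)]_y f y = \int[mu]_y ((p y)%:E * f y))%E.
  by move=> mf f0; apply: (@ge0_integral_density _ _ _ mu (normal_prob 0 (Num.sqrt t))).
rewrite fubini_tonelli1// /fubini_F.
transitivity (\int[normal_prob 0 (Num.sqrt t)]_a \int[mu]_b ((p b)%:E * h (x + (a, b))%R))%E.
  apply: eq_integral => a _; apply: dens => //.
  exact: (measurableT_comp mhx (pair1_measurable a)).
have mph : measurable_fun [set: R * R] (fun q : R * R => ((p q.2)%:E * h (x + q)%R)%E).
  apply: emeasurable_funM => //; apply/measurable_EFinP.
  exact: measurableT_comp mp measurable_snd.
rewrite dens; last 2 first.
- have := @measurable_ge0_integral _ _ _ _ _ mu setT _ measurableT mph.
  by apply=> q; rewrite mule_ge0// lee_fin.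
- by move=> a; apply: integral_ge0 => b _; rewrite mule_ge0// lee_fin.
apply: eq_integral => a _; rewrite -ge0_integralZl//.
- by apply: eq_integral => b _; rewrite muleA -EFinM (normal_pdf_prod (a, b)).
- exact: (measurableT_comp mph (pair1_measurable a)).
- by move=> b _; rewrite mule_ge0// lee_fin.
- by rewrite lee_fin.
Qed.

(** The time is replaced by its positive part so that the kernel is nonnegative at every real time,
    as parametric integrals require. At time 0 the kernel is 0, because [0^-1 = 0]. *)
Lemma measurable_heat (h : R * R -> \bar R) :
  measurable_fun setT h -> (forall x, (0 <= h x)%E) ->
  measurable_fun setT (fun p : R * (R * R) => (\int[leb2]_y
    ((gauss2 (Num.max p.1 0) y)%:E * h (p.2 + y)%R))%E).
Proof.
move=> mh h0.
pose f (q : (R * (R * R)) * (R * R)) :=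
  ((gauss2 (Num.max q.1.1 0) q.2)%:E * h (q.1.2 + q.2)%R)%E.
have mf : measurable_fun setT f.
  apply: emeasurable_funM.
    apply/measurable_EFinP.
    have m1 : measurable_fun [set: (R * (R * R)) * (R * R)]
        (fun q : (R * (R * R)) * (R * R) => (Num.max q.1.1 0, q.2)).
      apply: measurable_fun_pair; last exact: measurable_snd.
      by apply: measurable_maxr => //; exact: measurableT_comp measurable_fst measurable_fst.
    exact: (measurableT_comp measurable_gauss2 m1).
  apply: (measurableT_comp mh); apply: measurable_fun_addpair.
    exact: measurableT_comp measurable_snd measurable_fst.
  exact: measurable_snd.
have f0 q : (0 <= f q)%E by rewrite mule_ge0// lee_fin gauss2_ge0// le_max lexx orbT.
exact: (measurable_ge0_integral leb2_sfm measurableT mf f0).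
Qed.

(** The substitution [t = s + r] maps the triangle to a quadrant: once the integrals are exchanged,
    the inner one is translated by [s]. *)
Lemma ge0_integral_triangle (F : R * R -> \bar R) :
  measurable_fun setT F -> (forall p, (0 <= F p)%E) ->
  (\int[mu]_(t in `]0%R, +oo[) \int[mu]_(s in `]0%R, t[) F (t, s) =
   \int[mu]_(s in `]0%R, +oo[) \int[mu]_(r in `]0%R, +oo[) F (s + r, s)%R)%E.
Proof.
move=> mF F0; pose D := [set p : R * R | (0 < p.2) && (p.2 < p.1)].
have mD : measurable D.
  rewrite -[D]setTI; apply: (measurable_and (f := fun p : R * R => 0 < p.2) (g := fun p : R * R => p.2 < p.1)) => //.
  - apply: measurable_fun_ltr => //; exact: measurable_snd.
  - apply: measurable_fun_ltr; [exact: measurable_snd|exact: measurable_fst].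
pose g := F \_ D.
have mg : measurable_fun setT g.
  by apply/(measurable_restrictT _ _).1 => //; exact: measurable_funTS.
have g0 p : (0 <= g p)%E by rewrite /g patchE; case: ifP.
transitivity (\int[mu]_t \int[mu]_s g (t, s))%E.
  rewrite integral_mkcond; apply: eq_integral => t _; rewrite patchE.
  case: ifPn => tD.
    rewrite integral_mkcond; apply: eq_integral => s _.
    by rewrite /g !patchE; congr (if _ then _ else _); apply/idP/idP; rewrite !inE/= in_itv/=.
  rewrite integral0_eq// => s _; rewrite /g patchE; case: ifPn => // sD.
  move/negP : tD; case; rewrite inE/= in_itv/= andbT.
  by move: sD; rewrite inE/= => /andP[s0 st]; exact: lt_trans st.
rewrite fubini_tonelli// [RHS]integral_mkcond; apply: eq_integral => s _; rewrite patchE.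
case: ifPn => sD.
  rewrite -(ge0_integral_shift s); last 2 first.
  - exact: (measurableT_comp mg (pair2_measurable s)).
  - by move=> t; exact: g0.
  rewrite [RHS]integral_mkcond; apply: eq_integral => r _.
  rewrite /g !patchE addrC; congr (if _ then _ else _); move: sD.
  rewrite inE/= in_itv/= andbT => s0.
  apply/idP/idP; first by rewrite !inE/= in_itv/= andbT => /andP[_]; rewrite ltrDl.
  rewrite inE/= in_itv/= andbT => r0; rewrite inE/=; apply/andP; split => //.
  by rewrite ltrDl.
rewrite integral0_eq// => t _; rewrite /g patchE; case: ifPn => // tD.
move/negP : sD; case; rewrite inE/= in_itv/= andbT.
by move: tD; rewrite inE/= => /andP[].
Qed.
End PlaneMeasurability.

(** * Duhamel's formula for the weighted Brownian motion *)

Section Duhamel.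
Context {R : realType} {d : measure_display} {Omega : measurableType d}.
Variables (P : probability Omega R) (z : R * R) (W : R -> Omega -> R * R).
Hypothesis WB : is_brownian2 P z W.
Variables (V : R * R -> R) (K : R).
Hypotheses (mV : measurable_fun setT V) (VK : forall x, `|V x| <= K).
Local Notation X := (trajectory z W).
Local Notation mu := (@lebesgue_measure R).
Local Notation Pos := (`]0%R, +oo[%classic).

Definition weight (t : R) (w : Omega) : R := expR (primitive (fun s => V (X s w)) t).

Lemma measurable_weight_of d' (T : measurableType d') (Z : R * T -> R * R) :
  measurable_fun setT Z ->
  measurable_fun setT (fun p : R * T => expR (primitive (fun s => V (Z (s, p.2))) p.1)).
Proof.
move=> mZ.
have mVZ w : measurable_fun setT (fun s : R => V (Z (s, w))).
  apply: (measurableT_comp mV).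
  exact: (measurableT_comp mZ (pair2_measurable w)).
apply: (measurable_fun_caratheodory (X := fun t w => expR (primitive (fun s => V (Z (s, w))) t))).
  move=> t; apply: measurableT_comp => //.
  have mg : measurable_fun setT (fun q : T * R => V (Z (q.2, q.1))).
    apply: (measurableT_comp mV); apply: (measurableT_comp mZ).
    by apply: measurable_fun_pair; [exact: measurable_snd|exact: measurable_fst].
  exact: (measurable_Rintegral mu (E := `[0, t]%classic) _ mg).
move=> w t; apply: cvg_comp; last exact: continuous_expR.
exact: (continuous_primitive (mVZ w) (fun s => VK _)).
Qed.

Lemma weight_ge0 t w : 0 <= weight t w. Proof. exact: expR_ge0. Qed.

Lemma measurable_weight : measurable_fun setT (fun p : R * Omega => weight p.1 p.2).
Proof. exact: (measurable_weight_of (measurable_trajectory2 WB)). Qed.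

Lemma measurable_weight_past s : 0 < s ->
  measurable_fun setT (weight s : g_sigma_algebraType (past_events W s) -> R).
Proof.
move=> s0.
have H := measurableT_comp (measurable_weight_of (measurable_trajectory2_past WB s0))
  (pair1_measurable s).
apply: (eq_measurable_fun _ _ H) => w _ /=; congr expR.
by apply: eq_Rintegral => u; rewrite inE/= in_itv/= => /andP[_ us]; rewrite min_l.
Qed.

(** The time factor [om] is left free because it serves twice: as exponential killing, and as
    exponential killing cut at a finite horizon. *)
Definition occupation (om : R -> R) (h : R * R -> \bar R) : \bar R :=
  (\int[mu]_(t in Pos) \int[P]_w ((om t * weight t w)%:E * h (X t w)))%E.

(** The unweighted future seen from [x] at time [s]. For exponential killing it factors into the
    killing at [s] and the free resolvent, see [potential_kill]. *)
Definition potential (om : R -> R) (h : R * R -> \bar R) (s : R) (x : R * R) : \bar R :=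
  (\int[mu]_(r in Pos) ((om (s + r))%:E * heat r h x))%E.

Lemma trajectory_law t (h : R * R -> \bar R) : 0 < t ->
  measurable_fun setT h -> (forall x, (0 <= h x)%E) ->
  (\int[P]_w h (X t w) = heat t h z)%E.
Proof.
move=> t0 mh h0.
pose nu : probability (measurableTypeR R * measurableTypeR R)%type R :=
  [the probability _ _ of (normal_prob 0 (Num.sqrt t) \x normal_prob 0 (Num.sqrt t))%E].
have mi : measurable_fun setT (fun w => W t w - W 0 w) by exact: (measurable_increment WB (ltW t0) (lexx 0)).
have mi' : measurable_fun setT ((fun w => W t w - W 0 w) : Omega -> measurableTypeR R * measurableTypeR R) by exact: mi.
have mhz : measurable_fun [set: measurableTypeR R * measurableTypeR R] (fun y => h (z + y)).
  exact: (measurableT_comp mh (measurable_fun_addpair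
    (measurable_cst z) (@measurable_id _ (R * R)%type setT))).
have := ge0_integral_pushforward mi' P measurableT mhz (fun y _ => h0 (z + y)).
rewrite preimage_setT => E.
transitivity (\int[P]_w h (z + (W t w - W 0 w))%R)%E.
  by apply: eq_integral => w _; rewrite /trajectory max_l ?ltW.
etransitivity; first exact: (esym E).
apply: (eq_measure_integral nu) => A mA _.
have := brownian2_increment_law WB (lexx 0) t0 mA.
by rewrite subr0 => lawE; exact: lawE.
Qed.

Section Weighted.
Variables (om : R -> R) (h : R * R -> \bar R).
Hypotheses (mom : measurable_fun setT om) (om0 : forall t, 0 <= om t).
Hypotheses (mh : measurable_fun setT h) (h0 : forall x, (0 <= h x)%E).

Let c (p : R * Omega) : \bar R := ((om p.1)%:E * h (X p.1 p.2))%E.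

Let mc : measurable_fun setT c.
Proof.
apply: emeasurable_funM.
  by apply/measurable_EFinP; exact: measurableT_comp mom measurable_fst.
exact: measurableT_comp mh (measurable_trajectory2 WB).
Qed.

Let c0 p : (0 <= c p)%E. Proof. by rewrite mule_ge0// lee_fin. Qed.

Definition heat_kernel (p : R * (R * R)) : \bar R :=
  (\int[leb2]_y ((gauss2 (Num.max p.1 0) y)%:E * h (p.2 + y)%R))%E.

Lemma heat_kernelE r x : 0 < r -> heat r h x = heat_kernel (r, x).
Proof. by move=> r0; rewrite (heatE x r0 mh h0) /heat_kernel [(r, x).1]/= (max_l (ltW r0)). Qed.

Let mheat : measurable_fun setT heat_kernel. Proof. exact: measurable_heat. Qed.

Let heat0 p : (0 <= heat_kernel p)%E.
Proof.
by apply: integral_ge0 => y _; rewrite mule_ge0// lee_fin gauss2_ge0// le_max lexx orbT.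
Qed.

Lemma potentialE (s : R) (x : R * R) :
  potential om h s x = (\int[mu]_(r in Pos) ((om (s + r))%:E * heat_kernel (r, x)))%E.
Proof.
apply: eq_integral => r.
by rewrite inE/= in_itv/= andbT => r0; rewrite heat_kernelE.
Qed.

Lemma measurable_potential s : measurable_fun setT (potential om h s).
Proof.
pose f (q : (R * R) * R) := ((om (s + q.2))%:E * heat_kernel (q.2, q.1))%E.
have mf : measurable_fun setT f.
  apply: emeasurable_funM.
    apply/measurable_EFinP; apply: (measurableT_comp mom).
    by apply: measurable_funD => //; exact: measurable_snd.
  apply: (measurableT_comp mheat).
  by apply: measurable_fun_pair; [exact: measurable_snd|exact: measurable_fst].
have f0 q : (0 <= f q)%E by rewrite mule_ge0// lee_fin.
have H := measurable_ge0_integral mu (E := Pos) (measurable_itv _) mf f0.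
by apply: (eq_measurable_fun _ _ H) => x _; rewrite potentialE.
Qed.

Lemma potential_ge0 s x : (0 <= potential om h s x)%E.
Proof.
apply: integral_ge0 => r /=; rewrite in_itv/= andbT => r0.
by rewrite heat_kernelE// mule_ge0// lee_fin.
Qed.

(** The triangle substitution writes the later time as [s + r]; the Markov property at time [s]
    replaces [h] at that time by the heat semigroup, and the integral over [r] is [potential]. The
    weight up to [s] and [U] belong to the past. *)
Lemma duhamel_term (U : R * R -> R) : measurable_fun setT U -> (forall x, 0 <= U x) ->
  (\int[mu]_(t in Pos) \int[P]_w (c (t, w) *
      \int[mu]_(s in `[0%R, t]) (U (X s w) * weight s w)%R%:E) =
   \int[mu]_(s in Pos) \int[P]_w ((U (X s w) * weight s w)%:E * potential om h s (X s w)))%E.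
Proof.
move=> mU U0.
pose u (p : R * Omega) : \bar R := (U (X p.1 p.2) * weight p.1 p.2)%:E.
have mu_ : measurable_fun setT u.
  apply/measurable_EFinP; apply: measurable_funM; last exact: measurable_weight.
  exact: measurableT_comp mU (measurable_trajectory2 WB).
have u0 p : (0 <= u p)%E by rewrite lee_fin mulr_ge0// weight_ge0.
pose J (p : R * R) : \bar R := (\int[P]_w (c (p.1, w) * u (p.2, w)))%E.
have mcu : measurable_fun setT (fun q : (R * R) * Omega => (c (q.1.1, q.2) * u (q.1.2, q.2))%E).
  apply: emeasurable_funM.
    apply: (measurableT_comp mc); apply: measurable_fun_pair; last exact: measurable_snd.
    exact: measurableT_comp measurable_fst measurable_fst.
  apply: (measurableT_comp mu_); apply: measurable_fun_pair; last exact: measurable_snd.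
  exact: measurableT_comp measurable_snd measurable_fst.
have mJ : measurable_fun setT J.
  by apply: (measurable_ge0_integral P measurableT mcu) => q; rewrite mule_ge0.
have J0 p : (0 <= J p)%E by apply: integral_ge0 => w _; rewrite mule_ge0.
(* The endpoints are dropped because the Markov property needs [0 < s] and [s < t]. *)
transitivity (\int[mu]_(t in Pos) \int[mu]_(s in `]0%R, t[) J (t, s))%E.
  apply: eq_integral => t _.
  transitivity (\int[P]_w \int[mu]_(s in `]0%R, t[) (c (t, w) * u (s, w)))%E.
    apply: eq_integral => w _.
    have muw : measurable_fun setT (fun s => u (s, w)) by exact: (measurableT_comp mu_ (pair2_measurable w)).
    rewrite (ge0_integralZl mu (measurable_itv _) (measurable_funTS muw) (fun s _ => u0 _) (c0 _)).
    by congr (_ * _)%E; apply: integral_itv_bndoo; exact: measurable_funTS muw.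
  apply: (@ge0_fubini_domain _ _ _ _ _ P mu setT _ (fun q => (c (t, q.1) * u (q.2, q.1))%E)) => //.
    apply: emeasurable_funM.
      exact: (measurableT_comp (measurableT_comp mc (pair1_measurable t)) measurable_fst).
    apply: (measurableT_comp mu_).
    by apply: measurable_fun_pair; [exact: measurable_snd|exact: measurable_fst].
  by move=> q; rewrite mule_ge0.
rewrite ge0_integral_triangle//; apply: eq_integral => s.
rewrite inE/= in_itv/= andbT => s0.
pose Y (w : Omega) := u (s, w).
have mXs := measurable_trajectory_past WB s0 (lexx s).
have mY : measurable_fun setT (Y : g_sigma_algebraType (past_events W s) -> \bar R).
  apply/measurable_EFinP; apply: measurable_funM; last exact: measurable_weight_past.
  exact: measurableT_comp mU mXs.
have mXsO : measurable_fun setT (X s) by exact: (measurable_trajectory WB s).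
have mYO : measurable_fun setT Y by exact: (measurableT_comp mu_ (pair1_measurable s)).
have step (r : R) : 0 < r ->
    (\int[P]_w (Y w * h (X (s + r) w)) = \int[P]_w (Y w * heat_kernel (r, X s w)))%E.
  move=> r0; have sr : s < s + r by rewrite ltrDl.
  have srE : s + r - s = r by rewrite addrAC subrr add0r.
  have := markov_property WB s0 sr mY (fun w => u0 _) mh h0; rewrite srE => ->.
  by apply: eq_integral => w _; rewrite heat_kernelE.
transitivity (\int[mu]_(r in Pos) \int[P]_w (Y w * ((om (s + r))%:E * heat_kernel (r, X s w))))%E.
  apply: eq_integral => r; rewrite inE/= in_itv/= andbT => r0.
  have mhX t : measurable_fun setT (fun w => h (X t w)).
    exact: (measurableT_comp mh (measurable_trajectory WB t)).
  have omr0 : (0 <= (om (s + r))%:E)%E by rewrite lee_fin.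
  have mYh := emeasurable_funM mYO (mhX (s + r)).
  have mYk : measurable_fun setT (fun w => (Y w * heat_kernel (r, X s w))%E).
    apply: (emeasurable_funM mYO).
    exact: (measurableT_comp (measurableT_comp mheat (pair1_measurable r)) mXsO).
  transitivity ((om (s + r))%:E * \int[P]_w (Y w * h (X (s + r) w)))%E.
    rewrite -(ge0_integralZl P measurableT mYh (fun w _ => mule_ge0 (u0 _) (h0 _)) omr0).
    by apply: eq_integral => w _; rewrite /c/= muleAC muleA.
  rewrite (step r r0).
  rewrite -(ge0_integralZl P measurableT mYk (fun w _ => mule_ge0 (u0 _) (heat0 _)) omr0).
  by apply: eq_integral => w _; rewrite muleCA.
rewrite (@ge0_fubini_domain _ _ _ _ _ mu P _ setT
  (fun q => Y q.2 * ((om (s + q.1))%:E * heat_kernel (q.1, X s q.2)))%E)//.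
- apply: eq_integral => w _.
  have mk : measurable_fun setT (fun r => ((om (s + r))%:E * heat_kernel (r, X s w))%E).
    apply: emeasurable_funM.
      apply/measurable_EFinP; apply: (measurableT_comp mom).
      by apply: measurable_funD.
    exact: (measurableT_comp mheat (pair2_measurable _)).
  have k0 r : (0 <= (om (s + r))%:E * heat_kernel (r, X s w))%E by rewrite mule_ge0// lee_fin.
  transitivity (\int[mu]_(r in Pos) (u (s, w) * ((om (s + r))%:E * heat_kernel (r, X s w))))%E.
    by [].
  rewrite (ge0_integralZl mu (measurable_itv _) (measurable_funTS mk) (fun r _ => k0 r) (u0 _)).
  by rewrite potentialE.
- apply: emeasurable_funM; first exact: measurableT_comp mYO measurable_snd.
  apply: emeasurable_funM.
    apply/measurable_EFinP; apply: (measurableT_comp mom).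
    by apply: measurable_funD => //; exact: measurable_fst.
  apply: (measurableT_comp mheat); apply: measurable_fun_pair; first exact: measurable_fst.
  exact: measurableT_comp mXsO measurable_snd.
- by move=> q; rewrite mule_ge0 ?mule_ge0 ?lee_fin//; exact: u0.
Qed.

(** [expR_primitiveE] is applied along each path, multiplied by [om t] and by [h] at the position at
    time [t], and integrated. The constant 1 gives the free term; the two integrals are of the form
    treated by [duhamel_term]. *)
Lemma duhamel :
  (occupation om h + \int[mu]_(s in Pos) \int[P]_w
      ((Num.max (- V (X s w)) 0 * weight s w)%R%:E * potential om h s (X s w)) =
   \int[mu]_(t in Pos) ((om t)%:E * heat t h z) + \int[mu]_(s in Pos) \int[P]_w
      ((Num.max (V (X s w)) 0 * weight s w)%R%:E * potential om h s (X s w)))%E.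
Proof.
have mVn : measurable_fun setT (fun x => Num.max (- V x) 0).
  by apply: measurable_maxr => //; exact: measurableT_comp.
have mVp : measurable_fun setT (fun x => Num.max (V x) 0) by apply: measurable_maxr.
have Vn0 x : 0 <= Num.max (- V x) 0 by rewrite le_max lexx orbT.
have Vp0 x : 0 <= Num.max (V x) 0 by rewrite le_max lexx orbT.
rewrite -(duhamel_term mVn Vn0) -(duhamel_term mVp Vp0).
have mI (U : R * R -> R) : measurable_fun setT U -> (forall x, 0 <= U x) ->
    measurable_fun setT (fun q : R * Omega =>
      (\int[mu]_(s in `[0%R, q.1]) (U (X s q.2) * weight s q.2)%R%:E)%E).
  move=> mU U0; pose D := [set q : (R * Omega) * R | (0 <= q.2) && (q.2 <= q.1.1)].
  have mD : measurable D.
    rewrite -[D]setTI; apply: (measurable_and (f := fun q : (R * Omega) * R => 0 <= q.2)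
      (g := fun q : (R * Omega) * R => q.2 <= q.1.1)) => //.
    - apply: measurable_fun_ler => //; exact: measurable_snd.
    - apply: measurable_fun_ler; first exact: measurable_snd.
      exact: measurableT_comp measurable_fst measurable_fst.
  pose f (q : (R * Omega) * R) : \bar R := (U (X q.2 q.1.2) * weight q.2 q.1.2)%:E.
  have mf : measurable_fun setT f.
    have mp : measurable_fun setT (fun q : (R * Omega) * R => (q.2, q.1.2)).
      apply: measurable_fun_pair; first exact: measurable_snd.
      exact: measurableT_comp measurable_snd measurable_fst.
    apply/measurable_EFinP; apply: measurable_funM.
      exact: (measurableT_comp mU (measurableT_comp (measurable_trajectory2 WB) mp)).
    exact: (measurableT_comp measurable_weight mp).
  have mg : measurable_fun setT (f \_ D).
    by apply/(measurable_restrictT _ _).1 => //; exact: measurable_funTS.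
  have g0 q : (0 <= (f \_ D) q)%E.
    by rewrite patchE; case: ifP => // _; rewrite lee_fin mulr_ge0// weight_ge0.
  have H := measurable_ge0_integral mu measurableT mg g0.
  apply: (eq_measurable_fun _ _ H) => -[t w] _; rewrite [RHS]integral_mkcond.
  apply: eq_integral => s _; rewrite !patchE /f/=.
  have -> : (s \in `[0%R, t]%classic) = ((t, w, s) \in D).
    by apply/idP/idP; rewrite !inE /D/= ?in_itv.
  by [].
have addI (f g : R * Omega -> \bar R) : measurable_fun setT f -> measurable_fun setT g ->
    (forall p, 0 <= f p)%E -> (forall p, 0 <= g p)%E ->
    (\int[mu]_(t in Pos) \int[P]_w (c (t, w) * f (t, w)) +
     \int[mu]_(t in Pos) \int[P]_w (c (t, w) * g (t, w)) =
     \int[mu]_(t in Pos) \int[P]_w (c (t, w) * (f (t, w) + g (t, w))))%E.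
  move=> mf mg f0 g0.
  have mcf : measurable_fun setT (fun p => (c p * f p)%E) by exact: emeasurable_funM.
  have mcg : measurable_fun setT (fun p => (c p * g p)%E) by exact: emeasurable_funM.
  have cf0 p : (0 <= c p * f p)%E by rewrite mule_ge0.
  have cg0 p : (0 <= c p * g p)%E by rewrite mule_ge0.
  rewrite -ge0_integralD//.
  - apply: eq_integral => t _; rewrite -ge0_integralD//.
    + by apply: eq_integral => w _; rewrite ge0_muleDr.
    + exact: (measurableT_comp mcf (pair1_measurable t)).
    + exact: (measurableT_comp mcg (pair1_measurable t)).
  - by move=> t _; exact: integral_ge0.
  - by apply: measurable_funTS; exact: (measurable_ge0_integral P measurableT mcf cf0).
  - by move=> t _; exact: integral_ge0.
  - by apply: measurable_funTS; exact: (measurable_ge0_integral P measurableT mcg cg0).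
pose In (q : R * Omega) : \bar R :=
  (\int[mu]_(s in `[0%R, q.1]) (Num.max (- V (X s q.2)) 0 * weight s q.2)%R%:E)%E.
pose Ip (q : R * Omega) : \bar R :=
  (\int[mu]_(s in `[0%R, q.1]) (Num.max (V (X s q.2)) 0 * weight s q.2)%R%:E)%E.
have In0 q : (0 <= In q)%E.
  by apply: integral_ge0 => s _; rewrite lee_fin mulr_ge0// weight_ge0.
have Ip0 q : (0 <= Ip q)%E.
  by apply: integral_ge0 => s _; rewrite lee_fin mulr_ge0// weight_ge0.
have mVX w : measurable_fun setT (fun s : R => V (X s w)).
  apply: (measurableT_comp mV).
  exact: (measurableT_comp (measurable_trajectory2 WB) (pair2_measurable w)).
have occE : occupation om h =
    (\int[mu]_(t in Pos) \int[P]_w (c (t, w) * (weight t w)%:E))%E.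
  have cE (t : R) (w : Omega) :
      ((om t * weight t w)%:E * h (X t w) = c (t, w) * (weight t w)%:E)%E.
    by rewrite /c EFinM muleAC.
  by apply: eq_integral => t _; apply: eq_integral => w _; exact: cE.
have mwE : measurable_fun setT (fun p : R * Omega => (weight p.1 p.2)%:E).
  by apply/measurable_EFinP; exact: measurable_weight.
rewrite occE.
transitivity (\int[mu]_(t in Pos) \int[P]_w (c (t, w) * ((weight t w)%:E + In (t, w))))%E.
  rewrite -(addI (fun p => (weight p.1 p.2)%:E) In)//.
  - exact: (mI _ mVn Vn0).
  - by move=> p; rewrite lee_fin weight_ge0.
transitivity (\int[mu]_(t in Pos) \int[P]_w (c (t, w) * (1 + Ip (t, w))))%E.
  apply: eq_integral => t; rewrite inE/= in_itv/= andbT => t0; apply: eq_integral => w _.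
  congr (_ * _)%E; rewrite /weight.
  exact: (expR_primitiveE (mVX w) (fun s => VK _) (ltW t0)).
rewrite -(addI (cst 1%E) Ip)//; last exact: (mI _ mVp Vp0).
congr (_ + _)%E; apply: eq_integral => t; rewrite inE/= in_itv/= andbT => t0.
have mhX : measurable_fun setT (fun w => h (X t w)).
  exact: (measurableT_comp mh (measurable_trajectory WB t)).
have omt0 : (0 <= (om t)%:E)%E by rewrite lee_fin.
rewrite -(trajectory_law t0 mh h0) -(ge0_integralZl P measurableT mhX (fun w _ => h0 _) omt0).
by apply: eq_integral => w _; rewrite mule1.
Qed.
End Weighted.
End Duhamel.

(** * Killed occupation measures and the a priori bound *)

Section Occupation.
Context {R : realType} {d : measure_display} {Omega : measurableType d}.
Variables (P : probability Omega R) (z : R * R) (W : R -> Omega -> R * R).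
Hypothesis WB : is_brownian2 P z W.
Variables (V : R * R -> R) (K : R).
Hypotheses (mV : measurable_fun setT V) (VK : forall x, `|V x| <= K).
Local Notation X := (trajectory z W).
Local Notation mu := (@lebesgue_measure R).
Local Notation Pos := (`]0%R, +oo[%classic).
Local Notation occ := (occupation P z W V).

Let mX := measurable_trajectory2 WB.
Let mweight := measurable_weight WB mV VK.

Definition positive_times : set (R * Omega) := [set p | 0 < p.1].
Local Notation D := positive_times.

Lemma measurable_positive_times : measurable D.
Proof.
have mP : measurable (`]0%R, +oo[%classic : set R) by exact: measurable_itv.
have mf : measurable_fun [set: R * Omega] (fun p : R * Omega => p.1) by exact: measurable_fst.
have := mf measurableT _ mP; congr (measurable _).
by apply/seteqP; split => p; rewrite /D/= in_itv/= andbT; [case|].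
Qed.
Let mD := measurable_positive_times.

Lemma ge0_iterated_integralE (c : R * Omega -> \bar R) :
  measurable_fun setT c -> (forall p, (0 <= c p)%E) ->
  (\int[mu]_(t in Pos) \int[P]_w c (t, w) = \int[mu \x P]_(p in D) c p)%E.
Proof.
move=> mc c0; rewrite integral_mkcond [RHS]integral_mkcond.
have mg : measurable_fun setT (c \_ (D)).
  by apply: ((measurable_restrictT c mD).1); exact: measurable_funTS.
have g0 p : (0 <= (c \_ (D)) p)%E by rewrite patchE; case: ifP.
rewrite fubini_tonelli1//; apply: eq_integral => t _; rewrite patchE /fubini_F.
case: ifPn => tD.
  apply: eq_integral => w _; rewrite patchE ifT// inE /D/=.
  by move: tD; rewrite inE/= in_itv/= andbT.
rewrite integral0_eq// => w _; rewrite patchE ifF//; apply/negbTE; move: tD; apply: contra.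
by rewrite !inE /D/= in_itv/= andbT.
Qed.

Definition occ_integrand (om : R -> R) (h : R * R -> \bar R) (p : R * Omega) : \bar R :=
  ((om p.1 * weight z W V p.1 p.2)%:E * h (X p.1 p.2))%E.

Lemma measurable_occ_integrand (om : R -> R) (h : R * R -> \bar R) :
  measurable_fun setT om -> measurable_fun setT h ->
  measurable_fun setT (occ_integrand om h).
Proof.
move=> mom mh; apply: emeasurable_funM; last exact: measurableT_comp mh mX.
apply/measurable_EFinP; apply: measurable_funM => //.
exact: measurableT_comp mom measurable_fst.
Qed.

Lemma occ_integrand_ge0 (om : R -> R) (h : R * R -> \bar R) p : (forall t, 0 <= om t) -> (forall x, (0 <= h x)%E) ->
  (0 <= occ_integrand om h p)%E.
Proof. by move=> om0 h0; rewrite mule_ge0// lee_fin mulr_ge0// weight_ge0. Qed.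

Lemma occupationE (om : R -> R) (h : R * R -> \bar R) : measurable_fun setT om -> (forall t, 0 <= om t) ->
  measurable_fun setT h -> (forall x, (0 <= h x)%E) ->
  (occ om h = \int[mu \x P]_(p in D) occ_integrand om h p)%E.
Proof.
move=> mom om0 mh h0; rewrite -ge0_iterated_integralE//.
  exact: measurable_occ_integrand.
by move=> p; exact: occ_integrand_ge0.
Qed.

Lemma occupation_ge0 (om : R -> R) (h : R * R -> \bar R) : (forall t, 0 <= om t) -> (forall x, (0 <= h x)%E) ->
  (0 <= occ om h)%E.
Proof.
move=> om0 h0; apply: integral_ge0 => t _; apply: integral_ge0 => w _.
exact: (occ_integrand_ge0 (t, w) om0 h0).
Qed.

Lemma le_occupation (om : R -> R) (h : R * R -> \bar R) (om' : R -> R) (h' : R * R -> \bar R) :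
  measurable_fun setT om -> (forall t, 0 <= om t) ->
  measurable_fun setT h -> (forall x, (0 <= h x)%E) ->
  measurable_fun setT om' -> measurable_fun setT h' ->
  (forall t, 0 < t -> om t <= om' t) -> (forall x, (h x <= h' x)%E) ->
  (forall t, 0 <= om' t) ->
  (occ om h <= occ om' h')%E.
Proof.
move=> mom om0 mh h0 mom' mh' le_om le_h om'0.
have h'0 x : (0 <= h' x)%E by exact: le_trans (h0 x) (le_h x).
rewrite !occupationE//; apply: ge0_le_integral.
- exact: mD.
- by move=> p _; exact: occ_integrand_ge0.
- by apply: measurable_funTS; exact: measurable_occ_integrand.
- by apply: measurable_funTS; exact: measurable_occ_integrand.
- move=> p p1; apply: lee_pmul => //.
    by rewrite lee_fin mulr_ge0// weight_ge0.
  by rewrite lee_fin ler_wpM2r ?weight_ge0//; exact: le_om.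
Qed.

Lemma occupationZ (om : R -> R) (h : R * R -> \bar R) (k : \bar R) : measurable_fun setT om -> (forall t, 0 <= om t) ->
  measurable_fun setT h -> (forall x, (0 <= h x)%E) -> (0 <= k)%E ->
  (occ om (fun x => k * h x) = k * occ om h)%E.
Proof.
move=> mom om0 mh h0 k0; rewrite !occupationE//.
- rewrite -(ge0_integralZl (mu \x P)%E mD
    (measurable_funTS (measurable_occ_integrand mom mh))
    (fun p _ => occ_integrand_ge0 p om0 h0) k0).
  by apply: eq_integral => p _; rewrite /occ_integrand muleCA.
- exact: emeasurable_funM (measurable_cst _) mh.
- by move=> x; rewrite mule_ge0.
Qed.

Section Killed.
Variable (q : R).
Hypothesis q0 : 0 < q.

Definition kill (t : R) : R := expR (- (q * t)).

Lemma kill_ge0 t : 0 <= kill t. Proof. exact: expR_ge0. Qed.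

Lemma measurable_kill : measurable_fun setT kill.
Proof.
apply: measurableT_comp => //; apply: measurableT_comp => //.
Qed.

Lemma killD s t : kill (s + t) = kill s * kill t.
Proof. by rewrite /kill mulrDr opprD expRD. Qed.

Definition green_op (h : R * R -> \bar R) : R * R -> \bar R := potential kill h 0.

Lemma measurable_green_op h : measurable_fun setT h -> (forall x, (0 <= h x)%E) ->
  measurable_fun setT (green_op h).
Proof. by move=> mh h0; exact: (measurable_potential measurable_kill kill_ge0 mh h0 0). Qed.

Lemma green_op_ge0 h x : measurable_fun setT h -> (forall x, (0 <= h x)%E) ->
  (0 <= green_op h x)%E.
Proof. by move=> mh h0; exact: potential_ge0 kill_ge0 mh h0 0 x. Qed.

Let mkern (om : R -> R) (h : R * R -> \bar R) (s : R) (x : R * R) : measurable_fun setT om ->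
  measurable_fun setT h -> (forall x, (0 <= h x)%E) ->
  measurable_fun setT (fun r : R => ((om (s + r))%:E * heat_kernel h (r, x))%E).
Proof.
move=> mom mh h0; apply: emeasurable_funM.
  apply/measurable_EFinP; apply: (measurableT_comp mom).
  by apply: measurable_funD.
exact: (measurableT_comp (measurable_heat mh h0) (pair2_measurable x)).
Qed.

Let kern0 (om : R -> R) (h : R * R -> \bar R) (s r : R) (x : R * R) : (forall t, 0 <= om t) ->
  (forall x, (0 <= h x)%E) -> (0 <= (om s)%:E * heat_kernel h (r, x))%E.
Proof.
move=> om0 h0; rewrite mule_ge0// ?lee_fin//.
by apply: integral_ge0 => y _; rewrite mule_ge0// lee_fin gauss2_ge0// le_max lexx orbT.
Qed.

Lemma potential_kill (s : R) h x : measurable_fun setT h -> (forall x, (0 <= h x)%E) ->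
  (potential kill h s x = (kill s)%:E * green_op h x)%E.
Proof.
move=> mh h0.
have mf := mkern 0 x measurable_kill mh h0.
have f0 (r : R) : (0 <= (kill (0 + r))%:E * heat_kernel h (r, x))%E.
  exact: (kern0 _ _ _ kill_ge0 h0).
have ks : (0 <= (kill s)%:E)%E by rewrite lee_fin kill_ge0.
rewrite /green_op !potentialE//.
rewrite -(ge0_integralZl mu (measurable_itv _) (measurable_funTS mf) (fun r _ => f0 r) ks).
have E (r : R) : ((kill (s + r))%:E * heat_kernel h (r, x) =
    (kill s)%:E * ((kill (0 + r))%:E * heat_kernel h (r, x)))%E.
  by rewrite muleA -EFinM killD add0r.
by apply: eq_integral => r _; exact: E.
Qed.

Definition kill_until (T t : R) : R := kill t * (t <= T)%R%:R.

Lemma kill_until_ge0 T t : 0 <= kill_until T t.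
Proof. by rewrite mulr_ge0 ?kill_ge0. Qed.

Lemma kill_until_le T t : kill_until T t <= kill t.
Proof. by rewrite ler_piMr ?kill_ge0// lern1 leq_b1. Qed.

Lemma measurable_kill_until T : measurable_fun setT (kill_until T).
Proof.
apply: measurable_funM; first exact: measurable_kill.
have -> : (fun t : R => (t <= T)%R%:R : R) = \1_(`]-oo, T]%classic).
  by apply/funext => t; rewrite indicE; congr ((nat_of_bool _)%:R); apply/idP/idP; rewrite inE/= in_itv.
exact: measurable_indic.
Qed.

(** Only an inequality: the horizon forces [s + r <= T] on the left, but merely [s <= T] on the
    right. *)
Lemma potential_kill_until_le (T s : R) h x : measurable_fun setT h ->
  (forall x, (0 <= h x)%E) ->
  (potential (kill_until T) h s x <= (kill_until T s)%:E * green_op h x)%E.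
Proof.
move=> mh h0.
have mf := mkern 0 x measurable_kill mh h0.
have f0 (r : R) : (0 <= (kill (0 + r))%:E * heat_kernel h (r, x))%E.
  exact: (kern0 _ _ _ kill_ge0 h0).
have ks : (0 <= (kill_until T s)%:E)%E by rewrite lee_fin kill_until_ge0.
rewrite /green_op !potentialE//.
rewrite -(ge0_integralZl mu (measurable_itv _) (measurable_funTS mf) (fun r _ => f0 r) ks).
have mg := mkern s x (measurable_kill_until T) mh h0.
have g0 (r : R) : (0 <= (kill_until T (s + r))%:E * heat_kernel h (r, x))%E.
  exact: (kern0 _ _ _ (kill_until_ge0 T) h0).
have fg (r : R) : 0 < r -> ((kill_until T (s + r))%:E * heat_kernel h (r, x) <=
    (kill_until T s)%:E * ((kill (0 + r))%:E * heat_kernel h (r, x)))%E.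
  move=> r0; rewrite muleA -EFinM; apply: lee_wpmul2r.
    by apply: integral_ge0 => y _; rewrite mule_ge0// lee_fin gauss2_ge0// le_max lexx orbT.
  rewrite lee_fin /kill_until killD add0r [leRHS]mulrAC ler_wpM2l ?mulr_ge0 ?kill_ge0//.
  case: (leP (s + r) T) => [sr|_]; last by rewrite ler0n.
  by rewrite (le_trans _ sr)// lerDl ltW.
apply: ge0_le_integral; first exact: measurable_itv.
- by move=> r _; exact: g0.
- exact: (measurable_funTS mg).
- by apply: measurable_funTS; exact: emeasurable_funM (measurable_cst _) mf.
- by move=> r; rewrite /= in_itv/= andbT => r0; exact: fg.
Qed.

Lemma heat_kernel_ge0 (h : R * R -> \bar R) p : (forall x, (0 <= h x)%E) -> (0 <= heat_kernel h p)%E.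
Proof.
move=> h0; apply: integral_ge0 => y _; rewrite mule_ge0// lee_fin gauss2_ge0//.
by rewrite le_max lexx orbT.
Qed.

Lemma measurable_potential2 (om : R -> R) (h : R * R -> \bar R) : measurable_fun setT om ->
  (forall t, 0 <= om t) -> measurable_fun setT h -> (forall x, (0 <= h x)%E) ->
  measurable_fun setT (fun p : R * (R * R) => potential om h p.1 p.2).
Proof.
move=> mom om0 mh h0.
pose f (u : (R * (R * R)) * R) := ((om (u.1.1 + u.2))%:E * heat_kernel h (u.2, u.1.2))%E.
have mf : measurable_fun setT f.
  apply: emeasurable_funM.
    apply/measurable_EFinP; apply: (measurableT_comp mom).
    apply: measurable_funD; last exact: measurable_snd.
    exact: measurableT_comp measurable_fst measurable_fst.
  apply: (measurableT_comp (measurable_heat mh h0)).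
  apply: measurable_fun_pair; first exact: measurable_snd.
  exact: measurableT_comp measurable_snd measurable_fst.
have f0 u : (0 <= f u)%E by exact: (kern0 _ _ _ om0 h0).
have H := measurable_ge0_integral mu (E := Pos) (measurable_itv _) mf f0.
by apply: (eq_measurable_fun _ _ H) => p _; rewrite potentialE.
Qed.

Definition pos_part (x : R * R) : R := Num.max (V x) 0.
Definition neg_part (x : R * R) : R := Num.max (- V x) 0.

Lemma pos_part_ge0 x : 0 <= pos_part x. Proof. by rewrite le_max lexx orbT. Qed.
Lemma neg_part_ge0 x : 0 <= neg_part x. Proof. by rewrite le_max lexx orbT. Qed.

Lemma measurable_pos_part : measurable_fun setT pos_part.
Proof. exact: measurable_maxr. Qed.

Let swapE (v a k : R) (f : \bar R) : ((v * a)%:E * (k%:E * f) = (k * a)%:E * (v%:E * f))%E.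
Proof. by rewrite !muleA -!EFinM; congr (_%:E * _)%E; ring. Qed.

Lemma duhamel_kill (h : R * R -> \bar R) : measurable_fun setT h -> (forall x, (0 <= h x)%E) ->
  (occ kill h + occ kill (fun x => (neg_part x)%:E * green_op h x) =
   green_op h z + occ kill (fun x => (pos_part x)%:E * green_op h x))%E.
Proof.
move=> mh h0; have duh := duhamel WB mV VK measurable_kill kill_ge0 mh h0.
have E (U : R * R -> R) : (\int[mu]_(s in Pos) \int[P]_w
      ((U (X s w) * weight z W V s w)%:E * potential kill h s (X s w)) =
    occ kill (fun x => (U x)%:E * green_op h x))%E.
  have E0 (s : R) (w : Omega) : ((U (X s w) * weight z W V s w)%:E * potential kill h s (X s w) =
      (kill s * weight z W V s w)%:E * ((U (X s w))%:E * green_op h (X s w)))%E.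
    by rewrite potential_kill// swapE.
  by apply: eq_integral => s _; apply: eq_integral => w _; exact: E0.
have E1 (t : R) : ((kill (0 + t))%:E * heat t h z = (kill t)%:E * heat t h z)%E by rewrite add0r.
have E2 : (green_op h z = \int[mu]_(t in Pos) ((kill t)%:E * heat t h z))%E.
  by apply: eq_integral => t _; exact: E1.
by rewrite -(E neg_part) -(E pos_part) E2; exact: duh.
Qed.

Let kill_until_heat_le (T : R) (h : R * R -> \bar R) :
  measurable_fun setT h -> (forall x, (0 <= h x)%E) ->
  (\int[mu]_(t in Pos) ((kill_until T t)%:E * heat t h z) <= green_op h z)%E.
Proof.
move=> mh h0; have mk := measurable_kill_until T; have k0 := kill_until_ge0 T.
have E1 (t : R) : 0 < t ->
    ((kill_until T t)%:E * heat t h z <= (kill (0 + t))%:E * heat_kernel h (t, z))%E.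
  move=> t0; rewrite (heat_kernelE mh h0 z t0) (add0r t); apply: lee_wpmul2r.
    exact: heat_kernel_ge0.
  by rewrite lee_fin kill_until_le.
have E2 (t : R) : 0 < t -> (0 <= (kill_until T t)%:E * heat t h z)%E.
  by move=> t0; rewrite (heat_kernelE mh h0 z t0); exact: (kern0 _ _ _ k0 h0).
have m1 : measurable_fun setT (fun t : R => ((kill_until T t)%:E * heat_kernel h (t, z))%E).
  have m3 := mkern 0 z mk mh h0.
  by apply: (eq_measurable_fun _ _ m3) => r _; rewrite (add0r r).
have m2 := mkern 0 z measurable_kill mh h0.
have E3 : (green_op h z = \int[mu]_(t in Pos) ((kill (0 + t))%:E * heat_kernel h (t, z)))%E.
  exact: (potentialE kill mh h0 0 z).
rewrite E3; apply: ge0_le_integral.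
- exact: measurable_itv.
- by move=> t; rewrite /= in_itv/= andbT => t0; exact: E2.
- apply: (eq_measurable_fun _ _ (measurable_funTS m1)) => t.
  by rewrite inE/= in_itv/= andbT => t0; rewrite (heat_kernelE mh h0 z t0).
- exact: (measurable_funTS m2).
- by move=> t; rewrite /= in_itv/= andbT => t0; exact: E1.
Qed.

(** In Duhamel's formula the term of the negative part is nonnegative and is dropped; the horizon is
    then relaxed inside the potential. *)
Lemma occupation_until_le (T : R) (h : R * R -> \bar R) :
  measurable_fun setT h -> (forall x, (0 <= h x)%E) ->
  (occ (kill_until T) h <=
   green_op h z + occ (kill_until T) (fun x => (pos_part x)%:E * green_op h x))%E.
Proof.
move=> mh h0.
have mk := measurable_kill_until T; have k0 := kill_until_ge0 T.
have mG := measurable_green_op mh h0.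
have G0 x : (0 <= green_op h x)%E by exact: green_op_ge0.
have mpG : measurable_fun setT (fun x => (pos_part x)%:E * green_op h x)%E.
  by apply: emeasurable_funM => //; apply/measurable_EFinP; exact: measurable_pos_part.
have mpot : measurable_fun setT (fun p : R * Omega => potential (kill_until T) h p.1 (X p.1 p.2)).
  have mp : measurable_fun setT (fun p : R * Omega => (p.1, X p.1 p.2)).
    by apply: measurable_fun_pair; [exact: measurable_fst|exact: mX].
  exact: (measurableT_comp (measurable_potential2 mk k0 mh h0) mp).
pose c (U : R * R -> R) (p : R * Omega) : \bar R :=
  ((U (X p.1 p.2) * weight z W V p.1 p.2)%:E * potential (kill_until T) h p.1 (X p.1 p.2))%E.
have c0 U p : (forall x, 0 <= U x) -> (0 <= c U p)%E.
  by move=> U0; rewrite mule_ge0 ?lee_fin ?mulr_ge0 ?weight_ge0//; exact: potential_ge0.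
have mc U : measurable_fun setT U -> measurable_fun setT (c U).
  move=> mU; apply: emeasurable_funM => //; apply/measurable_EFinP.
  by apply: measurable_funM => //; exact: measurableT_comp mU mX.
have duh := duhamel WB mV VK mk k0 mh h0.
apply: (@le_trans _ _ (occ (kill_until T) h +
  \int[mu]_(s in Pos) \int[P]_w c neg_part (s, w))%E).
  apply: leeDl; apply: integral_ge0 => s _; apply: integral_ge0 => w _.
  by apply: c0; exact: neg_part_ge0.
have -> : (occ (kill_until T) h + \int[mu]_(s in Pos) \int[P]_w c neg_part (s, w) =
   \int[mu]_(t in Pos) ((kill_until T t)%:E * heat t h z) +
   \int[mu]_(s in Pos) \int[P]_w c pos_part (s, w))%E by exact: duh.
apply: leeD.
  exact: kill_until_heat_le.
rewrite ge0_iterated_integralE; last 2 first.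
- exact: (mc _ measurable_pos_part).
- by move=> p; apply: c0; exact: pos_part_ge0.
have pG0 x : (0 <= (pos_part x)%:E * green_op h x)%E by rewrite mule_ge0 ?lee_fin ?pos_part_ge0.
rewrite (occupationE mk k0 mpG pG0).
have cle (p : R * Omega) : (c pos_part p <=
    occ_integrand (kill_until T) (fun x => (pos_part x)%:E * green_op h x) p)%E.
  rewrite /occ_integrand -swapE; apply: lee_wpmul2l.
    by rewrite lee_fin mulr_ge0 ?pos_part_ge0 ?weight_ge0.
  exact: potential_kill_until_le.
apply: ge0_le_integral; first exact: mD.
- by move=> p _; apply: c0; exact: pos_part_ge0.
- exact: (measurable_funTS (mc _ measurable_pos_part)).
- by apply: measurable_funTS; exact: measurable_occ_integrand.
- by move=> p _; exact: cle.
Qed.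

Lemma weight_le (t : R) (w : Omega) : 0 <= t -> weight z W V t w <= expR (K * t).
Proof.
move=> t0; rewrite /weight ler_expR.
have mVX : measurable_fun setT (fun s : R => V (X s w)).
  exact: (measurableT_comp mV (measurableT_comp mX (pair2_measurable w))).
exact: (primitive_le mVX (fun s => VK _) t0).
Qed.

Let K0 : 0 <= K. Proof. exact: le_trans (normr_ge0 (V 0)) (VK 0). Qed.

(** Up to the horizon the weight is at most [expR (K * T)]. The bound degenerates as [T] grows; its
    only purpose is finiteness. *)
Lemma occupation_until_fin (T : R) : 0 < T -> (occ (kill_until T) (cst 1%E) < +oo)%E.
Proof.
move=> T0; have k0 := kill_until_ge0 T.
have one0 (x : R * R) : (0 <= cst (1%E : \bar R) x)%E by exact: lee01.
have mbound : measurable_fun setT (fun t : R => ((expR (K * T))%:E * (\1_(`]-oo, T]%classic) t)%:E)%E).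
  apply: emeasurable_funM => //; apply/measurable_EFinP; exact: measurable_indic.
have H (t : R) : 0 < t -> (\int[P]_w ((kill_until T t * weight z W V t w)%:E * cst 1%E (X t w)) <=
    (expR (K * T))%:E * (\1_(`]-oo, T]%classic) t)%:E)%E.
  move=> t0; set b := (X in (_ <= X)%E).
  have bE : (\int[P]_w (cst b) w = b)%E.
    have P1 : P setT = 1%E by exact: probability_setT.
    transitivity (b * P setT)%E; last by rewrite P1 mule1.
    exact: (integral_cst P measurableT b).
  rewrite -bE.
  have mo := measurable_occ_integrand (measurable_kill_until T) (measurable_cst (1%E : \bar R)).
  apply: ge0_le_integral; first exact: measurableT.
  - by move=> w _; exact: (occ_integrand_ge0 (t, w) k0 one0).
  - exact: (measurableT_comp mo (pair1_measurable t)).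
  - exact: measurable_cst.
  - move=> w _; rewrite mule1 /b -EFinM lee_fin indicE /kill_until mulrAC.
    have -> : (t \in `]-oo, T]%classic) = (t <= T) by apply/idP/idP; rewrite inE/= in_itv.
    case: (leP t T) => [tT|_]; rewrite ?mulr0// !mulr1.
    rewrite -[leRHS]mul1r ler_pM ?expR_ge0 ?weight_ge0 ?kill_ge0//.
      by rewrite /kill -expR0 ler_expR oppr_le0 mulr_ge0 ?ltW.
    by rewrite (le_trans (weight_le w (ltW t0)))// ler_expR ler_wpM2l.
have fin : (\int[mu]_(t in Pos) ((expR (K * T))%:E * (\1_(`]-oo, T]%classic) t)%:E) < +oo)%E.
  rewrite ge0_integralZl//; last first.
    by apply: measurable_funTS; apply/measurable_EFinP; exact: measurable_indic.
  rewrite integral_indic//.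
  rewrite (_ : _ `&` _ = `]0%R, T]%classic); last first.
    apply/seteqP; split => t /=; rewrite !in_itv/= andbT; first by case=> -> ->.
    by move=> /andP[].
  by rewrite /= lebesgue_measure_itv/= lte_fin T0 sube0 -EFinM ltry.
apply: le_lt_trans fin; apply: ge0_le_integral.
- exact: measurable_itv.
- by move=> t _; apply: integral_ge0 => w _; exact: (occ_integrand_ge0 (t, w) k0 one0).
- apply: measurable_funTS.
  have mo := measurable_occ_integrand (measurable_kill_until T) (measurable_cst (1%E : \bar R)).
  exact: (measurable_ge0_integral P measurableT mo (fun p => occ_integrand_ge0 p k0 one0)).
- exact: measurable_funTS mbound.
- by move=> t; rewrite /= in_itv/= andbT => t0; exact: H.
Qed.

(** Monotone convergence removes the horizon from any bound that is uniform in it. *)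
Lemma occupation_kill_le (h : R * R -> \bar R) (C : \bar R) :
  measurable_fun setT h -> (forall x, (0 <= h x)%E) ->
  (forall n : nat, (occ (kill_until n.+1%:R) h <= C)%E) -> (occ kill h <= C)%E.
Proof.
move=> mh h0 bound.
pose g (n : nat) := occ_integrand (kill_until n.+1%:R) h.
have mg n : measurable_fun D (g n).
  by apply: measurable_funTS; exact: measurable_occ_integrand (measurable_kill_until _) mh.
have g0 n p : D p -> (0 <= g n p)%E.
  by move=> _; exact: occ_integrand_ge0 (kill_until_ge0 _) h0.
have homo p : D p -> {homo g^~ p : n m / (n <= m)%N >-> (n <= m)%E}.
  move=> _ n m nm; rewrite /g /occ_integrand; apply: lee_wpmul2r => //.
  rewrite lee_fin ler_wpM2r ?weight_ge0// /kill_until ler_wpM2l ?kill_ge0//.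
  rewrite ler_nat; case: (leP p.1 n.+1%:R) => // pn.
  by rewrite (le_trans pn)// ler_nat.
have lim p : limn (g^~ p) = occ_integrand kill h p.
  apply: cvg_lim => //; apply: cvg_near_cst.
  near=> n; rewrite /g /occ_integrand /kill_until.
  suff -> : (p.1 <= n.+1%:R) by rewrite mulr1.
  rewrite (le_trans (ler_norm _))// (le_trans (ltW (archi_boundP _)))//.
  rewrite ler_nat ltnW// ltnS; near: n; exact: nbhs_infty_ge.
have cvg := cvg_monotone_convergence (mu := (mu \x P)%E) mD mg g0 homo.
have -> : occ kill h = (\int[mu \x P]_(p in D) limn (g^~ p))%E.
  rewrite (occupationE measurable_kill kill_ge0 mh h0).
  by apply: eq_integral => p _; rewrite lim.
apply: (cvge_to_le cvg); near=> n.
rewrite -(occupationE (measurable_kill_until n.+1%:R) (kill_until_ge0 n.+1%:R) mh h0).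
exact: bound.
Unshelve. all: by end_near. Qed.

Let absV (x : R * R) : \bar R := (`|V x|)%:E.
Let mabsV : measurable_fun setT absV.
Proof. by apply/measurable_EFinP; exact: measurableT_comp. Qed.
Let absV0 x : (0 <= absV x)%E. Proof. by rewrite lee_fin. Qed.

Lemma pos_part_le x : pos_part x <= `|V x|.
Proof. by rewrite ge_max ler_norm normr_ge0. Qed.

Lemma occupation_until_absV_fin (T : R) : 0 < T -> (occ (kill_until T) absV < +oo)%E.
Proof.
move=> T0; have mk := measurable_kill_until T; have k0 := kill_until_ge0 T.
have m1 : measurable_fun setT (fun x : R * R => (K%:E * cst 1%E x)%E).
  exact: emeasurable_funM (measurable_cst _) (measurable_cst _).
have one0 (x : R * R) : (0 <= cst (1%E : \bar R) x)%E by exact: lee01.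
have absVK x : (absV x <= K%:E * cst 1%E x)%E by rewrite mule1 lee_fin.
apply: (@le_lt_trans _ _ (occ (kill_until T) (fun x => K%:E * cst 1%E x)%E)).
  exact: le_occupation.
rewrite (occupationZ mk k0 (measurable_cst _) one0); last by rewrite lee_fin.
by rewrite lte_mul_pinfty ?lee_fin// occupation_until_fin.
Qed.

(** Duhamel's formula bounds the occupation of [absV] by [green_op absV z] plus [theta] times the
    same occupation. At a finite horizon this occupation is finite, so the inequality can be solved
    for it, and the result does not depend on the horizon. *)
Lemma occupation_absV_le (theta : R) : 0 <= theta -> theta < 1 ->
  (forall x, V x != 0 -> (green_op absV x <= theta%:E)%E) ->
  (occ kill absV <= ((1 - theta)^-1)%:E * green_op absV z)%E.
Proof.
move=> theta0 theta1 small; apply: (occupation_kill_le mabsV absV0) => n.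
set T : R := n.+1%:R; have T0 : 0 < T by rewrite ltr0n.
have mk := measurable_kill_until T; have k0 := kill_until_ge0 T.
have mG := measurable_green_op mabsV absV0.
have G0 x : (0 <= green_op absV x)%E by exact: green_op_ge0.
have mpG : measurable_fun setT (fun x => (pos_part x)%:E * green_op absV x)%E.
  by apply: emeasurable_funM => //; apply/measurable_EFinP; exact: measurable_pos_part.
have pG0 x : (0 <= (pos_part x)%:E * green_op absV x)%E.
  by rewrite mule_ge0 ?lee_fin ?pos_part_ge0.
have mtV : measurable_fun setT (fun x => theta%:E * absV x)%E.
  exact: emeasurable_funM (measurable_cst _) mabsV.
have pGle x : ((pos_part x)%:E * green_op absV x <= theta%:E * absV x)%E.
  (* Smallness is known only where [V] does not vanish; elsewhere the factor [pos_part x] is 0. *)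
  have [Vx0|Vx0] := eqVneq (V x) 0.
    have -> : pos_part x = 0 by rewrite /pos_part Vx0 maxxx.
    by rewrite mul0e mule_ge0// lee_fin.
  apply: (@le_trans _ _ ((pos_part x)%:E * theta%:E)%E).
    by apply: lee_wpmul2l; [rewrite lee_fin pos_part_ge0|exact: small].
  by rewrite muleC; apply: lee_wpmul2l; rewrite lee_fin// pos_part_le.
have key : (occ (kill_until T) absV <=
    green_op absV z + theta%:E * occ (kill_until T) absV)%E.
  apply: (le_trans (occupation_until_le T mabsV absV0)); apply: leeD2l.
  rewrite -(occupationZ mk k0 mabsV absV0); last by rewrite lee_fin.
  exact: le_occupation.
have a0 := occupation_ge0 k0 absV0.
have aoo := occupation_until_absV_fin T0.
move: key a0 aoo (G0 z).
case: (occ (kill_until T) absV) => [a| |]//; case: (green_op absV z) => [g| |]//.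
- rewrite -!EFinM -EFinD !lee_fin => key _ _ _.
  have t1 : 0 < 1 - theta by rewrite subr_gt0.
  by rewrite ler_pdivlMl//; lra.
- by move=> _ _ _ _; rewrite gt0_muley ?leey// lte_fin invr_gt0 subr_gt0.
Qed.

Lemma heat_cst1 (r : R) (x : R * R) : heat r (cst 1%E) x = 1%E.
Proof.
rewrite /heat; pose m := normal_prob 0 (Num.sqrt r).
transitivity (1 * (m \x m)%E setT)%E.
  exact: (integral_cst (m \x m)%E measurableT 1%E).
by rewrite mul1e -setXTT product_measure1E//= !probability_setT mule1.
Qed.

(** The heat semigroup preserves 1, and [q * kill t] is the density of an exponential law. *)
Lemma green_op_cst1 x : green_op (cst 1%E) x = (q^-1)%:E.
Proof.
rewrite /green_op /potential.
have E (r : R) : 0 < r -> ((kill (0 + r))%:E * heat r (cst 1) x =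
   (q^-1)%:E * (exponential_pdf q r)%:E)%E.
  move=> r0; rewrite heat_cst1 mule1 add0r -EFinM /exponential_pdf patchE ifT; last first.
    by rewrite inE/= in_itv/= andbT ltW.
  by rewrite mulKf ?gt_eqF// /kill mulNr.
transitivity (\int[mu]_(r in Pos) ((q^-1)%:E * (exponential_pdf q r)%:E))%E.
  by apply: eq_integral => r; rewrite inE/= in_itv/= andbT; exact: E.
have me : measurable_fun setT (fun r : R => (exponential_pdf q r)%:E).
  by apply/measurable_EFinP; exact: measurable_exponential_pdf.
have e0 (r : R) : (0 <= (exponential_pdf q r)%:E)%E by rewrite lee_fin exponential_pdf_ge0 ?ltW.
have q10 : (0 <= (q^-1)%:E)%E by rewrite lee_fin invr_ge0 ltW.
rewrite (ge0_integralZl mu (measurable_itv _) (measurable_funTS me) (fun r _ => e0 r) q10).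
rewrite (_ : (\int[mu]_(r in Pos) (exponential_pdf q r)%:E = 1)%E) ?mule1//.
rewrite -(integral_exponential_pdf q0) integral_itv_obnd_cbnd; last exact: measurable_funTS.
rewrite integral_mkcond; apply: eq_integral => r _.
by rewrite patchE; case: ifPn => //; rewrite /exponential_pdf patchE => /negbTE ->.
Qed.

Lemma le_green_op h h' x : measurable_fun setT h -> (forall x, (0 <= h x)%E) ->
  measurable_fun setT h' -> (forall x, (h x <= h' x)%E) ->
  (green_op h x <= green_op h' x)%E.
Proof.
move=> mh h0 mh' hh'.
have h'0 y : (0 <= h' y)%E by exact: le_trans (h0 y) (hh' y).
rewrite /green_op (potentialE kill mh h0) (potentialE kill mh' h'0).
have mf := mkern 0 x measurable_kill mh h0.
have mf' := mkern 0 x measurable_kill mh' h'0.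
have f0 (r : R) : (0 <= (kill (0 + r))%:E * heat_kernel h (r, x))%E.
  exact: (kern0 _ _ _ kill_ge0 h0).
have mg (r : R) k : measurable_fun setT k -> measurable_fun setT
    (fun y : R * R => ((gauss2 (Num.max r 0) y)%:E * k (x + y)%R)%E).
  move=> mk; apply: emeasurable_funM.
    apply/measurable_EFinP.
    exact: (measurableT_comp measurable_gauss2 (pair1_measurable (Num.max r 0))).
  exact: (measurableT_comp mk (measurable_fun_addpair (measurable_cst x)
    (@measurable_id _ (R * R)%type setT))).
have fle (r : R) : ((kill (0 + r))%:E * heat_kernel h (r, x) <=
    (kill (0 + r))%:E * heat_kernel h' (r, x))%E.
  apply: lee_wpmul2l; first by rewrite lee_fin kill_ge0.
  have g0 y : 0 <= gauss2 (Num.max r 0) y by rewrite gauss2_ge0// le_max lexx orbT.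
  have mgh := mg r h mh; have mgh' := mg r h' mh'.
  have gh0 (y : R * R) : (0 <= (gauss2 (Num.max r 0) y)%:E * h (x + y)%R)%E.
    by apply: mule_ge0; [rewrite lee_fin g0|exact: h0].
  have ghle (y : R * R) : ((gauss2 (Num.max r 0) y)%:E * h (x + y)%R <=
      (gauss2 (Num.max r 0) y)%:E * h' (x + y)%R)%E.
    by apply: lee_wpmul2l; [rewrite lee_fin g0|exact: hh'].
  apply: (@ge0_le_integral _ _ _ leb2_sfm); first exact: measurableT.
  - by move=> y _; exact: gh0.
  - exact: mgh.
  - exact: mgh'.
  - by move=> y _; exact: ghle.
apply: ge0_le_integral; first exact: measurable_itv.
- by move=> r _; exact: f0.
- exact: (measurable_funTS mf).
- exact: (measurable_funTS mf').
- by move=> r _; exact: fle.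
Qed.

Lemma green_opZ h (k : \bar R) x : measurable_fun setT h -> (forall x, (0 <= h x)%E) ->
  (0 <= k)%E -> (green_op (fun y => k * h y) x = k * green_op h x)%E.
Proof.
move=> mh h0 k0.
have mkh : measurable_fun setT (fun y => k * h y)%E by exact: emeasurable_funM (measurable_cst _) mh.
have kh0 y : (0 <= k * h y)%E by rewrite mule_ge0.
rewrite /green_op (potentialE kill mkh kh0) (potentialE kill mh h0).
have mf := mkern 0 x measurable_kill mh h0.
have f0 (r : R) : (0 <= (kill (0 + r))%:E * heat_kernel h (r, x))%E.
  exact: (kern0 _ _ _ kill_ge0 h0).
rewrite -(ge0_integralZl mu (measurable_itv _) (measurable_funTS mf) (fun r _ => f0 r) k0).
have fE (r : R) : ((kill (0 + r))%:E * heat_kernel (fun y => k * h y)%E (r, x) =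
    k * ((kill (0 + r))%:E * heat_kernel h (r, x)))%E.
  have mgh : measurable_fun setT (fun y : R * R => ((gauss2 (Num.max r 0) y)%:E * h (x + y)%R)%E).
    apply: emeasurable_funM.
      apply/measurable_EFinP.
      exact: (measurableT_comp measurable_gauss2 (pair1_measurable (Num.max r 0))).
    exact: (measurableT_comp mh (measurable_fun_addpair (measurable_cst x)
      (@measurable_id _ (R * R)%type setT))).
  have gh0 (y : R * R) : (0 <= (gauss2 (Num.max r 0) y)%:E * h (x + y)%R)%E.
    by apply: mule_ge0; [rewrite lee_fin gauss2_ge0// le_max lexx orbT|exact: h0].
  have swap (y : R * R) : ((gauss2 (Num.max r 0) y)%:E * (k * h (x + y)%R) =
      k * ((gauss2 (Num.max r 0) y)%:E * h (x + y)%R))%E by rewrite muleCA.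
  have -> : heat_kernel (fun y => k * h y)%E (r, x) = (k * heat_kernel h (r, x))%E.
    rewrite /heat_kernel/= -(ge0_integralZl leb2_sfm measurableT mgh (fun y _ => gh0 y) k0).
    by apply: eq_integral => y _; exact: swap.
  by rewrite muleCA.
by apply: eq_integral => r _; exact: fE.
Qed.

(** Duhamel's formula for the constant 1, whose free resolvent is [q^-1], bounds the total mass by
    [q^-1] plus [q^-1] times the occupation of [absV]. *)
Lemma occupation_kill_fin (theta : R) : 0 <= theta -> theta < 1 ->
  (forall x, V x != 0 -> (green_op absV x <= theta%:E)%E) ->
  (green_op absV z < +oo)%E -> (occ kill (cst 1%E) < +oo)%E.
Proof.
move=> theta0 theta1 small Goo.
have one0 (x : R * R) : (0 <= cst (1%E : \bar R) x)%E by exact: lee01.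
have m1 : measurable_fun setT (cst (1%E : \bar R) : R * R -> \bar R) by exact: measurable_cst.
have G10 x : (0 <= green_op (cst 1%E) x)%E by exact: green_op_ge0.
have duh := duhamel_kill m1 one0.
have D0 : (0 <= occ kill (fun x => (neg_part x)%:E * green_op (cst 1%E) x))%E.
  apply: occupation_ge0; first exact: kill_ge0.
  by move=> x; apply: mule_ge0; [rewrite lee_fin; exact: neg_part_ge0|exact: G10].
apply: (@le_lt_trans _ _ (green_op (cst 1%E) z +
   occ kill (fun x => (pos_part x)%:E * green_op (cst 1%E) x))%E).
  by rewrite -duh; apply: leeDl.
rewrite green_op_cst1; apply: lte_add_pinfty; first exact: ltry.
have qV0 : (0 <= (q^-1)%:E :> \bar R)%E by rewrite lee_fin invr_ge0 ltW.
apply: (@le_lt_trans _ _ (occ kill (fun x => (q^-1)%:E * absV x)%E)).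
  apply: le_occupation.
  - exact: measurable_kill.
  - exact: kill_ge0.
  - apply: emeasurable_funM; last exact: measurable_green_op.
    by apply/measurable_EFinP; exact: measurable_pos_part.
  - by move=> x; apply: mule_ge0; [rewrite lee_fin; exact: pos_part_ge0|exact: G10].
  - exact: measurable_kill.
  - exact: emeasurable_funM (measurable_cst _) mabsV.
  - by move=> t _; exact: lexx.
  - move=> x; rewrite green_op_cst1 muleC; apply: lee_wpmul2l; first exact: qV0.
    by rewrite /absV lee_fin pos_part_le.
  - exact: kill_ge0.
rewrite (occupationZ measurable_kill kill_ge0 mabsV absV0 qV0).
apply: lte_mul_pinfty; [exact: qV0|by []|].
apply: (le_lt_trans (occupation_absV_le theta0 theta1 small)).
by apply: lte_mul_pinfty; [rewrite lee_fin invr_ge0 subr_ge0 ltW|by []|exact: Goo].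
Qed.

Definition bmeas (h : R * R -> R) : Prop :=
  measurable_fun setT h /\ exists C, forall x, `|h x| <= C.

Lemma bmeas_cst (c : R) : bmeas (fun=> c).
Proof. by split; [exact: measurable_cst|exists `|c|]. Qed.

Lemma bmeasD h h' : bmeas h -> bmeas h' -> bmeas (fun x => h x + h' x).
Proof.
move=> [mh [C hC]] [mh' [C' hC']]; split; first exact: measurable_funD.
by exists (C + C') => x; rewrite (le_trans (ler_normD _ _))// lerD.
Qed.

Lemma bmeasM h h' : bmeas h -> bmeas h' -> bmeas (fun x => h x * h' x).
Proof.
move=> [mh [C hC]] [mh' [C' hC']]; split; first exact: measurable_funM.
by exists (C * C') => x; rewrite normrM ler_pM.
Qed.

Lemma bmeasN h : bmeas h -> bmeas (fun x => - h x).
Proof.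
by move=> [mh [C hC]]; split; [exact: measurableT_comp|exists C => x; rewrite normrN].
Qed.

Lemma bmeasB h h' : bmeas h -> bmeas h' -> bmeas (fun x => h x - h' x).
Proof. by move=> bh bh'; apply: bmeasD => //; exact: bmeasN. Qed.

Lemma bmeas_abs h : bmeas h -> bmeas (fun x => `|h x|).
Proof.
by move=> [mh [C hC]]; split; [exact: measurableT_comp|exists C => x; rewrite normr_id].
Qed.

Lemma bmeas_max0 h : bmeas h -> bmeas (fun x => Num.max (h x) 0).
Proof.
move=> [mh [C hC]]; split; first exact: measurable_maxr.
exists C => x; have C0 := le_trans (normr_ge0 _) (hC x).
rewrite ger0_norm ?le_max ?lexx ?orbT// ge_max C0 andbT.
exact: le_trans (ler_norm _) (hC x).
Qed.

Lemma bmeas_EFin h : bmeas h -> measurable_fun setT (EFin \o h).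
Proof. by move=> [mh _]; apply/measurable_EFinP. Qed.

Lemma bmeas_fine_green_op h : bmeas h -> (forall x, 0 <= h x) ->
  (forall x, green_op (EFin \o h) x = (fine (green_op (EFin \o h) x))%:E) /\
  bmeas (fun x => fine (green_op (EFin \o h) x)).
Proof.
move=> bh h0; have mh := bmeas_EFin bh; have [_ [C hC]] := bh.
have h0e x : (0 <= (EFin \o h) x)%E by rewrite lee_fin.
have C0 : 0 <= C by exact: le_trans (normr_ge0 _) (hC 0).
have G0 x := green_op_ge0 x mh h0e.
have GC x : (green_op (EFin \o h) x <= (C * q^-1)%:E)%E.
  have m1 : measurable_fun setT (cst (1%E : \bar R) : R * R -> \bar R) by exact: measurable_cst.
  have one0 (y : R * R) : (0 <= cst (1%E : \bar R) y)%E by exact: lee01.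
  have C0e : (0 <= C%:E)%E by rewrite lee_fin.
  rewrite EFinM -(green_op_cst1 x) -(green_opZ x m1 one0 C0e).
  apply: le_green_op.
  - exact: mh.
  - exact: h0e.
  - exact: emeasurable_funM (measurable_cst _) m1.
  - by move=> y; rewrite mule1 /= lee_fin (le_trans (ler_norm _)).
have fin x : green_op (EFin \o h) x = (fine (green_op (EFin \o h) x))%:E.
  rewrite fineK// ge0_fin_numE; last exact: G0.
  exact: le_lt_trans (GC x) (ltry _).
split; first exact: fin.
split.
  apply: measurableT_comp; first exact: fine_measurable.
  exact: measurable_green_op.
exists (C * q^-1) => x; rewrite ger0_norm; last exact: fine_ge0 (G0 x).
by rewrite -lee_fin -fin; exact: GC.
Qed.

Lemma bmeasV : bmeas V. Proof. by split; [exact: mV|exists K]. Qed.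

Hypothesis mass_fin : (occ kill (cst 1%E) < +oo)%E.
Local Notation nu := (mu \x P)%E.

Definition km_integrand (h : R * R -> R) (p : R * Omega) : R :=
  kill p.1 * weight z W V p.1 p.2 * h (X p.1 p.2).

(** One integral over the product of time and outcomes, so that linearity for signed bounded
    functions is that of the integral. Integrability rests on [mass_fin]. *)
Definition killed_mean (h : R * R -> R) : R := \int[nu]_(p in D) km_integrand h p.

Let mkm h : bmeas h -> measurable_fun setT (km_integrand h).
Proof.
move=> [mh _]; apply: measurable_funM; last exact: measurableT_comp mh mX.
apply: measurable_funM => //; exact: measurableT_comp measurable_kill measurable_fst.
Qed.

Let kmw0 (p : R * Omega) : 0 <= kill p.1 * weight z W V p.1 p.2.
Proof. by apply: mulr_ge0; [exact: kill_ge0|exact: weight_ge0]. Qed.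

Let occ_km h p : occ_integrand kill (EFin \o h) p = (km_integrand h p)%:E.
Proof. by rewrite /occ_integrand -EFinM. Qed.

Lemma km_integrable h : bmeas h -> nu.-integrable D (EFin \o km_integrand h).
Proof.
move=> bh; have [_ [C hC]] := bh.
have C0 : 0 <= C by exact: le_trans (normr_ge0 _) (hC 0).
apply/integrableP; split.
  by apply/measurable_EFinP; apply: measurable_funTS; exact: mkm.
have one0 (x : R * R) : (0 <= cst (1%E : \bar R) x)%E by exact: lee01.
have m1 : measurable_fun setT (cst (1%E : \bar R) : R * R -> \bar R) by exact: measurable_cst.
have C0e : (0 <= C%:E)%E by rewrite lee_fin.
apply: (@le_lt_trans _ _ (C%:E * occ kill (cst 1%E))%E); last by apply: lte_mul_pinfty.
rewrite -(occupationZ measurable_kill kill_ge0 m1 one0 C0e).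
have mC1 : measurable_fun setT (fun x : R * R => C%:E * cst 1%E x)%E.
  exact: emeasurable_funM (measurable_cst _) m1.
have C10 (x : R * R) : (0 <= C%:E * cst 1%E x)%E by rewrite mule1.
rewrite (occupationE measurable_kill kill_ge0 mC1 C10).
have le (p : R * Omega) : (`|(EFin \o km_integrand h) p| <=
    occ_integrand kill (fun x => C%:E * cst 1%E x) p)%E.
  by rewrite /occ_integrand mule1 -EFinM /= lee_fin normrM ger0_norm// ler_wpM2l.
apply: ge0_le_integral; first exact: mD.
- by move=> p _; exact: abse_ge0.
- apply: measurable_funTS; apply: measurableT_comp => //.
  by apply/measurable_EFinP; exact: mkm.
- exact: (measurable_funTS (measurable_occ_integrand measurable_kill mC1)).
- by move=> p _; exact: le.
Qed.

Lemma km_occ h : bmeas h -> (forall x, 0 <= h x) ->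
  occ kill (EFin \o h) = (killed_mean h)%:E.
Proof.
move=> bh h0; have mh := bmeas_EFin bh.
have h0e x : (0 <= (EFin \o h) x)%E by rewrite lee_fin.
rewrite (occupationE measurable_kill kill_ge0 mh h0e).
rewrite /killed_mean /Rintegral fineK; last exact: integrable_fin_num (km_integrable bh).
by apply: eq_integral => p _; exact: occ_km.
Qed.

Lemma kmD h h' : bmeas h -> bmeas h' ->
  killed_mean (fun x => h x + h' x) = killed_mean h + killed_mean h'.
Proof.
move=> bh bh'; rewrite /killed_mean -RintegralD; last 3 first.
- exact: mD.
- exact: (km_integrable bh).
- exact: (km_integrable bh').
have E (p : R * Omega) : km_integrand (fun x => h x + h' x) p =
    km_integrand h p + km_integrand h' p by rewrite /km_integrand mulrDr.
by apply: eq_Rintegral => p _; exact: E.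
Qed.

Lemma kmZ c h : bmeas h -> killed_mean (fun x => c * h x) = c * killed_mean h.
Proof.
move=> bh; rewrite /killed_mean -RintegralZl; last 2 first.
- exact: mD.
- exact: (km_integrable bh).
have E (p : R * Omega) : km_integrand (fun x => c * h x) p = c * km_integrand h p.
  by rewrite /km_integrand mulrCA.
by apply: eq_Rintegral => p _; exact: E.
Qed.

Lemma kmB h h' : bmeas h -> bmeas h' ->
  killed_mean (fun x => h x - h' x) = killed_mean h - killed_mean h'.
Proof.
move=> bh bh'; rewrite (kmD bh (bmeasN bh')); congr (_ + _).
rewrite -[RHS]mulN1r -(kmZ (-1) bh'); congr killed_mean; apply/funext => x.
by rewrite mulN1r.
Qed.

Lemma km_norm_le h h' : bmeas h -> bmeas h' -> (forall x, `|h x| <= h' x) ->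
  `|killed_mean h| <= killed_mean h'.
Proof.
move=> bh bh' hh'; rewrite /killed_mean.
have ih := km_integrable bh; have ih' := km_integrable bh'.
have le (p : R * Omega) : `|km_integrand h p| <= km_integrand h' p.
  by rewrite /km_integrand normrM ger0_norm// ler_wpM2l.
apply: le_trans; first by apply: le_normr_Rintegral; [exact: mD|exact: ih].
apply: le_Rintegral; first exact: mD.
- exact: integrable_norm ih.
- exact: ih'.
- by move=> p _; exact: le.
Qed.

(** All terms of [duhamel_kill] are finite by now, so the term of the negative part changes sides
    and recombines with the positive one into [V]. *)
Lemma km_duhamel h : bmeas h -> (forall x, 0 <= h x) ->
  killed_mean h = fine (green_op (EFin \o h) z) +
    killed_mean (fun x => V x * fine (green_op (EFin \o h) x)).
Proof.
move=> bh h0; have mh := bmeas_EFin bh.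
have h0e x : (0 <= (EFin \o h) x)%E by rewrite lee_fin.
have [Gfin bG] := bmeas_fine_green_op bh h0.
set G := fun x => fine (green_op (EFin \o h) x).
have G0 x : 0 <= G x by rewrite /G -lee_fin -Gfin; exact: green_op_ge0.
have bp : bmeas pos_part := bmeas_max0 bmeasV.
have bn : bmeas neg_part := bmeas_max0 (bmeasN bmeasV).
have E (U : R * R -> R) : bmeas U -> (forall x, 0 <= U x) ->
    occ kill (fun x => (U x)%:E * green_op (EFin \o h) x)%E = (killed_mean (fun x => U x * G x))%:E.
  move=> bU U0.
  have UG0 x : 0 <= U x * G x by apply: mulr_ge0; [exact: U0|exact: G0].
  rewrite -(km_occ (bmeasM bU bG) UG0).
  by congr occupation; apply/funext => x; rewrite Gfin -EFinM.
have duh : killed_mean h + killed_mean (fun x => neg_part x * G x) =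
    G z + killed_mean (fun x => pos_part x * G x).
  apply: EFin_inj; rewrite !EFinD -(km_occ bh h0) -(E _ bn neg_part_ge0) -(E _ bp pos_part_ge0).
  rewrite /G -Gfin; exact: duhamel_kill.
have -> : (fun x => V x * G x) = (fun x => pos_part x * G x - neg_part x * G x).
  apply/funext => x; rewrite -mulrBl; congr (_ * _).
  rewrite /pos_part /neg_part; have [v|v] := leP 0 (V x).
    by rewrite max_r ?subr0// oppr_le0.
  by rewrite max_l ?sub0r ?opprK// oppr_ge0 ltW.
rewrite (kmB (bmeasM bp bG) (bmeasM bn bG)) addrA.
by apply: (@addIr _ (killed_mean (fun x => neg_part x * G x))); rewrite duh subrK.
Qed.
End Killed.
End Occupation.

(** * Euler's constant and the exponential integral *)

Section ExponentialIntegral.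
Context {R : realType}.
Local Notation mu := (@lebesgue_measure R).

Lemma integral_FTC_gt0 (F f : R -> R) (a b : R) : 0 < a -> a < b ->
  (forall t : R, 0 < t -> is_derive t 1 F (f t)) ->
  (forall t : R, 0 < t -> {for t, continuous f}) ->
  (\int[mu]_(t in `[a, b]) (f t)%:E = (F b - F a)%:E)%E.
Proof.
move=> a0 ab dF cf; have b0 := lt_trans a0 ab.
have cF (t : R) : 0 < t -> {for t, continuous F}.
  move=> t0; apply: differentiable_continuous; apply/derivable1_diffP.
  by have [] := dF t t0.
rewrite EFinB; apply: continuous_FTC2 => //.
- apply/(continuous_within_itvP _ ab); split.
  + by move=> t; rewrite in_itv/= => /andP[at_ _]; apply: cf; exact: lt_trans at_.
  + by apply: cvg_at_right_filter; exact: cf.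
  + by apply: cvg_at_left_filter; exact: cf.
- split.
  + by move=> t; rewrite in_itv/= => /andP[at_ _]; have [] := dF t (lt_trans a0 at_).
  + by apply: cvg_at_right_filter; exact: cF.
  + by apply: cvg_at_left_filter; exact: cF.
- move=> t; rewrite in_itv/= => /andP[at_ _]; rewrite derive1E.
  by have [_ ->] := dF t (lt_trans a0 at_).
Qed.

Definition harmonic_gap (n : nat) : R := \sum_(1 <= k < n.+1) k%:R^-1 - ln n%:R.

(** [euler_mascheroni] is a [limn], which is informative only for a convergent sequence. The gap
    decreases and is nonnegative, by comparing [ln] increments with reciprocals. *)
Lemma harmonic_gap_cvg : harmonic_gap n @[n --> \oo] --> euler_mascheroni R.
Proof.
rewrite /euler_mascheroni -/harmonic_gap.
have lnS (n : nat) : (0 < n)%N -> (n.+1%:R^-1 : R) <= ln n.+1%:R - ln n%:R <= (n%:R^-1 : R).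
  move=> n0; have n0' : 0 < n%:R :> R by rewrite ltr0n.
  have Sn0 : 0 < n.+1%:R :> R by rewrite ltr0n.
  apply/andP; split.
    have := @le_ln1Dx R (- n.+1%:R^-1).
    have -> : 1 + - n.+1%:R^-1 = n%:R / n.+1%:R :> R.
      by rewrite -natr1; field; rewrite natr1 gt_eqF.
    rewrite ln_div ?posrE// => H; have : ln n%:R - ln n.+1%:R <= - n.+1%:R^-1 :> R.
      by apply: H; rewrite ltrN2 invf_lt1// ltr1n.
    by rewrite -[leLHS]opprB lerN2.
  have iv : 0 < n%:R^-1 :> R by rewrite invr_gt0.
  have H := le_ln1Dx (lt_trans (ltrN10 R) iv).
  have E : 1 + n%:R^-1 = n.+1%:R / n%:R :> R by rewrite -natr1; field; rewrite gt_eqF.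
  by move: H; rewrite E ln_div ?posrE.
have gapS (n : nat) : harmonic_gap n.+2 <= harmonic_gap n.+1.
  rewrite /harmonic_gap (big_nat_recr n.+2)//=.
  have /andP[+ _] := lnS n.+1 (ltn0Sn n).
  move: (n.+2%:R^-1 : R) (ln n.+2%:R : R) (ln n.+1%:R : R) (\sum_(1 <= k < n.+2) k%:R^-1 : R).
  by move=> x y w s; lra.
have gap_ge0 (n : nat) : 0 <= harmonic_gap n.+1.
  (* The sum up to [n.+1] is compared with the logarithm one index further, the form that passes
     through the induction. *)
  suff : ln n.+2%:R <= \sum_(1 <= k < n.+2) k%:R^-1 :> R.
    move=> H; rewrite /harmonic_gap subr_ge0; apply: le_trans H.
    by rewrite ler_ln ?posrE ?ltr0n// ler_nat.
  elim: n => [|n IH].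
    rewrite big_nat1 invr1; have := @le_ln1Dx R 1; rewrite -natr1 addrC; apply.
    by rewrite (@lt_trans _ _ 0)// ltrN10.
  rewrite (big_nat_recr n.+2)//=; have /andP[_ +] := lnS n.+2 (ltn0Sn _); move: IH.
  move: (n.+2%:R^-1 : R) (ln n.+2%:R : R) (ln n.+3%:R : R) (\sum_(1 <= k < n.+2) k%:R^-1 : R).
  by move=> x y w s; lra.
(* Monotonicity starts at index 1 only: since [ln 0 = 0], the gap is 0 at index 0 and 1 at index
   1. *)
have cvgS : cvgn (fun n => harmonic_gap n.+1).
  apply: nonincreasing_is_cvgn.
    by apply/nonincreasing_seqP => n; exact: gapS.
  by exists 0 => _ [n _ <-]; exact: gap_ge0.
have : cvgn harmonic_gap.
  apply/cvg_ex; move/cvg_ex : cvgS => [l hl]; exists l.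
  by rewrite -(cvg_shiftS harmonic_gap).
by [].
Qed.

Lemma expR_sub_pow_ge0 (v : R) (n : nat) : 0 <= v <= n%:R -> (0 < n)%N ->
  (1 - v / n%:R) ^+ n <= expR (- v).
Proof.
move=> /andP[v0 vn] n0; have n0' : 0 < n%:R :> R by rewrite ltr0n.
have -> : expR (- v) = expR (- (v / n%:R)) ^+ n.
  by rewrite -expRM_natl; congr expR; field; rewrite gt_eqF.
apply: lerXn2r; rewrite ?nnegrE ?expR_ge0//.
  by rewrite subr_ge0 ler_pdivrMr// mul1r.
exact: expR_ge1Dx.
Qed.

(** For [w = v / n%:R], the difference of the [n]-th powers of [expR (- w)] and [1 - w] is the
    difference of the bases, at most [w ^+ 2], times a sum of [n] terms that are at most 1. *)
Lemma expR_sub_pow_le (v : R) (n : nat) : 0 <= v <= n%:R -> (0 < n)%N ->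
  expR (- v) <= (1 - v / n%:R) ^+ n + v ^+ 2 / n%:R.
Proof.
move=> /andP[v0 vn] n0; have n0' : 0 < n%:R :> R by rewrite ltr0n.
pose w := v / n%:R; have w0 : 0 <= w by rewrite divr_ge0// ltW.
have w1 : w <= 1 by rewrite ler_pdivrMr// mul1r.
have -> : expR (- v) = expR (- w) ^+ n.
  by rewrite -expRM_natl; congr expR; rewrite /w; field; rewrite gt_eqF.
have e1 : expR (- w) <= 1 by rewrite -expR0 ler_expR oppr_le0.
have eb : expR (- w) - (1 - w) <= w ^+ 2.
  have nw : - w <= 0 by rewrite oppr_le0.
  have := expR_taylor1_le nw (lexx 0); rewrite expR0 subr0 !mul1r normrN (ger0_norm w0).
  by move=> /(le_trans (ler_norm _)); rewrite opprK; lra.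
rewrite -/w -lerBlDl subrXX.
apply: (@le_trans _ _ (w ^+ 2 * n%:R)); last first.
  by rewrite le_eqVlt; apply/orP; left; apply/eqP; rewrite /w; field; rewrite gt_eqF.
apply: ler_pM.
- by rewrite subr_ge0; exact: expR_ge1Dx.
- by apply: sumr_ge0 => i _; rewrite mulr_ge0// exprn_ge0 ?expR_ge0// subr_ge0.
- exact: eb.
- rewrite -[n in leRHS]card_ord -sum1_card natr_sum; apply: ler_sum => i _.
  rewrite mulr_ile1 ?exprn_ge0 ?expR_ge0 ?subr_ge0// exprn_ile1 ?expR_ge0 ?subr_ge0//.
  by lra.
Qed.

Variable (q : R).
Hypothesis q0 : 0 < q.

(** For [c = q / n%:R], the geometric sum [c * \sum_(k < n) (1 - c * t) ^+ k] equals
    [(1 - (1 - c * t) ^+ n) / t]; subtracting it from [t^-1] leaves the integrand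
    [pow_kernel n t]. *)
Definition log_antiderivative (n : nat) (t : R) : R :=
  ln t + \sum_(k < n) (1 - q / n%:R * t) ^+ k.+1 / k.+1%:R.

Lemma is_derive_log_antiderivative (n : nat) (t : R) : 0 < t ->
  is_derive t 1 (log_antiderivative n) ((1 - q / n%:R * t) ^+ n / t).
Proof.
move=> t0; set c := q / n%:R.
suff H m : is_derive t 1 (fun t : R => ln t + \sum_(k < m) (1 - c * t) ^+ k.+1 / k.+1%:R)
    ((1 - c * t) ^+ m / t) by exact: H.
elim: m => [|m IH].
  rewrite expr0 mul1r.
  have -> : (fun t : R => ln t + \sum_(k < 0) (1 - c * t) ^+ k.+1 / k.+1%:R) = @ln R.
    by apply/funext => u; rewrite big_ord0 addr0.
  exact: is_derive1_ln.
pose L : R -> R := fun t => 1 - c * t.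
have dl : is_derive t 1 L (- c).
  by apply: is_derive_eq; rewrite /GRing.scale/=; ring.
have dZ := is_deriveZ (m.+1%:R^-1) (is_deriveX m.+1 dl).
have dS := is_deriveD IH dZ.
have LXE n' u : (L ^+ n') u = (1 - c * u) ^+ n'.
  by elim: n' => [|n' IHn]; rewrite ?expr0// !exprS -IHn.
have -> : (fun t : R => ln t + \sum_(k < m.+1) (1 - c * t) ^+ k.+1 / k.+1%:R) =
    (fun t : R => ln t + \sum_(k < m) (1 - c * t) ^+ k.+1 / k.+1%:R) +
    m.+1%:R^-1 \*: (L ^+ m.+1).
  apply/funext => u; rewrite big_ord_recr/= addrA; congr (_ + _).
  by rewrite /= LXE mulrC.
apply: (is_derive_eq dS); rewrite /L.
rewrite /GRing.scale/= exprS; field.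
by rewrite gt_eqF//= -[1]/(1%:R) -natrD pnatr_eq0.
Qed.

Lemma bernoulli_le (x : R) (k : nat) : 0 <= x <= (1 : R) -> 0 <= 1 - x ^+ k <= k%:R * (1 - x).
Proof.
move=> /andP[x0 x1]; rewrite subr_ge0 exprn_ile1//=.
elim: k => [|k IH]; first by rewrite expr0 subrr mul0r.
have xk1 : x ^+ k <= 1 by rewrite exprn_ile1.
have : x * (1 - x ^+ k) <= 1 - x ^+ k by rewrite ler_piMl ?subr_ge0.
rewrite exprS -natr1; move: IH; move: (x ^+ k) (k%:R : R) => y w; nra.
Qed.

Definition pow_kernel (n : nat) (t : R) : R := (1 - q / n%:R * t) ^+ n / t.

Lemma continuous_pow_kernel n (t : R) : 0 < t -> {for t, continuous (pow_kernel n)}.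
Proof.
move=> t0; apply: cvgM; last by apply: cvgV; [rewrite gt_eqF|exact: cvg_id].
apply: (@cvg_comp _ _ _ (fun t => 1 - q / n%:R * t) (fun y : R => y ^+ n)); last exact: exprn_continuous.
by apply: cvgB; [exact: cvg_cst|apply: cvgM; [exact: cvg_cst|exact: cvg_id]].
Qed.

(** The source of Euler's constant. At the upper endpoint the powers vanish; with
    [x = 1 - q * t0 / n%:R], adding the harmonic gap and the logarithm leaves the sum of the
    [(1 - x ^+ k.+1) / k.+1%:R], which Bernoulli's inequality places between 0 and
    [n%:R * (1 - x) = q * t0]. *)
Lemma integral_pow_kernel (n : nat) (t0 : R) : 0 < t0 -> q * t0 < n%:R ->
  exists A : R, (\int[mu]_(t in `[t0, (n%:R / q)%R]) (pow_kernel n t)%:E = A%:E)%E /\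
    0 <= A + harmonic_gap n + ln (q * t0) <= q * t0.
Proof.
move=> t00 bn; have n0 : 0 < n%:R :> R by apply: lt_trans bn; rewrite mulr_gt0.
have tn : t0 < n%:R / q by rewrite ltr_pdivlMr// mulrC.
exists (log_antiderivative n (n%:R / q) - log_antiderivative n t0); split.
  apply: integral_FTC_gt0 => //.
  - by move=> t tt; exact: is_derive_log_antiderivative.
  - by move=> t tt; exact: continuous_pow_kernel.
pose x := 1 - q * t0 / n%:R.
have x01 : 0 <= x <= (1 : R).
  rewrite subr_ge0 ler_pdivrMr// mul1r ltW//= gerBl divr_ge0 ?(ltW n0)//.
  by rewrite mulr_ge0// ltW.
rewrite /log_antiderivative ln_div ?posrE// [ln (q * t0)]lnM ?posrE//.
have -> : \sum_(k < n) (1 - q / n%:R * (n%:R / q)) ^+ k.+1 / k.+1%:R = 0 :> R.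
  apply: big1 => k _.
  have -> : 1 - q / n%:R * (n%:R / q) = 0 :> R by field; rewrite !gt_eqF.
  by rewrite expr0n/= mul0r.
have -> : 1 - q / n%:R * t0 = x by rewrite /x mulrAC.
rewrite /harmonic_gap big_add1/= big_mkord.
have -> : ln n%:R - ln q + 0 - (ln t0 + \sum_(k < n) x ^+ k.+1 / k.+1%:R) +
   (\sum_(k < n) k.+1%:R^-1 - ln n%:R) + (ln q + ln t0) =
   \sum_(k < n) (1 - x ^+ k.+1) / k.+1%:R :> R.
  have -> : \sum_(k < n) (1 - x ^+ k.+1) / k.+1%:R =
     \sum_(k < n) k.+1%:R^-1 - \sum_(k < n) x ^+ k.+1 / k.+1%:R :> R.
    by rewrite -sumrB; apply: eq_bigr => k _; rewrite mulrBl mul1r.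
  by ring.
apply/andP; split.
  apply: sumr_ge0 => k _; rewrite divr_ge0//.
  by have /andP[] := bernoulli_le k.+1 x01.
apply: (@le_trans _ _ (\sum_(k < n) (1 - x))).
  apply: ler_sum => k _; rewrite ler_pdivrMr// mulrC.
  by have /andP[_] := bernoulli_le k.+1 x01.
rewrite sumr_const card_ord -mulr_natl /x.
by rewrite le_eqVlt; apply/orP; left; apply/eqP; field; rewrite gt_eqF.
Qed.

Lemma integral_exhaust_le (f : R -> R) (a : R) (C : \bar R) : measurable_fun setT f ->
  (forall t, a <= t -> 0 <= f t) ->
  (forall n : nat, (\int[mu]_(t in `[a, (a + n.+1%:R)%R]) (f t)%:E <= C)%E) ->
  (\int[mu]_(t in `[a, +oo[) (f t)%:E <= C)%E.
Proof.
move=> mf f0 bound; pose F (n : nat) : set R := `[a, (a + n.+1%:R)%R]%classic.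
have FE : \bigcup_n F n = `[a, +oo[%classic.
  apply/seteqP; split => t; first by move=> [n _]; rewrite /F/= !in_itv/= => /andP[->].
  rewrite /= in_itv/= andbT => at_; exists (Num.bound (t - a)) => //.
  rewrite /F/= in_itv/= at_/= -lerBlDl ltW//.
  apply: lt_le_trans (archi_boundP _) _; first by rewrite subr_ge0.
  by rewrite ler_nat.
have mfE : measurable_fun setT (fun t => (f t)%:E) by apply/measurable_EFinP.
have nnd : {homo F : n m / (n <= m)%N >-> (n <= m)%O}.
  move=> n m nm; apply/subsetPset => t; rewrite /F/= !in_itv/= => /andP[-> /le_trans]; apply.
  by rewrite lerD2l ler_nat.
have mF n : measurable (F n) by exact: measurable_itv.
have mfF n : measurable_fun (F n) (fun t => (f t)%:E) by exact: measurable_funTS.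
have fF0 n t : F n t -> (0 <= (f t)%:E)%E.
  by rewrite /F/= in_itv/= => /andP[at_ _]; rewrite lee_fin f0.
have cv := ge0_nondecreasing_set_cvg_integral (mu := mu) nnd mF mfF fF0.
by rewrite -FE; apply: (cvge_to_le cv); apply: nearW => n; exact: bound.
Qed.

Definition exp_kernel (t : R) : R := expR (- (q * t)) / t.

Lemma measurable_exp_kernel : measurable_fun setT exp_kernel.
Proof.
apply: measurable_funM; last exact: measurable_inv.
exact: measurable_kill.
Qed.

Lemma exp_kernel_ge0 t : 0 <= t -> 0 <= exp_kernel t.
Proof. by move=> t0; rewrite divr_ge0 ?expR_ge0. Qed.

Lemma measurable_pow_kernel n : measurable_fun setT (pow_kernel n).
Proof.
apply: measurable_funM; last exact: measurable_inv.
apply: measurable_funX; apply: measurable_funB => //.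
Qed.

(** [exp_kernel] lies above [pow_kernel n] up to [n%:R / q], and on a bounded interval it lies below
    [pow_kernel n] plus an error of order [n%:R^-1]. The upper bound is therefore proved on bounded
    intervals, uniformly, and these exhaust the half-line. *)
Lemma exp_integral_bounds (t0 : R) : 0 < t0 ->
  ((- euler_mascheroni R - ln (q * t0))%:E <= \int[mu]_(t in `[t0, +oo[) (exp_kernel t)%:E <=
   (- euler_mascheroni R - ln (q * t0) + q * t0)%:E)%E.
Proof.
move=> t00; have b0 : 0 < q * t0 by rewrite mulr_gt0.
have mE : measurable_fun setT (fun t : R => (exp_kernel t)%:E).
  by apply/measurable_EFinP; exact: measurable_exp_kernel.
have mP n : measurable_fun setT (fun t : R => (pow_kernel n t)%:E).
  by apply/measurable_EFinP; exact: measurable_pow_kernel.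
have vn (n : nat) (t : R) : 0 < t -> t <= n%:R / q -> 0 < n%:R :> R -> 0 <= q * t <= (n%:R : R).
  by move=> tt tn n0; rewrite (mulr_ge0 (ltW q0) (ltW tt))/= mulrC -ler_pdivlMr.
have powE (n : nat) (t : R) : pow_kernel n t = (1 - (q * t) / n%:R) ^+ n / t.
  by rewrite /pow_kernel mulrAC.
have pow_ge0 (n : nat) (t : R) : 0 < t -> t <= n%:R / q -> 0 < n%:R :> R -> 0 <= pow_kernel n t.
  move=> tt tn n0; rewrite powE divr_ge0 ?(ltW tt)// exprn_ge0// subr_ge0 ler_pdivrMr// mul1r.
  by have /andP[] := vn n t tt tn n0.
have cvg1 : (fun n => (- harmonic_gap n - ln (q * t0))%:E) @ \oo --> (- euler_mascheroni R - ln (q * t0))%:E.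
  apply: cvg_EFin; first exact: nearW.
  by apply: cvgB; [apply: cvgN; exact: harmonic_gap_cvg|exact: cvg_cst].
apply/andP; split.
  apply: (cvge_to_le cvg1); near=> n.
  have bn : q * t0 < n%:R by near: n; exact: nbhs_infty_gtr.
  have n0 : 0 < n%:R :> R by exact: lt_trans bn.
  have [A [AE /andP[A1 _]]] := integral_pow_kernel t00 bn.
  apply: (@le_trans _ _ A%:E); first by rewrite lee_fin; lra.
  rewrite -AE.
  have sub : `[t0, (n%:R / q)%R]%classic `<=` `[t0, +oo[%classic.
    by move=> t /=; rewrite !in_itv/= => /andP[->].
  apply: (@le_trans _ _ (\int[mu]_(t in `[t0, (n%:R / q)%R]) (exp_kernel t)%:E)%E).
    apply: ge0_le_integral; first exact: measurable_itv.
    - move=> t; rewrite /= in_itv/= => /andP[tt tn]; rewrite lee_fin pow_ge0//.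
      exact: lt_le_trans tt.
    - exact: measurable_funTS (mP n).
    - exact: measurable_funTS mE.
    - move=> t; rewrite /= in_itv/= => /andP[tt tn].
      have t_gt0 : 0 < t by exact: lt_le_trans tt.
      rewrite lee_fin powE /exp_kernel ler_pM2r ?invr_gt0//.
      apply: expR_sub_pow_ge0; first exact: vn.
      by rewrite -(ltr_nat R).
  apply: ge0_subset_integral => //.
  - exact: measurable_funTS mE.
  - by move=> t; rewrite /= in_itv/= andbT => tt; rewrite lee_fin exp_kernel_ge0// (le_trans (ltW t00)).
apply: integral_exhaust_le; first exact: measurable_exp_kernel.
  by move=> t tt; rewrite exp_kernel_ge0// (le_trans (ltW t00)).
move=> N; set T := t0 + N.+1%:R.
have t0T : t0 <= T by rewrite lerDl.
have T0 : 0 < T by exact: lt_le_trans t00 t0T.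
(* Bound for [n%:R] times the integral over [[t0, T]] of the error [(q * t) ^+ 2 / n%:R / t], using
   [t <= T] above and [t0 <= t] below. *)
pose c : R := (q * T) ^+ 2 / t0 * (T - t0).
have cvg2 : (fun n => (- harmonic_gap n - ln (q * t0) + q * t0 + c * n%:R^-1)%:E) @ \oo -->
    (- euler_mascheroni R - ln (q * t0) + q * t0)%:E.
  apply: cvg_EFin; first exact: nearW.
  rewrite -[X in _ --> X]addr0; apply: cvgD.
    apply: cvgD; last exact: cvg_cst.
    by apply: cvgB; [apply: cvgN; exact: harmonic_gap_cvg|exact: cvg_cst].
  rewrite -[X in _ --> X](mulr0 c); apply: cvgM; first exact: cvg_cst.
  apply/gtr0_cvgV0; first by near=> n; rewrite ltr0n; near: n; exact: nbhs_infty_gt.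
  exact: cvgr_idn.
apply: (cvge_ge _ cvg2); near=> n.
have bn : q * T < n%:R by near: n; exact: nbhs_infty_gtr.
have n0 : 0 < n%:R :> R by apply: lt_trans bn; rewrite mulr_gt0.
have bn0 : q * t0 < n%:R by apply: le_lt_trans bn; rewrite ler_wpM2l// ltW.
have Tn : T <= n%:R / q by rewrite ler_pdivlMr// mulrC ltW.
have [A [AE /andP[_ A1]]] := integral_pow_kernel t00 bn0.
pose e : R := (q * T) ^+ 2 / t0 / n%:R.
have e0 : 0 <= e by rewrite !divr_ge0 ?sqr_ge0// ltW.
apply: (@le_trans _ _ (\int[mu]_(t in `[t0, T]) ((pow_kernel n t)%:E + e%:E))%E).
  apply: ge0_le_integral; first exact: measurable_itv.
  - move=> t; rewrite /= in_itv/= => /andP[tt _].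
    by rewrite lee_fin exp_kernel_ge0// (le_trans (ltW t00)).
  - exact: measurable_funTS mE.
  - by apply: measurable_funTS; exact: emeasurable_funD (mP n) (measurable_cst _).
  - move=> t; rewrite /= in_itv/= => /andP[tt tT].
    have t_gt0 : 0 < t by exact: lt_le_trans tt.
    rewrite -EFinD lee_fin powE /exp_kernel.
    have nN : (0 < n)%N by rewrite -(ltr_nat R).
    have H := expR_sub_pow_le (vn n t t_gt0 (le_trans tT Tn) n0) nN.
    apply: (@le_trans _ _ (((1 - q * t / n%:R) ^+ n + (q * t) ^+ 2 / n%:R) / t)).
      by rewrite ler_pM2r ?invr_gt0.
    rewrite mulrDl lerD2l /e mulrAC ler_pM2r ?invr_gt0//.
    apply: ler_pM; rewrite ?sqr_ge0 ?invr_ge0 ?(ltW t_gt0)//.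
      by rewrite lerXn2r ?nnegrE ?mulr_ge0 ?(ltW q0) ?(ltW t_gt0) ?(ltW T0)// ler_wpM2l// ltW.
    by rewrite lef_pV2 ?posrE.
rewrite ge0_integralD//; last 2 first.
- by move=> t; rewrite /= in_itv/= => /andP[tt tT]; rewrite lee_fin pow_ge0//;
    [exact: lt_le_trans tt|exact: le_trans Tn].
- exact: measurable_funTS (mP n).
rewrite integral_cst//= lebesgue_measure_itv/= lte_fin.
have tT0 : t0 < T by rewrite ltrDl.
rewrite tT0 -EFinB -EFinM.
apply: (@le_trans _ _ (A%:E + (e * (T - t0))%:E)%E); last first.
  rewrite -EFinD lee_fin; have -> : e * (T - t0) = c * n%:R^-1 by rewrite /e /c; ring.
  by rewrite lerD2r; lra.
apply: leeD2r; rewrite -AE; apply: ge0_subset_integral => //.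
- exact: measurable_funTS (mP n).
- move=> t; rewrite /= in_itv/= => /andP[tt tn]; rewrite lee_fin pow_ge0//.
  exact: lt_le_trans tt.
- by move=> t /=; rewrite !in_itv/= => /andP[-> /le_trans]; apply.
Unshelve. all: by end_near. Qed.

(** Up to a constant this is the time integrand of the Green kernel, with the point encoded in [s]
    so that the two exponentials are exchanged by [t -> s ^+ 2 / t]. Its integral over the half-line
    is twice the Bessel function K_0 at [2 * q * s]. *)
Definition inv_kernel (s t : R) : R := expR (- (q * t)) * expR (- (q * s ^+ 2 / t)) / t.

Lemma measurable_inv_kernel s : measurable_fun setT (inv_kernel s).
Proof.
apply: measurable_funM; last exact: measurable_inv.
apply: measurable_funM; first exact: measurable_kill.
apply: measurableT_comp => //; apply: measurableT_comp => //.
by apply: measurable_funM => //; exact: measurable_inv.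
Qed.

Lemma inv_kernel_ge0 s t : 0 <= t -> 0 <= inv_kernel s t.
Proof. by move=> t0; rewrite divr_ge0// mulr_ge0 ?expR_ge0. Qed.

Lemma continuous_inv_kernel s t : 0 < t -> {for t, continuous (inv_kernel s)}.
Proof.
move=> t0; have cV : (fun t : R => t^-1) x @[x --> t] --> t^-1.
  by apply: cvgV; [rewrite gt_eqF|exact: cvg_id].
have cq : - (q * x) @[x --> t] --> - (q * t).
  by apply: cvgN; apply: cvgM; [exact: cvg_cst|exact: cvg_id].
have cs : - (q * s ^+ 2 / x) @[x --> t] --> - (q * s ^+ 2 / t).
  by apply: cvgN; apply: cvgM; [exact: cvg_cst|exact: cV].
apply: cvgM; last exact: cV.
by apply: cvgM; (apply: cvg_comp; last exact: continuous_expR); [exact: cq|exact: cs].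
Qed.

(** The involution [t -> s ^+ 2 / t] exchanges the exponentials and preserves the measure [dt / t].
    It is applied on compact intervals away from 0, where the substitution rule is available. *)
Lemma inv_kernel_symmetry (s M : R) : 0 < s -> 1 < M ->
  (\int[mu]_(t in `[(s / M)%R, s]) (inv_kernel s t)%:E =
   \int[mu]_(t in `[s, (s * M)%R]) (inv_kernel s t)%:E)%E.
Proof.
move=> s0 M1; have M0 : 0 < M by exact: lt_trans M1.
have sM : s < s * M by rewrite ltr_pMr.
pose F (t : R) : R := s ^+ 2 / t.
have dF (t : R) : 0 < t -> is_derive t 1 F (- (s ^+ 2 / t ^+ 2)).
  move=> t0; have dV := @is_deriveV R id t 1 1 (lt0r_neq0 t0) (is_derive_id t 1).
  have dZ := is_deriveZ (s ^+ 2) dV.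
  by apply: (is_derive_eq dZ); rewrite /GRing.scale/= mulr1 mulrN.
have F'E (t : R) : 0 < t -> F^`()%classic t = - (s ^+ 2 / t ^+ 2).
  by move=> t0; rewrite derive1E; have [_ ->] := dF t t0.
have cF' (t : R) : 0 < t -> F^`()%classic x @[x --> t] --> F^`()%classic t.
  move=> t0; have near_eq : \forall x \near t, - (s ^+ 2 / x ^+ 2) = F^`()%classic x.
    by near=> x; rewrite F'E//; near: x; exact: lt_nbhsr.
  apply: cvg_trans (near_eq_cvg near_eq) _; rewrite F'E//.
  apply: cvgN; apply: cvgM; first exact: cvg_cst.
  by apply: cvgV; [rewrite expf_neq0// gt_eqF|exact: exprn_continuous].
have cF (t : R) : 0 < t -> {for t, continuous F}.
  move=> t0; apply: differentiable_continuous; apply/derivable1_diffP.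
  by have [] := dF t t0.
have Fs : F s = s by rewrite /F expr2 mulfK// gt_eqF.
have FsM : F (s * M) = s / M by rewrite /F; field; rewrite !gt_eqF.
rewrite -{2}Fs -FsM integration_by_substitution_decreasing//.
- apply: eq_integral => t; rewrite inE/= in_itv/= => /andP[st _].
  have t0 : 0 < t by exact: lt_le_trans st.
  have tn : t != 0 by rewrite gt_eqF.
  have sn : s != 0 by rewrite gt_eqF.
  congr EFin.
  have -> : ((inv_kernel s \o F) * - F^`()%classic) t = inv_kernel s (F t) * - F^`()%classic t by [].
  rewrite F'E// opprK /inv_kernel /F.
  have -> : q * s ^+ 2 / (s ^+ 2 / t) = q * t by field; rewrite ?sn ?tn.
  have -> : q * (s ^+ 2 / t) = q * s ^+ 2 / t by rewrite mulrA.
  by rewrite [X in X / _ * _]mulrC; field; rewrite ?sn ?tn.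
- exact: ltW.
- move=> x y; rewrite !in_itv/= => /andP[sx _] /andP[sy _] xy.
  rewrite /F ltr_pM2l ?exprn_gt0// ltf_pV2 ?posrE//; exact: lt_le_trans s0 _.
- move=> t; rewrite in_itv/= => /andP[st _]; apply: cF'; exact: lt_trans st.
- apply: (cvgP (F^`()%classic s)); apply: cvg_at_right_filter; exact: cF'.
- apply: (cvgP (F^`()%classic (s * M))); apply: cvg_at_left_filter; apply: cF'.
  exact: lt_trans sM.
- split.
  + by move=> t; rewrite in_itv/= => /andP[st _]; have [] := dF t (lt_trans s0 st).
  + by apply: cvg_at_right_filter; exact: cF.
  + by apply: cvg_at_left_filter; apply: cF; exact: lt_trans sM.
- rewrite FsM Fs; apply/continuous_within_itvP; first by rewrite ltr_pdivrMr.
  have sM0 : 0 < s / M by rewrite divr_gt0.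
  split.
  + move=> t; rewrite in_itv/= => /andP[st _]; apply: continuous_inv_kernel.
    exact: lt_trans st.
  + by apply: cvg_at_right_filter; exact: continuous_inv_kernel.
  + by apply: cvg_at_left_filter; exact: continuous_inv_kernel.
Unshelve. all: by end_near. Qed.

Let mik s : measurable_fun setT (fun t : R => (inv_kernel s t)%:E).
Proof. by apply/measurable_EFinP; exact: measurable_inv_kernel. Qed.

(** The intervals [[s / M, s]] and [[s, s * M]] carry equal integrals and exhaust the two sides of
    [s]. *)
Lemma integral_inv_kernel (s : R) : 0 < s ->
  (\int[mu]_(t in `]0%R, +oo[) (inv_kernel s t)%:E =
   2%:E * \int[mu]_(t in `[s, +oo[) (inv_kernel s t)%:E)%E.
Proof.
move=> s0; pose Mn (n : nat) : R := n.+2%:R.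
have Mn1 n : 1 < Mn n by rewrite /Mn ltr1n.
have Mn0 n : 0 < Mn n by exact: lt_trans (Mn1 n).
have Mle n m : (n <= m)%N -> Mn n <= Mn m by move=> nm; rewrite ler_nat.
pose A (n : nat) : set R := `[(s / Mn n)%R, s]%classic.
pose B (n : nat) : set R := `[s, (s * Mn n)%R]%classic.
have AE : \bigcup_n A n = `]0%R, s]%classic.
  apply/seteqP; split => t.
    move=> [n _]; rewrite /A/= !in_itv/= => /andP[st ->]; rewrite andbT.
    by apply: lt_le_trans st; rewrite divr_gt0.
  rewrite /= in_itv/= => /andP[t0 ts]; exists (Num.bound (s / t)) => //.
  rewrite /A/= in_itv/= ts andbT ler_pdivrMr// -ler_pdivrMl// mulrC.
  rewrite (le_trans (ltW (archi_boundP _))) ?divr_ge0 ?(ltW s0) ?(ltW t0)//.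
  by rewrite /Mn ler_nat ltnW// ltnW.
have BE : \bigcup_n B n = `[s, +oo[%classic.
  apply/seteqP; split => t.
    by move=> [n _]; rewrite /B/= !in_itv/= => /andP[->].
  rewrite /= in_itv/= andbT => st; exists (Num.bound (t / s)) => //.
  rewrite /B/= in_itv/= st/= -ler_pdivrMl// mulrC.
  rewrite (le_trans (ltW (archi_boundP _))) ?divr_ge0 ?(ltW s0) ?(le_trans (ltW s0) st)//.
  by rewrite /Mn ler_nat ltnW// ltnW.
have nndA : {homo A : n m / (n <= m)%N >-> (n <= m)%O}.
  move=> n m nm; apply/subsetPset => t; rewrite /A/= !in_itv/= => /andP[st ->].
  by rewrite andbT (le_trans _ st)// ler_pM2l// lef_pV2 ?posrE// Mle.
have nndB : {homo B : n m / (n <= m)%N >-> (n <= m)%O}.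
  move=> n m nm; apply/subsetPset => t; rewrite /B/= !in_itv/= => /andP[-> /le_trans]; apply.
  by rewrite ler_pM2l// Mle.
have mA n : measurable (A n) by exact: measurable_itv.
have mB n : measurable (B n) by exact: measurable_itv.
have A0 n t : A n t -> (0 <= (inv_kernel s t)%:E)%E.
  rewrite /A/= in_itv/= => /andP[st _]; rewrite lee_fin inv_kernel_ge0//.
  by rewrite (le_trans _ st)// divr_ge0 ?(ltW s0) ?(ltW (Mn0 n)).
have B0 n t : B n t -> (0 <= (inv_kernel s t)%:E)%E.
  rewrite /B/= in_itv/= => /andP[st _]; rewrite lee_fin inv_kernel_ge0//.
  by rewrite (le_trans (ltW s0) st).
have cA := ge0_nondecreasing_set_cvg_integral (mu := mu) nndA mA
  (fun n => measurable_funTS (mik s)) A0.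
have cB := ge0_nondecreasing_set_cvg_integral (mu := mu) nndB mB
  (fun n => measurable_funTS (mik s)) B0.
rewrite AE in cA; rewrite BE in cB.
have AB : (\int[mu]_(t in `]0%R, s]) (inv_kernel s t)%:E =
    \int[mu]_(t in `[s, +oo[) (inv_kernel s t)%:E)%E.
  have sym : (fun n => \int[mu]_(t in A n) (inv_kernel s t)%:E)%E =
      (fun n => \int[mu]_(t in B n) (inv_kernel s t)%:E)%E.
    by apply/funext => n; exact: inv_kernel_symmetry.
  rewrite sym in cA; exact: (cvg_unique _ cA cB).
have -> : `]0%R, +oo[%classic = `]0%R, s] `|` `]s, +oo[ :> set R.
  apply/seteqP; split => t /=; rewrite !in_itv/= ?andbT.
    by move=> t0; case: (leP t s) => ts; [left; rewrite t0|right].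
  by move=> [/andP[]//|st]; exact: lt_trans st.
rewrite ge0_integral_setU//.
- rewrite AB integral_itv_obnd_cbnd; last exact: measurable_funTS (mik s).
  by rewrite -[X in (X + _)%E]mul1e -[X in (_ + X)%E]mul1e -ge0_muleDl.
- by apply: measurable_funTS; exact: mik.
- move=> t [] /=; rewrite in_itv/= ?andbT.
    by move=> /andP[t0 _]; rewrite lee_fin inv_kernel_ge0// ltW.
  by move=> st; rewrite lee_fin inv_kernel_ge0// ltW// (lt_trans s0).
- rewrite disj_set2E; apply/eqP/seteqP; split => t //= [] /=; rewrite !in_itv/= andbT.
  by move=> /andP[_ ts] /(le_lt_trans ts); rewrite ltxx.
Qed.

(** Beyond [s] the second exponential differs from 1 by at most [q * s ^+ 2 / t], which costs at
    most the integral of [q * s ^+ 2 / t ^+ 2], that is [q * s], against the exponential integral.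
    Near 0 that factor is not close to 1, hence the folding onto times beyond [s]. *)
Lemma inv_kernel_bounds (s : R) : 0 < s ->
  exists H : R, (\int[mu]_(t in `[s, +oo[) (inv_kernel s t)%:E = H%:E)%E /\
    `|H + euler_mascheroni R + ln (q * s)| <= q * s.
Proof.
move=> s0; set b := q * s; have b0 : 0 < b by rewrite mulr_gt0.
have /andP[E1 E2] := exp_integral_bounds s0.
set E := (\int[mu]_(t in `[s, +oo[) (exp_kernel t)%:E)%E in E1 E2.
set I := (\int[mu]_(t in `[s, +oo[) (inv_kernel s t)%:E)%E.
have mE : measurable_fun setT (fun t : R => (exp_kernel t)%:E).
  by apply/measurable_EFinP; exact: measurable_exp_kernel.
have tpos (t : R) : t \in `[s, +oo[ -> 0 < t.
  by rewrite in_itv/= andbT; exact: lt_le_trans.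
have I0 : (0 <= I)%E.
  by apply: integral_ge0 => t /tpos t0; rewrite lee_fin inv_kernel_ge0// ltW.
have IE : (I <= E)%E.
  apply: ge0_le_integral; first exact: measurable_itv.
  - by move=> t /tpos t0; rewrite lee_fin inv_kernel_ge0// ltW.
  - exact: measurable_funTS (mik s).
  - exact: measurable_funTS mE.
  - move=> t /tpos t0; rewrite lee_fin ler_pM2r ?invr_gt0// ler_piMr ?expR_ge0//.
    by rewrite -expR0 ler_expR oppr_le0 divr_ge0 ?(ltW t0)// mulr_ge0 ?sqr_ge0// ltW.
have mc : measurable_fun setT (fun t : R => (q * s ^+ 2 / t ^+ 2)%:E).
  apply/measurable_EFinP; apply: measurable_funM => //.
  by apply: (measurableT_comp measurable_inv); exact: exprn_measurable.
have EI : (E <= I + b%:E)%E.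
  have bE : (\int[mu]_(t in `[s, +oo[) (q * s ^+ 2 / t ^+ 2)%:E = b%:E)%E.
    pose F (t : R) : R := - (q * s ^+ 2) / t.
    have dF (t : R) : 0 < t -> is_derive t 1 F (q * s ^+ 2 / t ^+ 2).
      move=> t0; have dV := @is_deriveV R id t 1 1 (lt0r_neq0 t0) (is_derive_id t 1).
      have dZ := is_deriveZ (- (q * s ^+ 2)) dV.
      by apply: (is_derive_eq dZ); rewrite /GRing.scale/= mulr1 mulrNN.
    have cc (t : R) : 0 < t -> {for t, continuous (fun t : R => q * s ^+ 2 / t ^+ 2)}.
      move=> t0; apply: cvgM; first exact: cvg_cst.
      by apply: cvgV; [rewrite expf_neq0// gt_eqF|exact: exprn_continuous].
    rewrite (@ge0_continuous_FTC2y _ _ F s 0).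
    - by rewrite sub0e -EFinN /F /b; congr EFin; field; rewrite gt_eqF.
    - by move=> t st; rewrite divr_ge0 ?sqr_ge0// mulr_ge0 ?sqr_ge0// ltW.
    - apply/continuous_within_itvcyP; split.
        by move=> t; rewrite in_itv/= andbT => st; apply: cc; exact: lt_trans st.
      by apply: cvg_at_right_filter; exact: cc.
    - rewrite -[X in _ --> X](mulr0 (- (q * s ^+ 2))); apply: cvgM; first exact: cvg_cst.
      apply/gtr0_cvgV0; last exact: cvg_id.
      by near=> t; near: t; exact: nbhs_pinfty_gt.
    - by move=> t st; have [] := dF t (lt_trans s0 st).
    - apply: cvg_at_right_filter; apply: differentiable_continuous.
      by apply/derivable1_diffP; have [] := dF s s0.
    - move=> t; rewrite in_itv/= andbT => st; rewrite derive1E.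
      by have [_ ->] := dF t (lt_trans s0 st).
  rewrite -bE -ge0_integralD//; last 4 first.
  - by move=> t /tpos t0; rewrite lee_fin inv_kernel_ge0// ltW.
  - exact: measurable_funTS (mik s).
  - by move=> t _; rewrite lee_fin divr_ge0 ?sqr_ge0// mulr_ge0 ?sqr_ge0// ltW.
  - exact: measurable_funTS mc.
  apply: ge0_le_integral; first exact: measurable_itv.
  - by move=> t /tpos t0; rewrite lee_fin exp_kernel_ge0// ltW.
  - exact: measurable_funTS mE.
  - exact: (measurable_funTS (emeasurable_funD (mik s) mc)).
  - move=> t /tpos t0; rewrite -EFinD lee_fin /exp_kernel /inv_kernel.
    have -> : q * s ^+ 2 / t ^+ 2 = (q * s ^+ 2 / t) / t.
      by field; rewrite gt_eqF.
    rewrite -mulrDl ler_pM2r ?invr_gt0//; set y := q * s ^+ 2 / t.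
    have y0 : 0 <= y by rewrite divr_ge0 ?(ltW t0)// mulr_ge0 ?sqr_ge0// ltW.
    have e1 : expR (- (q * t)) <= 1 by rewrite -expR0 ler_expR oppr_le0 mulr_ge0 ?ltW.
    have := @expR_ge1Dx R (- y); have := expR_ge0 (- (q * t)).
    by move: e1; move: (expR (- (q * t))) (expR (- y)) => e f; nra.
have Efin : E \is a fin_num.
  by rewrite fin_numElt (lt_le_trans (ltNyr _) E1) (le_lt_trans E2 (ltry _)).
have Ifin : I \is a fin_num.
  by rewrite ge0_fin_numE// (le_lt_trans IE)// -ge0_fin_numE// (le_trans I0).
exists (fine I); rewrite fineK//; split => //.
rewrite -(fineK Efin) -(fineK Ifin) ?lee_fin in E1 E2 IE EI.
rewrite -/b in E1 E2; rewrite ler_norml; move: E1 E2 IE EI.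
by move: (fine I) (fine E) (ln b) (euler_mascheroni R) => x y v w; lra.
Unshelve. all: by end_near. Qed.
End ExponentialIntegral.

(** * Invariance of plane Lebesgue measure under dilations, translations and rotations *)

Section PlaneInvariance.
Context {R : realType}.
Local Notation mu := (@lebesgue_measure R).

Let mpair (f1 f2 : R * R -> R) : measurable_fun setT f1 -> measurable_fun setT f2 ->
  measurable_fun setT (fun y : R * R => (f1 y, f2 y)).
Proof. by move=> m1 m2; exact: measurable_fun_pair. Qed.

Let mlin (a b c : R) : measurable_fun setT (fun y : R * R => a * y.1 + b * y.2 + c).
Proof.
have m1 : measurable_fun [set: R * R] (fun y : R * R => y.1) by exact: measurable_fst.
have m2 : measurable_fun [set: R * R] (fun y : R * R => y.2) by exact: measurable_snd.
by apply: measurable_funD => //; apply: measurable_funD; exact: measurable_funM (measurable_cst _) _.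
Qed.

Lemma measurable_linear2 (a b c a' b' c' : R) :
  measurable_fun setT (fun y : R * R => (a * y.1 + b * y.2 + c, a' * y.1 + b' * y.2 + c')).
Proof. exact: mpair. Qed.

Lemma ge0_leb2_affine (a : R) (b : R * R) (f : R * R -> \bar R) : 0 < a ->
  measurable_fun setT f -> (forall x, (0 <= f x)%E) ->
  (\int[leb2]_y f y = (a ^+ 2)%:E * \int[leb2]_y f (a * y.1 + b.1, a * y.2 + b.2)%R)%E.
Proof.
move=> a0 mf f0.
have mg : measurable_fun setT (fun y : R * R => f (a * y.1 + b.1, a * y.2 + b.2)%R).
  have := measurableT_comp mf (measurable_linear2 a 0 b.1 0 a b.2).
  apply: eq_measurable_fun => y _ /=; congr f; congr pair; ring.
have mgy y : measurable_fun setT (fun x : R => f (a * x + b.1, y)).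
  have m1 := measurableT_comp mf (pair2_measurable y : measurable_fun setT (fun x : R => (x, y))).
  have m2 : measurable_fun setT (fun x : R => a * x + b.1).
    by apply: measurable_funD => //; exact: measurable_funM.
  exact: (measurableT_comp m1 m2).
have a0e : (0 <= a%:E)%E by rewrite lee_fin ltW.
rewrite (ge0_leb2E mf f0) (ge0_leb2E mg (fun _ => f0 _)).
have mF : measurable_fun setT (fun x : R => (\int[mu]_y f (x, y))%E).
  by have := @measurable_ge0_integral _ _ _ _ _ mu setT _ measurableT mf; exact.
rewrite (ge0_integral_affine b.1 a0 mF); last first.
  by move=> x; apply: integral_ge0 => y _; exact: f0.
rewrite expr2 EFinM -muleA; congr (_ * _)%E.
have mG : measurable_fun setT (fun x : R => (\int[mu]_y f (a * x + b.1, a * y + b.2)%R)%E).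
  by have := @measurable_ge0_integral _ _ _ _ _ mu setT _ measurableT mg; apply=> q; exact: f0.
rewrite -(ge0_integralZl mu measurableT mG _ a0e); last first.
  by move=> x _; apply: integral_ge0 => y _; exact: f0.
apply: eq_integral => x _; rewrite (ge0_integral_affine b.2 a0)//.
exact: (measurableT_comp mf (pair1_measurable _)).
Qed.

Lemma ge0_leb2_shear2 (t : R) (f : R * R -> \bar R) :
  measurable_fun setT f -> (forall x, (0 <= f x)%E) ->
  (\int[leb2]_y f (y.1, y.2 + t * y.1)%R = \int[leb2]_y f y)%E.
Proof.
move=> mf f0.
have mg : measurable_fun setT (fun y : R * R => f (y.1, y.2 + t * y.1)%R).
  have := measurableT_comp mf (measurable_linear2 1 0 0 t 1 0).
  apply: eq_measurable_fun => y _ /=; congr f; congr pair; ring.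
rewrite (ge0_leb2E mf f0) (ge0_leb2E mg (fun _ => f0 _)).
apply: eq_integral => x _.
apply: (ge0_integral_shift (t * x) (f := fun y => f (x, y))); last by move=> y; exact: f0.
exact: (measurableT_comp mf (pair1_measurable _)).
Qed.

Lemma ge0_leb2_shear1 (t : R) (f : R * R -> \bar R) :
  measurable_fun setT f -> (forall x, (0 <= f x)%E) ->
  (\int[leb2]_y f (y.1 + t * y.2, y.2)%R = \int[leb2]_y f y)%E.
Proof.
move=> mf f0.
have mg : measurable_fun setT (fun y : R * R => f (y.1 + t * y.2, y.2)%R).
  have := measurableT_comp mf (measurable_linear2 1 t 0 0 1 0).
  apply: eq_measurable_fun => y _ /=; congr f; congr pair; ring.
rewrite (ge0_leb2E mf f0) (ge0_leb2E mg (fun _ => f0 _)).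
have swap (g : R * R -> \bar R) : measurable_fun setT g -> (forall x, (0 <= g x)%E) ->
    (\int[mu]_x \int[mu]_y g (x, y) = \int[mu]_y \int[mu]_x g (x, y))%E.
  by move=> mg' g0; apply: fubini_tonelli.
rewrite (swap _ mf f0) (swap _ mg (fun _ => f0 _)).
apply: eq_integral => y _.
apply: (ge0_integral_shift (t * y) (f := fun x => f (x, y))); last by move=> x; exact: f0.
exact: (measurableT_comp mf (pair2_measurable _)).
Qed.

Definition rot (c s : R) (y : R * R) : R * R := (c * y.1 - s * y.2, s * y.1 + c * y.2).

Lemma measurable_rot c s : measurable_fun setT (rot c s).
Proof.
have := measurable_linear2 c (- s) 0 s c 0.
by apply: eq_measurable_fun => y _; rewrite /rot; congr pair; ring.
Qed.

Lemma modulus_rot c s y : c ^+ 2 + s ^+ 2 = 1 -> modulus (rot c s y) = modulus y.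
Proof.
move=> cs; rewrite /modulus /rot/=; congr Num.sqrt.
rewrite -[RHS]mul1r -cs; ring.
Qed.

(** A rotation is a product of three shears of slopes [t], [s], [t], where [t] is minus the tangent
    of the half-angle, and each shear is a translation in one variable. The half-turn is excluded
    because that tangent is infinite. *)
Lemma ge0_leb2_rot_shear (c s : R) (f : R * R -> \bar R) : c ^+ 2 + s ^+ 2 = 1 -> c != -1 ->
  measurable_fun setT f -> (forall x, (0 <= f x)%E) ->
  (\int[leb2]_y f (rot c s y) = \int[leb2]_y f y)%E.
Proof.
move=> cs c1 mf f0; pose t := - (s / (1 + c)).
have c10 : 1 + c != 0 by rewrite addrC addr_eq0.
pose f1 (y : R * R) := f (y.1 + t * y.2, y.2)%R.
pose f2 (y : R * R) := f1 (y.1, y.2 + s * y.1)%R.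
have mf1 : measurable_fun setT f1.
  have := measurableT_comp mf (measurable_linear2 1 t 0 0 1 0).
  apply: eq_measurable_fun => y _ /=; congr f; congr pair; ring.
have mf2 : measurable_fun setT f2.
  have := measurableT_comp mf1 (measurable_linear2 1 0 0 s 1 0).
  apply: eq_measurable_fun => y _ /=; congr f1; congr pair; ring.
rewrite -(ge0_leb2_shear1 t mf f0) -(ge0_leb2_shear2 s mf1 (fun _ => f0 _)).
rewrite -(ge0_leb2_shear1 t mf2 (fun _ => f0 _)); apply: eq_integral => y _.
rewrite /f2 /f1/= /rot; congr f.
have ts : t * s = c - 1.
  apply: (mulIf c10); rewrite /t mulrAC mulNr divfK//.
  have -> : - s * s = c ^+ 2 - (c ^+ 2 + s ^+ 2) by ring.
  by rewrite cs; ring.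
have t2 : t * (1 + c) = - s by rewrite /t mulNr divfK.
congr pair; first last.
  have -> : s * y.1 + c * y.2 = y.2 + s * y.1 + (c - 1) * y.2 by ring.
  by rewrite -ts; ring.
have -> : y.1 + t * y.2 + t * (y.2 + s * (y.1 + t * y.2)) =
  (1 + t * s) * y.1 + t * (1 + (1 + t * s)) * y.2 by ring.
by rewrite ts addrCA subrr addr0 t2 mulNr.
Qed.

(** The half-turn is the square of a quarter-turn, to which the shears apply. *)
Lemma ge0_leb2_rot (c s : R) (f : R * R -> \bar R) : c ^+ 2 + s ^+ 2 = 1 ->
  measurable_fun setT f -> (forall x, (0 <= f x)%E) ->
  (\int[leb2]_y f (rot c s y) = \int[leb2]_y f y)%E.
Proof.
move=> cs mf f0; have [c1|c1] := eqVneq c (-1); last exact: ge0_leb2_rot_shear.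
have s0 : s = 0.
  apply/eqP; rewrite -sqrf_eq0; apply/eqP.
  by move: cs; rewrite c1 sqrrN expr1n => /(canRL (addKr _)); rewrite addNr.
have n10 : (0 : R) != -1 by rewrite eq_sym oppr_eq0 oner_eq0.
have q1 : 0 ^+ 2 + 1 ^+ 2 = 1 :> R by rewrite expr0n/= expr1n add0r.
have mfr := measurableT_comp mf (measurable_rot 0 1).
rewrite -(ge0_leb2_rot_shear q1 n10 mf f0).
rewrite -(ge0_leb2_rot_shear q1 n10 mfr (fun _ => f0 _)).
apply: eq_integral => y _ /=; congr f; rewrite /rot c1 s0/=; congr pair; ring.
Qed.

(** No integrability is asked for: if the positive or the negative part has infinite integral, both
    sides are 0 since [fine] sends infinities to 0. *)
Lemma Rintegral_transfer (phi : R * R -> R * R) (k : R) : 0 < k ->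
  measurable_fun setT phi ->
  (forall f : R * R -> \bar R, measurable_fun setT f -> (forall x, (0 <= f x)%E) ->
    (\int[leb2]_y f y = k%:E * \int[leb2]_y f (phi y))%E) ->
  forall f : R * R -> R, measurable_fun setT f ->
    \int[leb2]_y f y = k * \int[leb2]_y f (phi y).
Proof.
move=> k0 mphi H f mf; rewrite /Rintegral.
have mfE : measurable_fun setT (EFin \o f) by apply/measurable_EFinP.
rewrite integralE [in RHS]integralE.
rewrite (H _ (measurable_funepos mfE) (funepos_ge0 _)) (H _ (measurable_funeneg mfE) (funeneg_ge0 _)).
set A := (\int[leb2]_y _)%E; set B := (\int[leb2]_y _)%E.
have AE : (\int[leb2]_x (fun x0 => (f (phi x0))%:E)^\+ x = A)%E.
  by apply: eq_integral => y _; rewrite !funeposE.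
have BE : (\int[leb2]_x (fun x0 => (f (phi x0))%:E)^\- x = B)%E.
  by apply: eq_integral => y _; rewrite !funenegE.
rewrite AE BE.
have A0 : (0 <= A)%E by apply: integral_ge0 => y _; exact: funepos_ge0.
have B0 : (0 <= B)%E by apply: integral_ge0 => y _; exact: funeneg_ge0.
move: (A) (B) A0 B0 => [a| |] [b| |]//= _ _; rewrite ?gt0_muley ?lte_fin//= ?mulr0//.
by rewrite mulrBr.
Qed.

Lemma Rintegral_leb2_affine (a : R) (b : R * R) (f : R * R -> R) : 0 < a ->
  measurable_fun setT f ->
  \int[leb2]_y f y = a ^+ 2 * \int[leb2]_y f (a * y.1 + b.1, a * y.2 + b.2).
Proof.
move=> a0; have m : measurable_fun setT (fun y : R * R => (a * y.1 + b.1, a * y.2 + b.2)).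
  have := measurable_linear2 a 0 b.1 0 a b.2.
  by apply: eq_measurable_fun => y _; congr pair; ring.
apply: (Rintegral_transfer (exprn_gt0 2 a0) m) => g mg g0.
exact: ge0_leb2_affine.
Qed.

Lemma Rintegral_leb2_rot (c s : R) (f : R * R -> R) : c ^+ 2 + s ^+ 2 = 1 ->
  measurable_fun setT f -> \int[leb2]_y f (rot c s y) = \int[leb2]_y f y.
Proof.
move=> cs mf; rewrite [RHS](Rintegral_transfer ltr01 (measurable_rot c s))// ?mul1r//.
by move=> g mg g0; rewrite mul1e ge0_leb2_rot.
Qed.
End PlaneInvariance.

(** * The Green function of the killed Brownian motion *)

Section GreenFunction.
Context {R : realType}.
Local Notation mu := (@lebesgue_measure R).
Local Notation Pos := (`]0%R, +oo[%classic).
Variable (q : R).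
Hypothesis q0 : 0 < q.

Let mkg : measurable_fun setT (fun p : R * (R * R) => (kill q p.1 * gauss2 p.1 p.2)%:E).
Proof.
apply/measurable_EFinP; apply: measurable_funM; last exact: measurable_gauss2.
exact: measurableT_comp (measurable_kill q) measurable_fst.
Qed.

Lemma greenE (y : R * R) : (green q y = \int[mu]_(t in Pos) (kill q t * gauss2 t y)%:E)%E.
Proof.
have m : measurable_fun setT (fun t : R => (kill q t * gauss2 t y)%:E).
  exact: (measurableT_comp mkg (pair2_measurable y)).
have E (t : R) : ((expR (- (q * t)) * (2 * pi * t)^-1 *
    expR (- (modulus y ^+ 2 / (2 * t))))%:E = (kill q t * gauss2 t y)%:E).
  by rewrite /kill /gauss2 mulrA.
transitivity (\int[mu]_(t in `[0%R, +oo[) (kill q t * gauss2 t y)%:E)%E.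
  by apply: eq_integral => t _; exact: E.
by rewrite integral_itv_obnd_cbnd//; exact: measurable_funTS.
Qed.

Lemma green_ge0 y : (0 <= green q y)%E.
Proof.
rewrite greenE; apply: integral_ge0 => t; rewrite /= in_itv/= andbT => t0.
by rewrite lee_fin mulr_ge0 ?kill_ge0// gauss2_ge0// ltW.
Qed.

Lemma measurable_green : measurable_fun setT (@green R q).
Proof.
pose f (p : (R * R) * R) : \bar R := (kill q p.2 * gauss2 (Num.max p.2 0) p.1)%:E.
have mf : measurable_fun setT f.
  apply/measurable_EFinP; apply: measurable_funM.
    exact: measurableT_comp (measurable_kill q) measurable_snd.
  have mp : measurable_fun setT (fun p : (R * R) * R => (Num.max p.2 0, p.1)).
    apply: measurable_fun_pair; last exact: measurable_fst.
    by apply: measurable_maxr => //; exact: measurable_snd.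
  exact: (measurableT_comp measurable_gauss2 mp).
have f0 p : (0 <= f p)%E.
  by rewrite lee_fin mulr_ge0 ?kill_ge0// gauss2_ge0// le_max lexx orbT.
have H := measurable_ge0_integral mu (E := Pos) (measurable_itv _) mf f0.
apply: (eq_measurable_fun _ _ H) => y _; rewrite greenE; apply: eq_integral => t.
by rewrite inE/= in_itv/= andbT => t0; rewrite /f/= max_l// ltW.
Qed.

(** [green q 0] is infinite, so [gr] takes the default value 0 at the origin. This is why estimates
    below assume a nonzero point and integrands are compared off one point. *)
Definition gr (y : R * R) : R := fine (green q y).

Lemma measurable_gr : measurable_fun setT gr.
Proof. by apply: measurableT_comp; [exact: fine_measurable|exact: measurable_green]. Qed.

Lemma gr_ge0 y : 0 <= gr y. Proof. exact: fine_ge0 (green_ge0 y). Qed.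

Lemma modulus_gt0 (y : R * R) : y != 0 -> 0 < modulus y.
Proof.
move=> y0; rewrite sqrtr_gt0 lt_neqAle addr_ge0 ?sqr_ge0// andbT eq_sym.
apply: contra y0; rewrite paddr_eq0 ?sqr_ge0// !sqrf_eq0 => /andP[/eqP y1 /eqP y2].
by apply/eqP; rewrite [y]surjective_pairing y1 y2.
Qed.

(** Half of [Num.sqrt (2 * q)]: the Green kernel is [pi^-1] times K_0 at [2 * kap * modulus y]. *)
Definition kap : R := Num.sqrt (q / 2).

Lemma kap_gt0 : 0 < kap. Proof. by rewrite sqrtr_gt0 divr_gt0. Qed.

(** The expansion of K_0 at small arguments with an explicit remainder, read off from
    [inv_kernel_bounds]. The choice of [s] makes [q * s ^+ 2 / t] the Gaussian exponent and [q * s]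
    equal to [modulus y * kap]. *)
Lemma green_log (y : R * R) : y != 0 ->
  green q y = (gr y)%:E /\
  `|pi * gr y + euler_mascheroni R + ln (modulus y * kap)| <= modulus y * kap.
Proof.
move=> y0; have my0 := modulus_gt0 y0; pose s := modulus y * kap / q.
have s0 : 0 < s by rewrite divr_gt0// mulr_gt0// kap_gt0.
have qs : q * s = modulus y * kap by rewrite /s mulrCA divff ?mulr1// gt_eqF.
have qss : q * s ^+ 2 = modulus y ^+ 2 / 2.
  rewrite expr2 mulrA qs /s.
  have -> : modulus y * kap * (modulus y * kap / q) = modulus y ^+ 2 * kap ^+ 2 / q by ring.
  have -> : kap ^+ 2 = q / 2 by rewrite /kap sqr_sqrtr// divr_ge0// ltW.
  by field; rewrite gt_eqF.
have [H [HE Hb]] := inv_kernel_bounds q0 s0.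
have gE : green q y = (H / pi)%:E.
  rewrite greenE.
  have E (t : R) : 0 < t -> ((kill q t * gauss2 t y)%:E = ((2 * pi)^-1)%:E * (inv_kernel q s t)%:E)%E.
    move=> t0; rewrite -EFinM; congr EFin; rewrite /kill /gauss2 /inv_kernel qss.
    have -> : modulus y ^+ 2 / (2 * t) = modulus y ^+ 2 / 2 / t by rewrite invfM mulrA.
    by rewrite [(2 * pi * t)^-1]invfM; ring.
  transitivity (\int[mu]_(t in Pos) (((2 * pi)^-1)%:E * (inv_kernel q s t)%:E))%E.
    by apply: eq_integral => t; rewrite inE/= in_itv/= andbT => t0; exact: E.
  have mi : measurable_fun setT (fun t : R => (inv_kernel q s t)%:E).
    by apply/measurable_EFinP; exact: measurable_inv_kernel.
  rewrite ge0_integralZl//; last 3 first.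
  - exact: measurable_funTS.
  - by move=> t; rewrite /= in_itv/= andbT => t0; rewrite lee_fin inv_kernel_ge0// ltW.
  - by rewrite lee_fin invr_ge0 mulr_ge0// pi_ge0.
  rewrite (integral_inv_kernel q s0) HE -!EFinM; congr EFin.
  by rewrite invfM mulrACA mulVf ?pnatr_eq0// mul1r mulrC.
have grE : gr y = H / pi by rewrite /gr gE.
split; first by rewrite gE grE.
by rewrite grE mulrCA divff ?gt_eqF ?pi_gt0// mulr1 -qs.
Qed.

Lemma green_op_greenE (h : R * R -> \bar R) (x : R * R) : measurable_fun setT h ->
  (forall x, (0 <= h x)%E) ->
  (green_op q h x = \int[leb2]_y (green q y * h (x + y)%R))%E.
Proof.
move=> mh h0.
rewrite /green_op (potentialE (kill q) mh h0).
have mhx : measurable_fun [set: R * R] (fun y : R * R => h (x + y)).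
  exact: (measurableT_comp mh (measurable_fun_addpair
    (measurable_cst x) (@measurable_id _ (R * R)%type setT))).
pose F (p : R * (R * R)) : \bar R := ((kill q p.1 * gauss2 (Num.max p.1 0) p.2)%:E * h (x + p.2)%R)%E.
have mg : measurable_fun setT (fun p : R * (R * R) => kill q p.1 * gauss2 (Num.max p.1 0) p.2).
  apply: measurable_funM; first exact: measurableT_comp (measurable_kill q) measurable_fst.
  have mp : measurable_fun setT (fun p : R * (R * R) => (Num.max p.1 0, p.2)).
    apply: measurable_fun_pair; last exact: measurable_snd.
    by apply: measurable_maxr => //; exact: measurable_fst.
  exact: (measurableT_comp measurable_gauss2 mp).
have g0 (t : R) y : 0 <= kill q t * gauss2 (Num.max t 0) y.
  by rewrite mulr_ge0 ?kill_ge0// gauss2_ge0// le_max lexx orbT.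
have mF : measurable_fun setT F.
  apply: emeasurable_funM; first by apply/measurable_EFinP.
  exact: measurableT_comp mhx measurable_snd.
have F0 p : (0 <= F p)%E by apply: mule_ge0; [rewrite lee_fin; exact: g0|exact: h0].
transitivity (\int[mu]_(r in Pos) \int[leb2]_y F (r, y))%E.
  apply: eq_integral => r _.
  have mk : measurable_fun setT (fun y : R * R => ((gauss2 (Num.max r 0) y)%:E * h (x + y)%R)%E).
    apply: emeasurable_funM => //; apply/measurable_EFinP.
    exact: (measurableT_comp measurable_gauss2 (pair1_measurable (Num.max r 0))).
  have k0 (y : R * R) : (0 <= (gauss2 (Num.max r 0) y)%:E * h (x + y)%R)%E.
    by apply: mule_ge0; [rewrite lee_fin gauss2_ge0// le_max lexx orbT|exact: h0].
  have kr0 : (0 <= (kill q (0 + r))%:E)%E by rewrite lee_fin kill_ge0.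
  rewrite /heat_kernel/= -(ge0_integralZl leb2_sfm measurableT mk (fun y _ => k0 y) kr0).
  have E (y : R * R) : ((kill q (0 + r))%:E * ((gauss2 (Num.max r 0) y)%:E * h (x + y)%R) = F (r, y))%E.
    by rewrite /F/= (add0r r) EFinM muleA.
  by apply: eq_integral => y _; exact: E.
rewrite (@ge0_fubini_domain _ _ _ _ _ mu leb2_sfm Pos setT F (measurable_itv _) measurableT mF F0).
have E (y : R * R) : (\int[mu]_(r in Pos) F (r, y) = green q y * h (x + y)%R)%E.
  rewrite greenE muleC.
  have m1 : measurable_fun setT (fun r : R => (kill q r * gauss2 (Num.max r 0) y)%:E).
    by apply/measurable_EFinP; exact: (measurableT_comp mg (pair2_measurable y)).
  have E1 (r : R) : F (r, y) = (h (x + y)%R * (kill q r * gauss2 (Num.max r 0) y)%:E)%E.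
    by rewrite /F/= muleC.
  transitivity (\int[mu]_(r in Pos) (h (x + y)%R * (kill q r * gauss2 (Num.max r 0) y)%:E))%E.
    by apply: eq_integral => r _; exact: E1.
  rewrite (ge0_integralZl mu (measurable_itv _) (measurable_funTS m1) _ (h0 _)); last first.
    by move=> r _; rewrite lee_fin; exact: g0.
  congr (_ * _)%E; apply: eq_integral => r; rewrite inE/= in_itv/= andbT => r0.
  by rewrite (max_l (ltW r0)).
by apply: eq_integral => y _; exact: E.
Qed.

Lemma integral_green : (\int[leb2]_y green q y = (q^-1)%:E)%E.
Proof.
have m1 : measurable_fun setT (cst (1%E : \bar R) : R * R -> \bar R) by exact: measurable_cst.
have one0 (x : R * R) : (0 <= cst (1%E : \bar R) x)%E by exact: lee01.
have := green_op_greenE 0 m1 one0; rewrite (green_op_cst1 q0) => ->.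
by apply: eq_integral => y _; rewrite mule1.
Qed.

Lemma integral_kill : (\int[mu]_(r in Pos) (kill q r)%:E = (q^-1)%:E)%E.
Proof.
rewrite -(green_op_cst1 q0 0); apply: eq_integral => r _.
by rewrite heat_cst1 mule1 (add0r r).
Qed.

Lemma expRN_sqr_le (v : R) : 0 <= v -> expR (- v) * v ^+ 2 <= 2.
Proof.
move=> v0; have H : v ^+ 2 <= 2 * expR v.
  have := @expR_ge1Dxn R v 1 v0.
  have -> : (2`!)%:R = 2 :> R by [].
  by move: (expR v) => e; nra.
apply: (@le_trans _ _ (expR (- v) * (2 * expR v))); first by rewrite ler_wpM2l ?expR_ge0.
by rewrite mulrCA -expRD addNr expR0 mulr1.
Qed.

(** Uniformity in [t] comes from [expRN_sqr_le] at [v = modulus x ^+ 2 / (2 * t)]: it absorbs two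
    powers of [t^-1], one from the normalisation and one from the difference of the exponents. *)
Lemma gauss2_lipschitz (t : R) (x y : R * R) : 0 < t -> x != 0 ->
  gauss2 t x <= gauss2 t y + 2 / pi * `|modulus y ^+ 2 - modulus x ^+ 2| / modulus x ^+ 4.
Proof.
move=> t0 x0; have mx := modulus_gt0 x0.
set a := modulus x ^+ 2; set b := modulus y ^+ 2.
have a0 : 0 < a by rewrite exprn_gt0.
have t20 : 0 < 2 * t by rewrite mulr_gt0.
rewrite /gauss2 -/a -/b.
have -> : modulus x ^+ 4 = a ^+ 2 by rewrite /a -exprM.
have p0 : 0 < (2 * pi * t)^-1 by rewrite invr_gt0 !mulr_gt0// pi_gt0.
have Hv := expRN_sqr_le (ltW (divr_gt0 a0 t20)).
have ab : b - a <= `|b - a| := ler_norm _.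
have eD : expR (- (a / (2 * t))) - expR (- (b / (2 * t))) <=
    expR (- (a / (2 * t))) * (`|b - a| / (2 * t)).
  have -> : expR (- (b / (2 * t))) = expR (- (a / (2 * t))) * expR (- ((b - a) / (2 * t))).
    by rewrite -expRD; congr expR; rewrite mulrBl; ring.
  have := @expR_ge1Dx R (- ((b - a) / (2 * t))).
  have : (b - a) / (2 * t) <= `|b - a| / (2 * t) by rewrite ler_pM2r ?invr_gt0.
  have := expR_gt0 (- (a / (2 * t))).
  move: (expR (- (a / (2 * t)))) (expR (- ((b - a) / (2 * t)))) ((b - a) / (2 * t)) (`|b - a| / (2 * t)).
  move=> A B u v; nra.
rewrite -lerBlDl -mulrBr.
apply: (@le_trans _ _ ((2 * pi * t)^-1 * (expR (- (a / (2 * t))) * (`|b - a| / (2 * t))))).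
  by rewrite ler_pM2l.
set e := expR _ in Hv *; set n := `|b - a|.
have n0 : 0 <= n by exact: normr_ge0.
have -> : (2 * pi * t)^-1 * (e * (n / (2 * t))) =
   (e * (a / (2 * t)) ^+ 2) * (pi^-1 * n / a ^+ 2).
  have pn : (pi : R) != 0 by rewrite gt_eqF ?pi_gt0.
  have tn : t != 0 by rewrite gt_eqF.
  have an : a != 0 by rewrite gt_eqF.
  have -> : (2 * pi * t)^-1 = pi^-1 * (2 * t)^-1 by rewrite -invfM; congr (_^-1); ring.
  have -> : (a / (2 * t)) ^+ 2 = a ^+ 2 * (2 * t)^-1 * (2 * t)^-1 by rewrite expr2; ring.
  have -> : e * (a ^+ 2 * (2 * t)^-1 * (2 * t)^-1) * (pi^-1 * n / a ^+ 2) =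
     (a ^+ 2 / a ^+ 2) * (pi^-1 * (2 * t)^-1 * (e * (n / (2 * t)))) by ring.
  by rewrite (divff (expf_neq0 2 an)) mul1r.
have -> : 2 / pi * n / a ^+ 2 = 2 * (pi^-1 * n / a ^+ 2) by ring.
apply: ler_wpM2r => //; rewrite !mulr_ge0// ?invr_ge0 ?pi_ge0//.
by rewrite exprn_ge0// ltW.
Qed.

Lemma gr_lipschitz_half (x y : R * R) : x != 0 -> y != 0 ->
  gr x <= gr y + 2 / pi * `|modulus y ^+ 2 - modulus x ^+ 2| / modulus x ^+ 4 / q.
Proof.
move=> x0 y0; have [gx _] := green_log x0; have [gy _] := green_log y0.
set c := 2 / pi * _ / _; have c0 : 0 <= c.
  by rewrite !mulr_ge0// ?invr_ge0 ?pi_ge0// exprn_ge0// modulus_ge0.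
have glip (t : R) : 0 < t -> gauss2 t x <= gauss2 t y + c.
  by move=> t0; exact: gauss2_lipschitz.
clearbody c.
suff H2 : (green q x <= green q y + c%:E * (q^-1)%:E)%E.
  by move: H2; rewrite gx gy -EFinM -EFinD lee_fin.
rewrite -[(q^-1)%:E]integral_kill (greenE x) (greenE y).
have mk : measurable_fun setT (fun t : R => (kill q t)%:E).
  by apply/measurable_EFinP; exact: measurable_kill.
have mkgx w : measurable_fun setT (fun t : R => (kill q t * gauss2 t w)%:E).
  exact: (measurableT_comp mkg (pair2_measurable w)).
have kg0 (t : R) w : 0 < t -> (0 <= (kill q t * gauss2 t w)%:E)%E.
  by move=> t0; rewrite lee_fin mulr_ge0 ?kill_ge0// gauss2_ge0// ltW.
have c0e : (0 <= c%:E)%E by rewrite lee_fin.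
have k0e (t : R) : (0 <= (kill q t)%:E)%E by rewrite lee_fin kill_ge0.
rewrite -(ge0_integralZl mu (measurable_itv _) (measurable_funTS mk) (fun t _ => k0e t) c0e).
have mck : measurable_fun setT (fun t : R => (c%:E * (kill q t)%:E)%E).
  exact: emeasurable_funM (measurable_cst _) mk.
have ck0 (t : R) : (0 <= c%:E * (kill q t)%:E)%E by rewrite mule_ge0.
rewrite -ge0_integralD; last 5 first.
- exact: measurable_itv.
- by move=> t; rewrite /= in_itv/= andbT => t0; exact: kg0.
- exact: measurable_funTS (mkgx y).
- by move=> t _; exact: ck0.
- exact: measurable_funTS mck.
have le (t : R) : 0 < t -> ((kill q t * gauss2 t x)%:E <=
    (kill q t * gauss2 t y)%:E + c%:E * (kill q t)%:E)%E.
  move=> t0; rewrite -EFinM -EFinD lee_fin (mulrC c) -mulrDr ler_wpM2l ?kill_ge0//.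
  exact: glip.
apply: ge0_le_integral; first exact: measurable_itv.
- by move=> t; rewrite /= in_itv/= andbT => t0; exact: kg0.
- exact: measurable_funTS (mkgx x).
- exact: (measurable_funTS (emeasurable_funD (mkgx y) mck)).
- by move=> t; rewrite /= in_itv/= andbT => t0; exact: le.
Qed.
End GreenFunction.
Arguments gr {R} q y.
Arguments kap {R} q.

(** * Logarithmic potentials of bounded functions supported in a disc *)

Section Modulus.
Context {R : realType}.
Implicit Types x y : R * R.

Lemma normr1_le_modulus x : `|x.1| <= modulus x.
Proof. by rewrite -sqrtr_sqr ler_wsqrtr// lerDl sqr_ge0. Qed.

Lemma normr2_le_modulus x : `|x.2| <= modulus x.
Proof. by rewrite -sqrtr_sqr ler_wsqrtr// lerDr sqr_ge0. Qed.

Lemma modulus_le_sum x : modulus x <= `|x.1| + `|x.2|.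
Proof.
have s0 : 0 <= `|x.1| + `|x.2| by rewrite addr_ge0.
rewrite -(ger0_norm s0) -sqrtr_sqr ler_wsqrtr//.
rewrite -[x.1 ^+ 2]real_normK ?num_real// -[x.2 ^+ 2]real_normK ?num_real//.
by rewrite sqrrD; have := mulr_ge0 (normr_ge0 x.1) (normr_ge0 x.2); lra.
Qed.

Lemma modulusN x : modulus (- x) = modulus x.
Proof. by rewrite /modulus /= !sqrrN. Qed.

(** The constant 4 results from estimating coordinate by coordinate; its value has no importance. *)
Lemma modulusB_le (M : R) x y : modulus x <= M -> modulus y <= M -> modulus (x - y) <= 4 * M.
Proof.
move=> xM yM; apply: (le_trans (modulus_le_sum _)).
have := ler_normB x.1 y.1; have := ler_normB x.2 y.2.
have := normr1_le_modulus x; have := normr2_le_modulus x.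
have := normr1_le_modulus y; have := normr2_le_modulus y.
by rewrite /=; lra.
Qed.

Lemma modulus_scale (a : R) x : 0 <= a -> modulus (a * x.1, a * x.2) = a * modulus x.
Proof.
move=> a0; rewrite /modulus/= !exprMn -mulrDr sqrtrM ?sqr_ge0//.
by rewrite sqrtr_sqr ger0_norm.
Qed.

(** At rate 2 the factor [kap] is 1, so [green_log] compares the logarithm of the modulus itself
    with a kernel whose integral is known. At the origin the left side is 0 by the convention for
    [ln]. *)
Lemma ln_modulus_le x : `|ln (modulus x)| <= pi * gr 2 x + `|euler_mascheroni R| + modulus x.
Proof.
have q2 : (0 : R) < 2 by [].
have pgw (w : R * R) : 0 <= pi * gr 2 w by apply: mulr_ge0; [exact: pi_ge0|exact: gr_ge0].
have pg0 := pgw x.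
have [->|x0] := eqVneq x 0.
  have -> : modulus (0 : R * R) = 0 by rewrite /modulus/= expr0n/= addr0 sqrtr0.
  rewrite (ln0 (lexx 0)) normr0 addr0; exact: addr_ge0 (pgw 0) (normr_ge0 _).
have [_] := green_log q2 x0.
have -> : kap 2 = 1 :> R by rewrite /kap divff ?pnatr_eq0// sqrtr1.
rewrite mulr1 => H; have mx := modulus_ge0 x.
have := ler_norm (euler_mascheroni R); have := ler_norm (- euler_mascheroni R); rewrite normrN.
move: H pg0 mx; rewrite !ler_norml.
move: (pi * gr 2 x) (modulus x) (ln _) `|euler_mascheroni R| (euler_mascheroni R) => p m l ng g.
move=> /andP[h1 h2] p0 m0 h3 h4; apply/andP; split; lra.
Qed.
End Modulus.

Section Potential.
Context {R : realType}.
Variable (M : R).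
Local Notation mu := (@lebesgue_measure R).
Local Notation leb := (@leb2_sfm R).
Local Notation g2 := (@gr R 2).

Definition bsupp (f : R * R -> R) : Prop :=
  bmeas f /\ forall x, M < modulus x -> f x = 0.

Lemma bsuppM k f : bmeas k -> bsupp f -> bsupp (fun x => k x * f x).
Proof. by move=> bk [bf f0]; split; [exact: bmeasM|move=> x /f0 ->; rewrite mulr0]. Qed.

Lemma bsuppD f g : bsupp f -> bsupp g -> bsupp (fun x => f x + g x).
Proof.
move=> [bf f0] [bg g0]; split; first exact: bmeasD.
by move=> x Mx; rewrite f0// g0// addr0.
Qed.

Lemma bsuppZ c f : bsupp f -> bsupp (fun x => c * f x).
Proof. by apply: bsuppM; exact: bmeas_cst. Qed.

Lemma bsupp_abs f : bsupp f -> bsupp (fun x => `|f x|).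
Proof. by move=> [bf f0]; split; [exact: bmeas_abs|move=> x /f0 ->; rewrite normr0]. Qed.

Definition disc : set (R * R) := [set x | modulus x <= M].

Lemma measurable_disc : measurable disc.
Proof.
have mI : measurable (`]-oo, M]%classic : set R) by exact: measurable_itv.
have := @measurable_modulus R measurableT _ mI; congr (measurable _).
by apply/seteqP; split => x; rewrite /disc/= in_itv/=; [case|].
Qed.

Definition area : R := fine (leb disc).

Lemma leb_disc : leb disc = area%:E.
Proof.
rewrite /area fineK//; have mI : measurable (`[- M, M]%classic : set (measurableTypeR R)) by exact: measurable_itv.
rewrite ge0_fin_numE; last exact: measure_ge0.
apply: (@le_lt_trans _ _ (leb (`[- M, M]%classic `*` `[- M, M]%classic))).
  apply: le_measure; rewrite ?inE; first exact: measurable_disc.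
    exact: measurableX.
  move=> x; rewrite /disc/= => xM; rewrite !in_itv/= -!ler_norml.
  by rewrite !(le_trans _ xM) ?normr1_le_modulus ?normr2_le_modulus.
rewrite /leb2_sfm/= product_measure1E//= !lebesgue_measure_itv/= !lte_fin.
by case: ifP => _; rewrite ?mule0 ?mul0e// -!EFinD -EFinM ltry.
Qed.

Lemma area_ge0 : 0 <= area. Proof. exact: fine_ge0 (measure_ge0 _ _). Qed.

Let mI1 : measurable_fun setT (\1_disc : R * R -> R).
Proof. exact: measurable_indic measurable_disc. Qed.

Lemma integral_disc : (\int[leb]_x (\1_disc x)%:E = area%:E)%E.
Proof.
rewrite (@integral_indic _ _ _ leb _ measurableT disc measurable_disc) setIT.
exact: leb_disc.
Qed.

Let int_disc : leb.-integrable setT (EFin \o (\1_disc : R * R -> R)).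
Proof.
apply/integrableP; split; first by apply/measurable_EFinP.
have E (x : R * R) : (`|(EFin \o (\1_disc : R * R -> R)) x| = (\1_disc x)%:E)%E.
  by rewrite /= ger0_norm.
have -> : (\int[leb]_x `|(EFin \o (\1_disc : R * R -> R)) x| = \int[leb]_x (\1_disc x)%:E)%E.
  by apply: eq_integral => x _; exact: E.
by rewrite integral_disc ltry.
Qed.

Lemma Rintegral_disc : \int[leb2]_x (\1_disc x : R) = area.
Proof.
by rewrite /Rintegral; have := integral_disc; rewrite /= => ->.
Qed.

(* [\1_disc y + gr 2 (y - x)] dominates the logarithmic kernel near the point [x]. *)
Definition dom (x y : R * R) : R := \1_disc y + g2 (y - x).

(** [2^-1] is the total mass of the Green kernel at rate 2, and translations preserve it; the bound
    is thus uniform in [x]. *)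
Lemma integral_gr_shift (x : R * R) : (\int[leb2]_y (g2 (y - x))%:E <= (2^-1)%:E)%E.
Proof.
have q2 : (0 : R) < 2 by [].
have mg : measurable_fun setT (fun y : R * R => (g2 y)%:E).
  by apply/measurable_EFinP; exact: measurable_gr.
have g0 (y : R * R) : (0 <= (g2 y)%:E)%E by rewrite lee_fin gr_ge0.
have m1 : measurable_fun setT (fun y : R * R => (g2 (y - x))%:E).
  exact: (measurableT_comp mg (measurable_fun_addpair (@measurable_id _ (R * R)%type setT)
    (measurable_cst (- x)))).
rewrite (ge0_leb2_affine x ltr01 m1 (fun _ => g0 _)) expr1n mul1e.
have E (y : R * R) : (1 * y.1 + x.1, 1 * y.2 + x.2) - x = y.
  by rewrite [RHS]surjective_pairing; congr pair; rewrite /= mul1r addrK.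
have -> : (\int[leb2]_y (g2 ((1 * y.1 + x.1, 1 * y.2 + x.2) - x))%:E = \int[leb2]_y (g2 y)%:E)%E.
  by apply: eq_integral => y _; rewrite E.
rewrite -(integral_green q2).
have le (y : R * R) : ((g2 y)%:E <= green 2 y)%E.
  by have := green_ge0 2 y; rewrite /gr; case: (green 2 y).
apply: (@ge0_le_integral _ _ _ leb); first exact: measurableT.
- by move=> y _; exact: g0.
- exact: mg.
- exact: measurable_green.
- by move=> y _; exact: le.
Qed.

Lemma dom_ge0 x y : 0 <= dom x y.
Proof. by rewrite addr_ge0// gr_ge0. Qed.

Let int_gr x : leb.-integrable setT (fun y => (g2 (y - x))%:E).
Proof.
apply/integrableP; split.
  apply/measurable_EFinP; exact: (measurableT_comp (@measurable_gr R 2) (measurable_fun_addpair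
    (@measurable_id _ (R * R)%type setT) (measurable_cst (- x)))).
have E (y : R * R) : (`|(g2 (y - x))%:E| = (g2 (y - x))%:E)%E.
  by rewrite /= ger0_norm// gr_ge0.
have -> : (\int[leb]_y `|(g2 (y - x))%:E| = \int[leb]_y (g2 (y - x))%:E)%E.
  by apply: eq_integral => y _; exact: E.
exact: le_lt_trans (integral_gr_shift x) (ltry _).
Qed.

Lemma integrable_dom x : leb.-integrable setT (EFin \o dom x).
Proof.
exact: (integrableD measurableT int_disc (int_gr x)).
Qed.

Lemma Rintegral_dom x : \int[leb2]_y dom x y <= area + 2^-1.
Proof.
rewrite (RintegralD measurableT int_disc (int_gr x)) Rintegral_disc lerD2l /Rintegral.
rewrite -lee_fin fineK; first exact: integral_gr_shift.
exact: (integrable_fin_num measurableT (int_gr x)).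
Qed.

(** Kernels with at most a logarithmic singularity at [x]. Their integrals against a bounded
    function supported in the disc are bounded in terms of [A], uniformly in [x], because the
    integral of [dom x] is. *)
Definition tame (x : R * R) (A : R) (K : R * R -> R) : Prop :=
  [/\ 0 <= A, measurable_fun setT K & forall y, modulus y <= M -> `|K y| <= A * dom x y].

Lemma tame_mul_le x A K f C y : tame x A K -> bsupp f -> (forall y, `|f y| <= C) ->
  `|K y * f y| <= A * C * dom x y.
Proof.
move=> [A0 mK KA] [bf f0] fC; have C0 := le_trans (normr_ge0 _) (fC 0).
case: (leP (modulus y) M) => [yM|My].
  by rewrite normrM mulrAC ler_pM// KA.
rewrite f0// mulr0 normr0; apply: mulr_ge0; last exact: dom_ge0.
exact: mulr_ge0.
Qed.

Lemma tame_integrable x A K f : tame x A K -> bsupp f ->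
  leb.-integrable setT (EFin \o (fun y => K y * f y)).
Proof.
move=> tK bf; have [_ mK _] := tK; have [[mf [C fC]] _] := bf.
apply: (@le_integrable _ _ _ leb setT measurableT _ (fun y => (A * C)%:E * (dom x y)%:E)%E).
- by apply/measurable_EFinP; exact: measurable_funM.
- move=> y _; rewrite -EFinM /= lee_fin.
  apply: (le_trans (tame_mul_le y tK bf fC)); exact: ler_norm.
- exact: (integrableZl measurableT (A * C) (integrable_dom x)).
Qed.

Lemma tame_Rintegral_le x A K f C : tame x A K -> bsupp f -> (forall y, `|f y| <= C) ->
  `|\int[leb2]_y (K y * f y)| <= A * C * (area + 2^-1).
Proof.
move=> tK bf fC; have iK := tame_integrable tK bf.
have iD : leb.-integrable setT (EFin \o (fun y => A * C * dom x y)).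
  exact: (integrableZl measurableT (A * C) (integrable_dom x)).
apply: (le_trans (le_normr_Rintegral measurableT iK)).
have AC0 : 0 <= A * C.
  by have [A0 _ _] := tK; rewrite mulr_ge0// (le_trans (normr_ge0 _) (fC 0)).
apply: (@le_trans _ _ (A * C * \int[leb2]_y dom x y)); last by rewrite ler_wpM2l// Rintegral_dom.
rewrite -(RintegralZl (A * C) measurableT (integrable_dom x)).
apply: (le_Rintegral measurableT _ iD).
- exact: (integrable_norm iK).
- by move=> y _; exact: tame_mul_le.
Qed.

Lemma tame_cst x c : tame x `|c| (fun=> c).
Proof.
split => // y yM; rewrite ler_peMr// /dom indicE mem_set//.
by rewrite lerDl gr_ge0.
Qed.

Lemma tameD x A B K K' : tame x A K -> tame x B K' -> tame x (A + B) (fun y => K y + K' y).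
Proof.
move=> [A0 mK KA] [B0 mK' KB]; split; [exact: addr_ge0|exact: measurable_funD|].
by move=> y yM; rewrite mulrDl (le_trans (ler_normD _ _))// lerD ?KA ?KB.
Qed.

Lemma bsupp_integrable f : bsupp f -> leb.-integrable setT (EFin \o f).
Proof.
move=> bf; have := tame_integrable (tame_cst 0 1) bf; congr (integrable _ _ _).
by apply/funext => y; rewrite /= mul1r.
Qed.

Lemma Rintegral_bsupp_le f C : bsupp f -> (forall y, `|f y| <= C) ->
  `|\int[leb2]_y f y| <= C * (area + 2^-1).
Proof.
move=> bf fC; have := tame_Rintegral_le (tame_cst 0 1) bf fC.
rewrite normr1 mul1r; suff -> : (fun y => 1 * f y) = f by [].
by apply/funext => y; rewrite mul1r.
Qed.

(** The three terms of [ln_modulus_le] for the difference of two points of the disc, with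
    [modulusB_le] for the last one. *)
Definition log_bound : R := pi + `|euler_mascheroni R| + 4 * `|M|.

Lemma measurable_ln_modulus : measurable_fun setT
  (fun p : (R * R) * (R * R) => ln (modulus (p.1 - p.2))).
Proof.
have mN : measurable_fun [set: R * R] (fun y : R * R => - y).
  have := measurable_linear2 (-1) 0 0 0 (-1) (0 : R).
  by apply: eq_measurable_fun => y _; rewrite [RHS]surjective_pairing; congr pair; rewrite /=; ring.
apply: (measurableT_comp (@measurable_ln R)); apply: (measurableT_comp (@measurable_modulus R)).
apply: measurable_fun_addpair; first exact: measurable_fst.
exact: (measurableT_comp mN measurable_snd).
Qed.

Lemma tame_ln x : modulus x <= M -> tame x log_bound (fun y => ln (modulus (x - y))).
Proof.
move=> xM; have M0 : 0 <= M := le_trans (modulus_ge0 x) xM.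
split.
  apply: addr_ge0; first by apply: addr_ge0; [exact: pi_ge0|exact: normr_ge0].
  by apply: mulr_ge0; [|exact: normr_ge0].

  exact: (measurableT_comp measurable_ln_modulus (pair1_measurable x)).
move=> y yM; apply: (le_trans (ln_modulus_le _)).
have g0 := gr_ge0 2 (y - x).
have -> : g2 (x - y) = g2 (y - x) by rewrite /gr /green -opprB modulusN.
have := modulusB_le xM yM; rewrite /dom indicE mem_set// /log_bound (ger0_norm M0).
have p0 := @pi_ge0 R; have n0 := normr_ge0 (euler_mascheroni R).
move: (modulus (x - y)) => m; move: `|_| n0 => e e0; move: (g2 _) g0 => g g0.
have eg := mulr_ge0 e0 g0; have Mg := mulr_ge0 M0 g0.
have -> : true%:R = 1 :> R by [].
by move: (pi) p0 => p p0 m4; rewrite mulrDr mulr1 !mulrDl -mulrA; lra.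
Qed.

Definition logpot (f : R * R -> R) (x : R * R) : R :=
  \int[leb2]_y (- ln (modulus (x - y)) * f y).

Lemma tame_Nln x : modulus x <= M -> tame x log_bound (fun y => - ln (modulus (x - y))).
Proof.
move=> /tame_ln [A0 mK KA]; split => //; first exact: measurableT_comp.
by move=> y yM; rewrite normrN KA.
Qed.

Lemma logpot_le f C x : bsupp f -> (forall y, `|f y| <= C) -> modulus x <= M ->
  `|logpot f x| <= log_bound * C * (area + 2^-1).
Proof. by move=> bf fC xM; apply: tame_Rintegral_le (tame_Nln xM) bf fC. Qed.

Lemma measurable_logpot f : measurable_fun setT f -> measurable_fun setT (logpot f).
Proof.
move=> mf.
have mK : measurable_fun setT
    (fun p : (R * R) * (R * R) => - ln (modulus (p.1 - p.2)) * f p.2).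
  apply: measurable_funM; first exact: measurableT_comp _ measurable_ln_modulus.
  exact: measurableT_comp mf measurable_snd.
exact: (measurable_Rintegral leb (E := setT) measurableT mK).
Qed.

Lemma logpotD f g x : bsupp f -> bsupp g -> modulus x <= M ->
  logpot (fun y => f y + g y) x = logpot f x + logpot g x.
Proof.
move=> bf bg xM; have tK := tame_Nln xM.
rewrite /logpot -(RintegralD measurableT (tame_integrable tK bf) (tame_integrable tK bg)).
by apply: eq_Rintegral => y _; rewrite mulrDr.
Qed.

Lemma logpotZ c f x : bsupp f -> modulus x <= M -> logpot (fun y => c * f y) x = c * logpot f x.
Proof.
move=> bf xM; have tK := tame_Nln xM.
rewrite /logpot -(RintegralZl c measurableT (tame_integrable tK bf)).
by apply: eq_Rintegral => y _; rewrite mulrCA.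
Qed.

Lemma integral_eq_off_point (a : R * R) (f g : R * R -> \bar R) : measurable_fun setT f ->
  measurable_fun setT g -> (forall y, y != a -> f y = g y) ->
  (\int[leb2]_y f y = \int[leb2]_y g y)%E.
Proof.
move=> mf mg fg; apply: (@ae_eq_integral _ _ _ leb setT g f measurableT mf mg).
exists ([set a.1] `*` [set a.2]); split.
- exact: measurableX.
- by rewrite /leb2_sfm/= product_measure1E//= lebesgue_measure_set1 mul0e.
- move=> y /= H; apply: contrapT => ya; apply: H => _; apply: fg; apply/eqP => ya'.
  by apply: ya; rewrite ya'.
Qed.

Lemma Rintegral_eq_off_point (a : R * R) (f g : R * R -> R) : measurable_fun setT f ->
  measurable_fun setT g -> (forall y, y != a -> f y = g y) ->
  \int[leb2]_y f y = \int[leb2]_y g y.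
Proof.
move=> mf mg fg; rewrite /Rintegral; congr fine; apply: (integral_eq_off_point (a := a)).
- by apply/measurable_EFinP.
- by apply/measurable_EFinP.
- by move=> y ya; rewrite /= fg.
Qed.

Lemma gr_opp q (y : R * R) : gr q (- y) = gr q y.
Proof. by rewrite /gr /green modulusN. Qed.

(** * The free resolvent on rescaled profiles and its continuity *)

Section GreenOperator.
Variable q : R.
Hypothesis q0 : 0 < q.

Lemma integrable_gr : leb.-integrable setT (EFin \o gr q).
Proof.
have mg : measurable_fun setT (EFin \o gr q).
  by apply/measurable_EFinP; exact: measurable_gr.
have E (y : R * R) : (`|(EFin \o gr q) y| <= green q y)%E.
  rewrite /= ger0_norm ?gr_ge0//.
  by have := green_ge0 q y; rewrite /gr; case: (green q y).
apply/integrableP; split => //.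
apply: (@le_lt_trans _ _ (\int[leb]_y green q y)%E); last by rewrite (integral_green q0) ltry.
apply: (@ge0_le_integral _ _ _ leb); first exact: measurableT.
- by move=> y _; exact: abse_ge0.
- exact: measurableT_comp.
- exact: measurable_green.
- by move=> y _; exact: E.
Qed.

Definition green_mean (h : R * R -> R) (x : R * R) : R := \int[leb2]_y (gr q y * h (x + y)).

Let mshift (h : R * R -> R) (x : R * R) : measurable_fun setT h ->
  measurable_fun setT (fun y : R * R => h (x + y)).
Proof.
move=> mh; exact: (measurableT_comp mh (measurable_fun_addpair
  (measurable_cst x) (@measurable_id _ (R * R)%type setT))).
Qed.

Lemma integrable_green_mean (h : R * R -> R) (x : R * R) : bmeas h ->
  leb.-integrable setT (EFin \o (fun y => gr q y * h (x + y))).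
Proof.
move=> [mh [C hC]].
apply: (@le_integrable _ _ _ leb setT measurableT _ (fun y => C%:E * (gr q y)%:E)%E).
- apply/measurable_EFinP; apply: measurable_funM; [exact: measurable_gr|exact: mshift].
- move=> y _; rewrite -EFinM /= lee_fin normrM (ger0_norm (gr_ge0 q y)).
  rewrite mulrC; apply: (le_trans _ (ler_norm _)); rewrite ler_wpM2r ?gr_ge0//.
- exact: (integrableZl measurableT C integrable_gr).
Qed.

Lemma green_meanE h x : bmeas h -> (forall y, 0 <= h y) ->
  green_op q (EFin \o h) x = (green_mean h x)%:E.
Proof.
move=> bh h0; have [mh _] := bh.
have mhE : measurable_fun setT (EFin \o h) by exact: bmeas_EFin.
have h0e y : (0 <= (EFin \o h) y)%E by rewrite lee_fin.
have ih := integrable_green_mean x bh.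
rewrite /green_mean /Rintegral fineK; last exact: (integrable_fin_num measurableT ih).
rewrite (green_op_greenE q x mhE h0e); apply: (integral_eq_off_point (a := 0)).
- by apply: emeasurable_funM; [exact: measurable_green|apply/measurable_EFinP; exact: mshift].
- apply/measurable_EFinP; apply: measurable_funM; [exact: measurable_gr|exact: mshift].
- by move=> y y0; have [-> _] := green_log q0 y0.
Qed.

Lemma green_meanD h k x : bmeas h -> bmeas k ->
  green_mean (fun y => h y + k y) x = green_mean h x + green_mean k x.
Proof.
move=> bh bk; rewrite /green_mean.
rewrite -(RintegralD measurableT (integrable_green_mean x bh) (integrable_green_mean x bk)).
by apply: eq_Rintegral => y _; rewrite mulrDr.
Qed.

Lemma green_meanZ c h x : bmeas h -> green_mean (fun y => c * h y) x = c * green_mean h x.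
Proof.
move=> bh; rewrite /green_mean -(RintegralZl c measurableT (integrable_green_mean x bh)).
by apply: eq_Rintegral => y _; rewrite mulrCA.
Qed.

Lemma green_meanB h k x : bmeas h -> bmeas k ->
  green_mean (fun y => h y - k y) x = green_mean h x - green_mean k x.
Proof.
move=> bh bk; rewrite (green_meanD x bh (bmeasN bk)); congr (_ + _).
rewrite -[RHS]mulN1r -(green_meanZ (-1) x bk); congr green_mean.
by apply/funext => y; rewrite mulN1r.
Qed.

Lemma bmeas_green_mean h : bmeas h -> bmeas (green_mean h).
Proof.
move=> bh; pose hp x := Num.max (h x) 0; pose hn x := Num.max (- h x) 0.
have bp : bmeas hp := bmeas_max0 bh.
have bn : bmeas hn := bmeas_max0 (bmeasN bh).
have hp0 x : 0 <= hp x by rewrite le_max lexx orbT.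
have hn0 x : 0 <= hn x by rewrite le_max lexx orbT.
have b1 k : bmeas k -> (forall x, 0 <= k x) -> bmeas (green_mean k).
  move=> bk k0; have [_] := bmeas_fine_green_op q0 bk k0; congr bmeas.
  by apply/funext => x; rewrite (green_meanE x bk k0).
have -> : green_mean h = (fun x => green_mean hp x - green_mean hn x).
  apply/funext => x; rewrite -(green_meanB x bp bn); congr green_mean.
  apply/funext => y; rewrite /hp /hn; have [v|v] := leP 0 (h y).
    by rewrite max_r ?subr0// oppr_le0.
  by rewrite max_l ?sub0r ?opprK// oppr_ge0 ltW.
by apply: bmeasB; exact: b1.
Qed.

Lemma bmeas_scale (a : R) s : bmeas s -> bmeas (fun x => s (a * x.1, a * x.2)).
Proof.
move=> [ms [C sC]]; split; last by exists C => x.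
have := measurableT_comp ms (measurable_linear2 a 0 0 0 a 0).
by apply: eq_measurable_fun => y _ /=; congr s; congr pair; ring.
Qed.

Lemma bmeas_rescale (eps : R) s : bmeas s -> bmeas (rescale eps s).
Proof. by move=> bs; apply: bmeasM; [exact: bmeas_cst|exact: bmeas_scale]. Qed.

Lemma green_mean_rescale (eps : R) (s : R * R -> R) (w : R * R) : 0 < eps -> bmeas s ->
  green_mean (rescale eps s) w = \int[leb2]_y (gr q ((eps * y.1, eps * y.2) - w) * s y).
Proof.
move=> e0 bs; have bh := bmeas_scale eps^-1 bs.
rewrite /rescale (green_meanZ (eps ^- 2) w bh) /green_mean.
have mf : measurable_fun setT (fun y : R * R => gr q y * s (eps^-1 * (w + y).1, eps^-1 * (w + y).2)).
  by apply: measurable_funM; [exact: measurable_gr|have [m _] := bh; exact: (mshift w m)].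
rewrite (Rintegral_leb2_affine (- w) e0 mf) mulrA mulVf ?mul1r ?expf_neq0 ?gt_eqF//.
have E (y : R * R) : gr q (eps * y.1 + (- w).1, eps * y.2 + (- w).2) *
    s (eps^-1 * (w + (eps * y.1 + (- w).1, eps * y.2 + (- w).2)).1,
       eps^-1 * (w + (eps * y.1 + (- w).1, eps * y.2 + (- w).2)).2) =
    gr q ((eps * y.1, eps * y.2) - w) * s y.
  congr (_ * s _).
  have en : eps != 0 by rewrite gt_eqF.
  rewrite [RHS]surjective_pairing; congr pair; rewrite /= addrCA subrr addr0.
    by rewrite mulrA mulVf ?mul1r.
  by rewrite mulrA mulVf ?mul1r.
by apply: eq_Rintegral => y _; exact: E.
Qed.

(** Limit of [pi * gr q y + ln (modulus y)] as [y] tends to 0. *)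
Definition log_const : R := - euler_mascheroni R - ln (kap q).

(** [green_log] at [eps] times [y - x] splits the logarithm into [ln eps], which multiplies the
    total mass of [s], and [ln (modulus (x - y))], which gives the potential. The explicit linear
    dependence on [S] matters, since [S] will itself grow like [ln eps^-1]. *)
Lemma green_expand (eps : R) (s : R * R -> R) (S : R) (x : R * R) : 0 < eps -> bsupp s ->
  (forall y, `|s y| <= S) -> modulus x <= M ->
  `|pi * green_mean (rescale eps s) (eps * x.1, eps * x.2) -
    ((ln eps^-1 + log_const) * \int[leb2]_y s y + logpot s x)| <=
  eps * kap q * (4 * M) * S * (area + 2^-1).
Proof.
move=> e0 bs sS xM; have k0 := kap_gt0 q0; have M0 := le_trans (modulus_ge0 x) xM.
rewrite (green_mean_rescale _ e0 bs.1).
set w := (eps * x.1, eps * x.2); set L := ln eps^-1 + log_const.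
pose b := eps * kap q * (4 * M).
have b0 : 0 <= b by rewrite !mulr_ge0 ?(ltW e0) ?(ltW k0).
pose G (y : R * R) := gr q ((eps * y.1, eps * y.2) - w).
have mG : measurable_fun setT G.
  apply: (measurableT_comp (@measurable_gr R q)).
  have := measurable_linear2 eps 0 (- w.1) 0 eps (- w.2).
  by apply: eq_measurable_fun => y _; congr pair; rewrite /=; ring.
(* The remainder of the expansion, set to 0 at [y = x], where [gr] and [ln] have mere default
   values. *)
pose K (y : R * R) := if y == x then 0 else pi * G y - (L + - ln (modulus (x - y))).
have mln : measurable_fun setT (fun y : R * R => - ln (modulus (x - y))).
  by have [_ ? _] := tame_Nln xM.
have mK : measurable_fun setT K.
  apply: measurable_fun_ifT => //.
    apply: (measurable_fun_bool true); rewrite setTI.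
    rewrite (_ : _ @^-1` _ = [set x.1] `*` [set x.2]); first exact: measurableX.
    apply/seteqP; split => y /=; first by move=> /eqP ->.
    by move=> [y1 y2]; apply/eqP; rewrite [y]surjective_pairing [x]surjective_pairing y1 y2.
  apply: measurable_funB; first exact: measurable_funM.
  by apply: measurable_funD.
have KE y : y != x -> modulus y <= M -> `|K y| <= b.
  move=> yx yM; rewrite /K (negbTE yx).
  have dE : (eps * y.1, eps * y.2) - w = (eps * (y - x).1, eps * (y - x).2).
    by rewrite /w; congr pair; rewrite /= mulrBr.
  have yx0 : 0 < modulus (y - x) by apply: modulus_gt0; rewrite subr_eq0.
  have m1 : modulus ((eps * y.1, eps * y.2) - w) = eps * modulus (y - x).
    by rewrite dE modulus_scale// ltW.
  have n0 : (eps * y.1, eps * y.2) - w != 0.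
    apply/eqP => H; move: m1; rewrite H /modulus /= expr0n/= addr0 sqrtr0 => /esym/eqP.
    by rewrite mulf_eq0 gt_eqF//= gt_eqF.
  have [_] := green_log q0 n0; rewrite -/(G y) m1.
  have -> : modulus (x - y) = modulus (y - x) by rewrite -opprB modulusN.
  rewrite !lnM ?posrE ?mulr_gt0// /L lnV ?posrE// /log_const => H.
  have -> : pi * G y - (- ln eps + (- euler_mascheroni R - ln (kap q)) - ln (modulus (y - x))) =
     pi * G y + euler_mascheroni R + (ln eps + ln (modulus (y - x)) + ln (kap q)) by ring.
  apply: (le_trans H); rewrite /b [eps * kap q * _]mulrAC ler_wpM2r ?(ltW k0)// ler_wpM2l ?(ltW e0)//.
  exact: modulusB_le.
have tK : tame x b K.
  split => // y yM; have [yx|yx] := eqVneq y x.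
    by rewrite /K yx eqxx normr0; apply: mulr_ge0; [exact: b0|exact: dom_ge0].
  apply: (le_trans (KE y yx yM)); rewrite ler_peMr// /dom indicE mem_set//.
  by rewrite lerDl gr_ge0.
have tL := tame_cst x L; have tl := tame_Nln xM.
have tKL := tameD tK (tameD tL tl).
have [ms _] := bs.1.
have E1 : pi * \int[leb2]_y (G y * s y) = \int[leb2]_y ((K y + (L + - ln (modulus (x - y)))) * s y).
  have E2 : \int[leb2]_y (G y * s y) =
      \int[leb2]_y (pi^-1 * ((K y + (L + - ln (modulus (x - y)))) * s y)).
    apply: (Rintegral_eq_off_point (a := x)).
    - exact: measurable_funM.
    - apply: measurable_funM => //; apply: measurable_funM => //.
      by have [_ ? _] := tKL.
    - move=> y yx; rewrite /K (negbTE yx) subrK mulrA mulrA mulVf ?mul1r//.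
      by rewrite gt_eqF// pi_gt0.
  rewrite E2 (RintegralZl pi^-1 measurableT (tame_integrable tKL bs)) mulrA divff ?mul1r//.
  by rewrite gt_eqF// pi_gt0.
have iK := tame_integrable tK bs; have iL := tame_integrable tL bs; have il := tame_integrable tl bs.
have iLl := tame_integrable (tameD tL tl) bs.
have E3 : \int[leb2]_y ((K y + (L + - ln (modulus (x - y)))) * s y) =
    \int[leb2]_y (K y * s y) + (L * \int[leb2]_y s y + logpot s x).
  rewrite /logpot -(RintegralZl L measurableT (bsupp_integrable bs)).
  rewrite -(RintegralD measurableT iL il) -(RintegralD measurableT iK); last first.
    move: iLl; congr (integrable _ _ _); apply/funext => y; rewrite /= mulrDl//.
  by apply: eq_Rintegral => y _; rewrite !mulrDl.
rewrite E1 E3 addrK; exact: tame_Rintegral_le tK bs sS.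
Qed.

#[local] Opaque gr green.

Lemma gr_local (z : R * R) : z != 0 -> exists C e1 : R, [/\ 0 < C, 0 < e1 &
  forall v, modulus v <= e1 -> `|gr q (v - z) - gr q z| <= C * modulus v].
Proof.
move=> z0; set m := modulus z; have m0 : 0 < m := modulus_gt0 z0.
(* For [modulus v <= 1] the squared moduli of [v - z] and of [z] differ by at most [modulus v * D].
   The second entry of the minimum [e1] then keeps the squared modulus of [v - z] above
   [m ^+ 2 / 2]. *)
pose D := 1 + 4 * m; have D0 : 0 < D by rewrite addr_gt0// mulr_gt0.
pose e1 := Num.min 1 (m ^+ 2 / (2 * D)).
have mD : 0 < m ^+ 2 / (2 * D) by rewrite divr_gt0 ?exprn_gt0// mulr_gt0.
have e10 : 0 < e1 by rewrite lt_min ltr01.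
pose C := 2 / pi * D / (m ^+ 4 / 4) / q.
have C0 : 0 < C.
  by rewrite !(mulr_gt0, invr_gt0) ?pi_gt0 ?exprn_gt0 ?D0.
exists C, e1; split => // v; rewrite le_min => /andP[v1 ve]; have v0 := modulus_ge0 v.
set a := modulus (v - z) ^+ 2.
have aD : `|a - m ^+ 2| <= modulus v * D.
  have -> : a - m ^+ 2 = modulus v ^+ 2 - 2 * (v.1 * z.1 + v.2 * z.2).
    by rewrite /a /m !modulus_sqr/=; ring.
  apply: (le_trans (ler_normB _ _)).
  have h1 : `|v.1 * z.1| <= modulus v * m by rewrite normrM ler_pM// normr1_le_modulus.
  have h2 : `|v.2 * z.2| <= modulus v * m by rewrite normrM ler_pM// normr2_le_modulus.
  have h3 : `|2 * (v.1 * z.1 + v.2 * z.2)| <= 2 * (modulus v * m + modulus v * m).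
    rewrite normrM (ger0_norm (ler0n _ 2)) ler_wpM2l//.
    by rewrite (le_trans (ler_normD _ _))// lerD.
  have h4 : `|modulus v ^+ 2| <= modulus v.
    by rewrite ger0_norm ?sqr_ge0// expr2 ler_piMr.
  have -> : modulus v * D = modulus v + 2 * (modulus v * m + modulus v * m) by rewrite /D; ring.
  exact: lerD.
have aD2 : modulus v * D <= m ^+ 2 / 2.
  apply: (@le_trans _ _ (m ^+ 2 / (2 * D) * D)); first by rewrite ler_wpM2r// ltW.
  by rewrite le_eqVlt; apply/orP; left; apply/eqP; field; rewrite gt_eqF.
have a2 : m ^+ 2 / 2 <= a.
  move: (ler_norml (a - m ^+ 2) (modulus v * D)); rewrite aD => /esym/andP[h _].
  by move: h aD2; move: (m ^+ 2) (modulus v * D) => p r; lra.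
have vz0 : v - z != 0.
  apply/eqP => H; move: a2; rewrite /a H /modulus/= expr0n/= addr0 sqrtr0 expr0n/=.
  by rewrite leNgt divr_gt0// exprn_gt0.
have m4 : m ^+ 4 / 4 <= modulus (v - z) ^+ 4.
  have -> : modulus (v - z) ^+ 4 = a ^+ 2 by rewrite /a -exprM.
  have -> : m ^+ 4 / 4 = (m ^+ 2 / 2) ^+ 2 by field.
  by rewrite lerXn2r ?nnegrE ?divr_ge0 ?sqr_ge0// (le_trans _ a2)// divr_ge0// sqr_ge0.
have m44 : 0 < m ^+ 4 / 4 by rewrite divr_gt0// exprn_gt0.
have fin (y : R * R) (u : R) : m ^+ 4 / 4 <= modulus y ^+ 4 -> u <= modulus v * D -> 0 <= u ->
    2 / pi * u / modulus y ^+ 4 / q <= C * modulus v.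
  move=> my ud u0; have my0 : 0 < modulus y ^+ 4 by exact: lt_le_trans my.
  have -> : C * modulus v = 2 / pi * (modulus v * D) / (m ^+ 4 / 4) / q by rewrite /C; ring.
  rewrite ler_pM2r ?invr_gt0//; apply: ler_pM.
  - by rewrite !mulr_ge0// invr_ge0 pi_ge0.
  - by rewrite invr_ge0 ltW.
  - by rewrite ler_wpM2l// mulr_ge0// invr_ge0 pi_ge0.
  - by rewrite lef_pV2 ?posrE.
have f1 := gr_lipschitz_half q0 vz0 z0; have f2 := gr_lipschitz_half q0 z0 vz0.
have g1 := fin _ _ m4 aD (normr_ge0 _).
have mm4 : m ^+ 4 / 4 <= modulus z ^+ 4.
  by rewrite -/m ler_pdivrMr// ler_peMr ?ler1n// exprn_ge0// ltW.
have g2 := fin z _ mm4 aD (normr_ge0 _).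
rewrite -/m -/a distrC in f1; rewrite -/m -/a in f2 g1.
rewrite ler_norml; apply/andP; split.
  by rewrite lerBrDl -lerBrDr opprK; apply: (le_trans f2); rewrite lerD2l.
by rewrite lerBlDl; apply: (le_trans f1); rewrite lerD2l.
Qed.

Lemma Rintegral_gr_shift (w : R * R) : \int[leb2]_y gr q (y - w) = \int[leb2]_y gr q y.
Proof.
have m1 : measurable_fun setT (fun y : R * R => gr q (y - w)).
  exact: (measurableT_comp (@measurable_gr R q) (measurable_fun_addpair
    (@measurable_id _ (R * R)%type setT) (measurable_cst (- w)))).
etransitivity; first exact: (Rintegral_leb2_affine w ltr01 m1).
rewrite expr1n mul1r; apply: eq_Rintegral => y _; congr (gr q _).
by rewrite [RHS]surjective_pairing; congr pair; rewrite /= mul1r addrK.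
Qed.

Lemma integrable_gr_shift (w : R * R) :
  leb.-integrable setT (EFin \o (fun y : R * R => gr q (y - w))).
Proof.
have mg : measurable_fun setT (fun y : R * R => gr q (y - w)).
  exact: (measurableT_comp (@measurable_gr R q) (measurable_fun_addpair
    (@measurable_id _ (R * R)%type setT) (measurable_cst (- w)))).
have mgE : measurable_fun setT (fun y : R * R => (gr q y)%:E).
  by apply/measurable_EFinP; exact: measurable_gr.
have g0 (y : R * R) : (0 <= (gr q y)%:E)%E by rewrite lee_fin gr_ge0.
have mgwE : measurable_fun setT (fun y : R * R => (gr q (y - w))%:E) by apply/measurable_EFinP.
apply/integrableP; split => //.
have -> : (\int[leb]_y `|(EFin \o (fun y : R * R => gr q (y - w)%R)) y| =
    \int[leb]_y (gr q y)%:E)%E.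
  transitivity (\int[leb2]_y (gr q (y - w))%:E)%E.
    by apply: eq_integral => y _; rewrite /= ger0_norm// gr_ge0.
  etransitivity; first exact: (ge0_leb2_affine w ltr01 mgwE (fun _ => g0 _)).
  rewrite expr1n mul1e; apply: eq_integral => y _; congr (gr q _)%:E.
  by rewrite [RHS]surjective_pairing; congr pair; rewrite /= mul1r addrK.
have /integrableP[_] := integrable_gr.
apply: le_lt_trans; rewrite le_eqVlt; apply/orP; left; apply/eqP.
by apply: eq_integral => y _; rewrite /= ger0_norm// gr_ge0.
Qed.

(** Scheffe's argument: the minimum of the kernel and its translate is dominated by the kernel and
    converges to it off the origin. The distance of two numbers is their sum minus twice their
    minimum, and the two kernels have equal integrals. *)
Lemma gr_L1_continuous (w : (R * R)^nat) : (forall n, modulus (w n) <= n.+1%:R^-1) ->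
  \int[leb2]_y `|gr q (y - w n) - gr q y| @[n --> \oo] --> (0 : R).
Proof.
move=> wn; pose f (n : nat) (y : R * R) : R := Num.min (gr q (y - w n)) (gr q y).
have mg v : measurable_fun setT (fun y : R * R => gr q (y - v)).
  exact: (measurableT_comp (@measurable_gr R q) (measurable_fun_addpair
    (@measurable_id _ (R * R)%type setT) (measurable_cst (- v)))).
have mf n : measurable_fun setT (f n).
  by apply: measurable_minr; [exact: mg|exact: measurable_gr].
have f0 n y : 0 <= f n y by rewrite le_min; apply/andP; split; exact: gr_ge0.
have fle n y : f n y <= gr q y by rewrite /f ge_min; apply/orP; right.
have cvf (y : R * R) : y != 0 -> f n y @[n --> \oo] --> gr q y.
  move=> y0; have [C [e1 [C0 e10 H]]] := gr_local y0.
  apply/cvgrPdist_le => e e0; near=> n.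
  have wC : n.+1%:R^-1 < e / C.
    near: n; have eC : 0 < e / C by rewrite divr_gt0.
    exact: (near_infty_natSinv_lt (PosNum eC)).
  have we1 : n.+1%:R^-1 < e1 by near: n; exact: (near_infty_natSinv_lt (PosNum e10)).
  have := H (w n) (le_trans (wn n) (ltW we1)).
  have -> : gr q (w n - y) = gr q (y - w n) by rewrite -opprB gr_opp.
  have h1 : C * modulus (w n) <= e.
    by rewrite mulrC -ler_pdivlMr// (le_trans (wn n))// ltW.
  move=> /le_trans /(_ h1) h2; apply: le_trans h2; rewrite /f.
  move: (gr q (y - w n)) (gr q y) => a b.
  by case: (leP a b) => h; [rewrite distrC|rewrite subrr normr0].
have aef : {ae leb, forall y, setT y -> (f n y)%:E @[n --> \oo] --> (gr q y)%:E}.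
  exists ([set 0] `*` [set 0]); split.
  - exact: measurableX.
  - by rewrite /leb2_sfm/= product_measure1E//= lebesgue_measure_set1 mul0e.
  - move=> y /= H; apply: contrapT => ya; apply: H => _.
    apply: cvg_EFin; first exact: nearW.
    by apply: cvf; apply/eqP => ya'; apply: ya; rewrite ya'.
have dom n (y : R * R) : (`|(f n y)%:E| <= (gr q y)%:E)%E.
  by rewrite /= lee_fin (ger0_norm (f0 n y)).
have mfE n : measurable_fun setT (fun y => (f n y)%:E) by apply/measurable_EFinP; exact: mf.
have mgE : measurable_fun setT (fun y => (gr q y)%:E).
  by apply/measurable_EFinP; exact: measurable_gr.
have [_ _ cv] := @dominated_convergence _ _ _ leb setT measurableT
  (fun n y => (f n y)%:E) (fun y => (gr q y)%:E) (fun y => (gr q y)%:E) mfE mgE aef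
  integrable_gr (aeW leb (fun y n _ => dom n y)).
have iF n : leb.-integrable setT (EFin \o f n).
  apply: (@le_integrable _ _ _ leb setT measurableT _ (EFin \o gr q)).
  - exact: mfE.
  - by move=> y _ /=; rewrite lee_fin (ger0_norm (f0 n y)) (ger0_norm (gr_ge0 q y)); exact: fle.
  - exact: integrable_gr.
pose I := \int[leb2]_y gr q y.
have cvI : \int[leb2]_y f n y @[n --> \oo] --> I.
  apply: (@fine_cvg _ _ _ _ (fun n => \int[leb]_y (f n y)%:E)%E).
  rewrite /I /Rintegral fineK; first exact: cv.
  exact: (integrable_fin_num measurableT integrable_gr).
have E n : \int[leb2]_y `|gr q (y - w n) - gr q y| = 2 * (I - \int[leb2]_y f n y).
  have ig := integrable_gr; have igw := integrable_gr_shift (w n).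
  have -> : 2 * (I - \int[leb2]_y f n y) =
      (\int[leb2]_y gr q (y - w n) + I) - 2 * \int[leb2]_y f n y.
    by rewrite Rintegral_gr_shift -/I; ring.
  rewrite -(RintegralD measurableT igw ig) -(RintegralZl 2 measurableT (iF n)).
  rewrite -(RintegralB measurableT); last 2 first.
  - exact: (integrableD measurableT igw ig).
  - exact: (integrableZl measurableT 2 (iF n)).
  apply: eq_Rintegral => y _; rewrite /f.
  move: (gr q (y - w n)) (gr q y) => a b.
  case: (leP a b) => h.
    by rewrite distrC ger0_norm ?subr_ge0//; ring.
  by rewrite ger0_norm ?subr_ge0 ?(ltW h)//; ring.
rewrite (_ : (fun n => _) = (fun n => 2 * (I - \int[leb2]_y f n y))); last first.
  by apply/funext => n; exact: E.
rewrite -[X in _ --> X](mulr0 2) -(subrr I).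
by apply: cvgM; [exact: cvg_cst|apply: cvgB; [exact: cvg_cst|exact: cvI]].
Unshelve. all: by end_near. Qed.

(** The function is only bounded and measurable; continuity comes from the kernel, whose
    translations are continuous in L1. It allows the resolvent of [g] to be replaced by its value at
    0 on the shrinking support. *)
Lemma green_mean_continuous0 (h : R * R -> R) (e : R) : bmeas h -> 0 < e ->
  exists2 r : R, 0 < r & forall w, modulus w <= r -> `|green_mean h w - green_mean h 0| <= e.
Proof.
move=> bh e0; have [mh [C hC]] := bh.
have C0 : 0 <= C by exact: le_trans (normr_ge0 _) (hC 0).
have key w : `|green_mean h w - green_mean h 0| <= C * \int[leb2]_y `|gr q (y - w) - gr q y|.
  have ig := integrable_gr; have igw := integrable_gr_shift w.
  have mw : measurable_fun setT (fun y : R * R => gr q y * h (w + y)).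
    by apply: measurable_funM; [exact: measurable_gr|exact: mshift].
  have E1 : green_mean h w = \int[leb2]_y (gr q (y - w) * h y).
    rewrite /green_mean; etransitivity; first exact: (Rintegral_leb2_affine (- w) ltr01 mw).
    rewrite expr1n mul1r.
    have H (y : R * R) : (1 * y.1 + (- w).1, 1 * y.2 + (- w).2) = y - w.
      by rewrite [RHS]surjective_pairing; congr pair; rewrite /= mul1r.
    have Hk (y : R * R) : gr q (1 * y.1 + (- w).1, 1 * y.2 + (- w).2) *
      h (w + (1 * y.1 + (- w).1, 1 * y.2 + (- w).2)) = gr q (y - w) * h y.
      by rewrite H; congr (_ * h _); rewrite addrC subrK.
    by apply: eq_Rintegral => y _; exact: Hk.
  have E0 : green_mean h 0 = \int[leb2]_y (gr q y * h y).
    have Hk (y : R * R) : gr q y * h (0 + y) = gr q y * h y by rewrite add0r.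
    by apply: eq_Rintegral => y _; exact: Hk.
  have bnd (k : R * R -> R) : measurable_fun setT k -> leb.-integrable setT (EFin \o k) ->
      leb.-integrable setT (EFin \o (fun y => k y * h y)).
    move=> mk ik; apply: (@le_integrable _ _ _ leb setT measurableT _ (fun y => C%:E * (k y)%:E)%E).
    - by apply/measurable_EFinP; exact: measurable_funM.
    - move=> y _; rewrite -EFinM /= lee_fin !normrM mulrC (ger0_norm C0).
      by rewrite ler_wpM2r.
    - exact: (integrableZl measurableT C ik).
  have mgw : measurable_fun setT (fun y : R * R => gr q (y - w)).
    exact: (measurableT_comp (@measurable_gr R q) (measurable_fun_addpair
      (@measurable_id _ (R * R)%type setT) (measurable_cst (- w)))).
  have i1 := bnd _ mgw igw; have i0 := bnd _ (@measurable_gr R q) ig.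
  have md : measurable_fun setT (fun y : R * R => gr q (y - w) - gr q y).
    by apply: measurable_funB; [exact: mgw|exact: measurable_gr].
  have id : leb.-integrable setT (EFin \o (fun y : R * R => gr q (y - w) - gr q y)).
    exact: (integrableB measurableT igw ig).
  have idh := bnd _ md id.
  rewrite E1 E0 -(RintegralB measurableT i1 i0).
  have -> : \int[leb2]_y (gr q (y - w) * h y - gr q y * h y) =
      \int[leb2]_y ((gr q (y - w) - gr q y) * h y).
    by apply: eq_Rintegral => y _; rewrite mulrBl.
  apply: (le_trans (le_normr_Rintegral measurableT idh)).
  have ida := integrable_norm id.
  rewrite -(RintegralZl C measurableT ida).
  apply: (le_Rintegral measurableT (integrable_norm idh)).
  - exact: (integrableZl measurableT C ida).
  - by move=> y _; rewrite /= normrM mulrC ler_wpM2r.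
apply: contrapT => H.
have H' (n : nat) : exists w : R * R, modulus w <= n.+1%:R^-1 /\ e < `|green_mean h w - green_mean h 0|.
  apply: contrapT => Hn; apply: H; exists n.+1%:R^-1; first by rewrite invr_gt0.
  move=> w wn; rewrite leNgt; apply/negP => ew; apply: Hn; by exists w.
have [w wP] := choice H'.
have cv := gr_L1_continuous (fun n => (wP n).1).
have cv2 : C * \int[leb2]_y `|gr q (y - w n) - gr q y| @[n --> \oo] --> (0 : R).
  by rewrite -[X in _ --> X](mulr0 C); apply: cvgM; [exact: cvg_cst|exact: cv].
have : e <= 0.
  apply: (ler_cvg_to (cvg_cst e) cv2); apply: nearW => n.
  by rewrite (le_trans (ltW (wP n).2)).
by rewrite leNgt e0.
Qed.
End GreenOperator.

#[local] Opaque gr green.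

(** * The perturbative construction for abstract profiles *)

Section Core.
Variables (f0 f1 : R * R -> R) (C lambda : R).
Hypotheses (bf0 : bsupp f0) (bf1 : bsupp f1) (f00 : forall x, 0 <= f0 x).
Hypotheses (f0C : forall x, `|f0 x| <= C) (f1C : forall x, `|f1 x| <= C).
Hypotheses (f01 : \int[leb2]_x f0 x = 1) (M0 : 0 <= M).

Let B := area + 2^-1.
Let B0 : 0 <= B. Proof. by rewrite addr_ge0 ?area_ge0. Qed.
Let C0 : 0 <= C. Proof. exact: le_trans (normr_ge0 _) (f0C 0). Qed.
Let lb0 : 0 <= log_bound.
Proof.
apply: addr_ge0; first by apply: addr_ge0; [exact: pi_ge0|exact: normr_ge0].
by apply: mulr_ge0; [|exact: normr_ge0].
Qed.
Let P1 := log_bound * C * B.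
Let P10 : 0 <= P1. Proof. by rewrite !mulr_ge0. Qed.
Let pl := pi * (1 + `|lambda|).
Let pl0 : 0 <= pl. Proof. by rewrite mulr_ge0 ?pi_ge0// addr_ge0. Qed.

(** Cut off at the disc in order to be bounded; both profiles vanish outside. *)
Definition psi (x : R * R) : R := \1_disc x * logpot f0 x.

Lemma psi_disc x : modulus x <= M -> psi x = logpot f0 x.
Proof. by move=> xM; rewrite /psi indicE mem_set// mul1r. Qed.

Lemma psi_le x : `|psi x| <= P1.
Proof.
rewrite /psi indicE; case: (boolP (x \in disc)) => xM.
  by rewrite mul1r; apply: logpot_le => //; rewrite inE in xM.
by rewrite mul0r normr0.
Qed.

Lemma bmeas_psi : bmeas psi.
Proof.
split; last by exists P1; exact: psi_le.
by apply: measurable_funM => //; apply: measurable_logpot; have [[]] := bf0.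
Qed.

(** The limit of the integral of [sg T] as [T] tends to 0. For the profile of the theorem it is [pi]
    times the energy, by [energy_const_radial]. *)
Definition energy_const : R := pi * (\int[leb2]_x f1 x) + \int[leb2]_x (f0 x * logpot f0 x).
Local Notation e := energy_const.

(** [T] stands for the inverse of [ln eps^-1], which makes this the coupling and turns the
    bookkeeping into polynomial identities modulo [L * T = 1]. *)
Let coup (T : R) := pi * (T + lambda * T ^+ 2).
Let U (T : R) (x : R * R) := f0 x + coup T * f1 x.
Let sg (T : R) (x : R * R) := psi x * f0 x + (pi * (1 + lambda * T) * f1 x +
   coup T * (psi x * f1 x)).
Let S1 := P1 * C + (pl * C + pl * (P1 * C)).
Let R1 := pl * (C * B) + pl * (P1 * C * B).

Let coup_le T : 0 <= T -> T <= 1 -> `|coup T| <= pl * T.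
Proof.
move=> T0 T1; rewrite /coup /pl normrM (ger0_norm (pi_ge0 R)) -mulrA ler_wpM2l ?pi_ge0//.
rewrite (le_trans (ler_normD _ _))// normrM (ger0_norm T0) (ger0_norm (sqr_ge0 T)) mulrDl mul1r.
by rewrite lerD2l ler_wpM2l// expr2 ler_piMr.
Qed.

Let coup_le1 T : 0 <= T -> T <= 1 -> `|coup T| <= pl.
Proof. by move=> T0 T1; rewrite (le_trans (coup_le T0 T1))// ler_piMr. Qed.

Let onel_le T : 0 <= T -> T <= 1 -> `|pi * (1 + lambda * T)| <= pl.
Proof.
move=> T0 T1; rewrite normrM (ger0_norm (pi_ge0 R)) ler_wpM2l ?pi_ge0//.
rewrite (le_trans (ler_normD _ _))// normr1 lerD2l normrM (ger0_norm T0).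
by rewrite ler_piMr.
Qed.

Let bpf0 : bsupp (fun x => psi x * f0 x). Proof. exact: bsuppM bmeas_psi bf0. Qed.
Let bpf1 : bsupp (fun x => psi x * f1 x). Proof. exact: bsuppM bmeas_psi bf1. Qed.

Let bU T : bsupp (U T). Proof. exact: bsuppD bf0 (bsuppZ _ bf1). Qed.

Let bsg T : bsupp (sg T).
Proof. exact: bsuppD bpf0 (bsuppD (bsuppZ _ bf1) (bsuppZ _ bpf1)). Qed.

Let pfC f x : (forall x, `|f x| <= C) -> `|psi x * f x| <= P1 * C.
Proof. by move=> fC; rewrite normrM ler_pM// psi_le. Qed.

Lemma sg_le T x : 0 <= T -> T <= 1 -> `|sg T x| <= S1.
Proof.
move=> T0 T1; rewrite (le_trans (ler_normD _ _))// lerD ?pfC//.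
rewrite (le_trans (ler_normD _ _))// lerD// normrM ler_pM ?onel_le ?coup_le1 ?pfC//.
Qed.

Lemma U_le T x : 0 <= T -> T <= 1 -> `|U T x| <= C + pl * C.
Proof.
move=> T0 T1; rewrite (le_trans (ler_normD _ _))// lerD// normrM.
by rewrite ler_pM// coup_le1.
Qed.

Lemma sg_int T : 0 <= T -> T <= 1 -> `|\int[leb2]_x sg T x - e| <= T * R1.
Proof.
move=> T0 T1.
have i0 := bsupp_integrable bpf0; have i1 := bsupp_integrable (bsuppZ (pi * (1 + lambda * T)) bf1).
have i2 := bsupp_integrable (bsuppZ (coup T) bpf1).
have i12 := bsupp_integrable (bsuppD (bsuppZ (pi * (1 + lambda * T)) bf1) (bsuppZ (coup T) bpf1)).
rewrite /sg (RintegralD measurableT i0 i12) (RintegralD measurableT i1 i2).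
rewrite (RintegralZl _ measurableT (bsupp_integrable bf1)).
rewrite (RintegralZl _ measurableT (bsupp_integrable bpf1)).
have -> : \int[leb2]_x (psi x * f0 x) = \int[leb2]_x (f0 x * logpot f0 x).
  have E (x : R * R) : psi x * f0 x = f0 x * logpot f0 x.
    case: (leP (modulus x) M) => xM; first by rewrite psi_disc// mulrC.
    by have [_ ->] := bf0; rewrite ?mulr0 ?mul0r.
  by apply: eq_Rintegral => x _; exact: E.
rewrite /e; set a := \int[leb2]_x f1 x; set b := \int[leb2]_x (f0 x * _); set c := \int[leb2]_x _.
have aC : `|a| <= C * B by exact: Rintegral_bsupp_le.
have cC : `|c| <= P1 * C * B by apply: Rintegral_bsupp_le => // y; exact: pfC.
have -> : b + (pi * (1 + lambda * T) * a + coup T * c) - (pi * a + b) =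
    pi * (lambda * T) * a + coup T * c by ring.
have h1 : `|pi * (lambda * T)| <= T * pl.
  rewrite normrM (ger0_norm (pi_ge0 R)) normrM (ger0_norm T0) /pl.
  have -> : T * (pi * (1 + `|lambda|)) = pi * (`|lambda| * T) + pi * T by ring.
  by rewrite lerDl mulr_ge0 ?pi_ge0.
have h2 : `|coup T| <= T * pl by rewrite mulrC; exact: coup_le.
rewrite (le_trans (ler_normD _ _))// /R1 mulrDr lerD//.
  by rewrite normrM (mulrA T) ler_pM.
by rewrite normrM (mulrA T) ler_pM.
Qed.

(** Only [f0] carries a term of order [L]: in front of [f1] the factor [L] is used up by the
    coupling, as [L * coup T = pi * (1 + lambda * T)]. *)
Lemma sigmaE L T x : L * T = 1 -> U T x * (L + psi x) = L * f0 x + sg T x.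
Proof.
move=> LT; rewrite /U /sg.
have -> : pi * (1 + lambda * T) = L * coup T.
  rewrite /coup.
  have -> : L * (pi * (T + lambda * T ^+ 2)) = pi * ((L * T) + lambda * (L * T) * T) by ring.
  by rewrite LT mulr1.
by ring.
Qed.

Section FixedRate.
Variable q : R.
Hypothesis q0 : 0 < q.
Let c := log_const q.
Let k4 := kap q * (4 * M).
Let k40 : 0 <= k4. Proof. by rewrite mulr_ge0 ?mulr_ge0// ltW// kap_gt0. Qed.

Let IB := `|e| + R1.
Let R10 : 0 <= R1.
Proof.
apply: addr_ge0; apply: (mulr_ge0 pl0); first exact: (mulr_ge0 C0 B0).
exact: (mulr_ge0 (mulr_ge0 P10 C0) B0).
Qed.
Let S10 : 0 <= S1.
Proof.
have h := mulr_ge0 P10 C0.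
exact: (addr_ge0 h (addr_ge0 (mulr_ge0 pl0 C0) (mulr_ge0 pl0 h))).
Qed.
Let DB := k4 * (C + S1) * B.
Let P2 := log_bound * S1 * B.
Let G := `|c| * IB + P2 + DB.
Let XB := R1 + G + `|lambda| * (IB + `|c| + P1 + G).

(** The defect of the ansatz [L + psi] in the homogeneous equation. Expanding the resolvent and
    using [L * T = 1], the terms [L] and [psi x] cancel. Order one keeps the integral of [sg T],
    which is close to [e], the Green constant [c], and [lambda], which arises from
    [lambda * T ^+ 2 * L ^+ 2]. *)
Lemma bracket_le eps T x : 0 < eps -> eps <= 1 -> ln eps^-1 * T = 1 -> 0 < T -> T <= 1 ->
  modulus x <= M ->
  `|coup T * green_mean q (rescale eps (fun y => U T y * (ln eps^-1 + psi y))) (eps * x.1, eps * x.2)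
    - (ln eps^-1 + psi x) - (e + c + lambda)| <= T * XB.
Proof.
move=> e0 e1 LT T0 T1 xM; set L := ln eps^-1.
have -> : (fun y => U T y * (L + psi y)) = (fun y => L * f0 y + sg T y).
  by apply/funext => y; exact: sigmaE.
have L0 : 0 <= L by rewrite -(pmulr_lge0 _ T0) LT.
(* The remainder of [green_expand] is [eps] times a bound of order [L], hence stays bounded. *)
have eL : eps * L <= 1.
  by rewrite mulrC -ler_pdivlMr// mul1r ltW// ln_sublinear// invr_gt0.
have bs := bsuppD (bsuppZ L bf0) (bsg T).
have sB y : `|L * f0 y + sg T y| <= L * C + S1.
  rewrite (le_trans (ler_normD _ _))// lerD//; last by apply: sg_le => //; exact: ltW.
  by rewrite normrM (ger0_norm L0) ler_wpM2l.
have := green_expand q0 e0 bs sB xM.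
set gm := green_mean _ _ _.
rewrite (RintegralD measurableT (bsupp_integrable (bsuppZ L bf0)) (bsupp_integrable (bsg T))).
rewrite (RintegralZl _ measurableT (bsupp_integrable bf0)) f01 mulr1.
rewrite (logpotD (bsuppZ L bf0) (bsg T) xM) (logpotZ L bf0 xM) -(psi_disc xM) -/L -/c.
set I := \int[leb2]_y sg T y; set l := logpot (sg T) x.
set D := pi * gm - _ => DD.
have Dle : `|D| <= DB.
  apply: (le_trans DD); rewrite /DB -/B /k4 ler_wpM2r//.
  have -> : eps * kap q * (4 * M) * (L * C + S1) = kap q * (4 * M) * ((eps * L) * C + eps * S1) by ring.
  rewrite ler_wpM2l// lerD//; first by rewrite ler_piMl.
  by apply: ler_piMl.
have Ie : `|I - e| <= T * R1 by apply: sg_int => //; exact: ltW.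
have lle : `|l| <= P2 by apply: logpot_le => // y; apply: sg_le => //; exact: ltW.
have IIB : `|I| <= IB.
  rewrite -[I](subrK e) (le_trans (ler_normD _ _))// /IB addrC lerD2l.
  by rewrite (le_trans Ie)// ler_piMl.
have gmE : pi * gm = D + ((L + c) * (L + I) + (L * psi x + l)) by rewrite /D; ring.
have -> : coup T * gm - (L + psi x) - (e + c + lambda) =
    (I - e) + (T * (c * I + l + D) + lambda * T * (I + c + psi x + T * (c * I + l + D))).
  have -> : coup T * gm = (T + lambda * T ^+ 2) * (pi * gm) by rewrite /coup; ring.
  rewrite gmE.
  have -> : (T + lambda * T ^+ 2) * (D + ((L + c) * (L + I) + (L * psi x + l))) =
     (L * T) * L + (L * T) * (I + c + psi x) + T * (c * I + l + D) +
     lambda * ((L * T) ^+ 2 + (L * T) * T * (I + c + psi x) + T ^+ 2 * (c * I + l + D)) by ring.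
  by rewrite LT; ring.
have Gle : `|c * I + l + D| <= G.
  rewrite /G (le_trans (ler_normD _ _))// lerD// (le_trans (ler_normD _ _))// lerD//.
  by rewrite normrM ler_wpM2l.
have G0 : 0 <= G := le_trans (normr_ge0 _) Gle.
have -> : T * XB = T * R1 + (T * G + `|lambda| * T * (IB + `|c| + P1 + G)) by rewrite /XB; ring.
rewrite (le_trans (ler_normD _ _))// lerD// (le_trans (ler_normD _ _))// lerD//.
  by rewrite normrM (ger0_norm (ltW T0)) ler_wpM2l// ltW.
rewrite !normrM (ger0_norm (ltW T0)) ler_wpM2l ?mulr_ge0 ?(ltW T0)//.
rewrite (le_trans (ler_normD _ _))// lerD//.
  by rewrite (le_trans (ler_normD _ _))// lerD ?psi_le// (le_trans (ler_normD _ _))// lerD.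
by rewrite normrM (ger0_norm (ltW T0)) (le_trans _ Gle)// ler_piMl.
Qed.

Let CU := C + pl * C.
Let u1 := pl * (C * B).
Let P3 := log_bound * CU * B.
(** Order-one excess over [L] in [pi] times the resolvent of the absolute profile: [c] from the
    Green kernel, [u1] from [L * T * u1], where [T * u1] bounds the excess mass, [P3] from the
    potential, 1 for the [eps] error. Only [c] depends on [q], and it tends to minus infinity. *)
Let a := c + u1 + P3 + 1.
Let Y := `|c| * u1 + `|lambda| * `|a| + `|lambda| * (`|c| * u1).

(** After multiplication by the coupling the leading term is [L * T = 1], and the next one is [T]
    times [a] plus the absolute value of [lambda], at most [-2 * T]. The higher orders cost at most
    one [T] because [T * Y <= 1], and one [T] of margin is left. *)
Lemma small_le eps T x : 0 < eps -> ln eps^-1 * T = 1 -> 0 < T -> T <= 1 -> modulus x <= M ->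
  eps * k4 * CU * B <= 1 -> 0 <= ln eps^-1 + c -> T * Y <= 1 -> a + `|lambda| <= -2 ->
  green_mean q (fun w => `|coup T * rescale eps (U T) w|) (eps * x.1, eps * x.2) <= 1 - T.
Proof.
move=> e0 LT T0 T1 xM er Lc TY al; set L := ln eps^-1 in LT Lc *.
have T0' := ltW T0.
have bA := bsupp_abs (bU T).
have -> : (fun w => `|coup T * rescale eps (U T) w|) =
    (fun w => `|coup T| * rescale eps (fun y => `|U T y|) w).
  apply/funext => w; rewrite normrM /rescale; congr (_ * _).
  by rewrite normrM ger0_norm// invr_ge0 exprn_ge0// ltW.
rewrite (green_meanZ q0 _ _ (bmeas_rescale eps bA.1)).
have UB y : `| `|U T y| | <= CU by rewrite normr_id; exact: U_le.
have := green_expand q0 e0 bA UB xM; set gm := green_mean _ _ _; rewrite -/L -/c.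
set J := \int[leb2]_y _; set l := logpot _ _ => H.
have gm0 : 0 <= gm.
  apply: Rintegral_ge0 => y _; rewrite mulr_ge0 ?gr_ge0// /rescale mulr_ge0//.
  by rewrite invr_ge0 exprn_ge0// ltW.
have lle : `|l| <= P3 by exact: logpot_le.
(* Here [f0 >= 0] matters: the absolute profile has mass 1 to leading order, so the leading term of
   the estimate is not larger than 1. *)
have J1 : J <= 1 + T * u1.
  have i2 := bsupp_integrable (bsuppZ `|coup T| (bsupp_abs bf1)).
  apply: (@le_trans _ _ (\int[leb2]_y (f0 y + `|coup T| * `|f1 y|))).
    apply: (le_Rintegral measurableT (bsupp_integrable bA)).
    - exact: (bsupp_integrable (bsuppD bf0 (bsuppZ `|coup T| (bsupp_abs bf1)))).
    - by move=> y _; rewrite (le_trans (ler_normD _ _))// normrM (ger0_norm (f00 y)).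
  rewrite (RintegralD measurableT (bsupp_integrable bf0) i2) f01 lerD2l.
  rewrite (RintegralZl _ measurableT (bsupp_integrable (bsupp_abs bf1))).
  have f1a y : `| `|f1 y| | <= C by rewrite normr_id.
  rewrite /u1 mulrA [T * pl]mulrC ler_pM ?coup_le//.
    by apply: Rintegral_ge0 => y _.
  exact: le_trans (ler_norm _) (Rintegral_bsupp_le (bsupp_abs bf1) f1a).
have pgm : pi * gm <= (L + c) * (1 + T * u1) + P3 + 1.
  have h1 : (L + c) * J <= (L + c) * (1 + T * u1) by rewrite ler_wpM2l.
  have h2 := le_trans (ler_norm _) H; have h3 := le_trans (ler_norm _) lle.
  have h4 : eps * kap q * (4 * M) * CU * (area + 2^-1) <= 1.
    by apply: le_trans er; rewrite /k4 /B -!mulrA.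
  move: h1 h2 h3 h4; move: ((L + c) * J) ((L + c) * (1 + T * u1)) (eps * kap q * _ * _ * _).
  by move=> a1 a2 a3; lra.
have pgE : (L + c) * (1 + T * u1) + P3 + 1 = L + (a + T * (c * u1)).
  have -> : (L + c) * (1 + T * u1) = L + c + (L * T) * u1 + T * (c * u1) by ring.
  by rewrite LT /a; ring.
have cE : `|coup T| * gm = `|T + lambda * T ^+ 2| * (pi * gm).
  by rewrite /coup normrM (ger0_norm (pi_ge0 R)); ring.
have tl : `|T + lambda * T ^+ 2| <= T * (1 + `|lambda| * T).
  rewrite (le_trans (ler_normD _ _))// normrM (ger0_norm T0') (ger0_norm (sqr_ge0 T)).
  by rewrite mulrDr mulr1 expr2 mulrCA.
have pg0 : 0 <= pi * gm by rewrite mulr_ge0 ?pi_ge0.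
rewrite cE; apply: (@le_trans _ _ (T * (1 + `|lambda| * T) * (L + (a + T * (c * u1))))).
  apply: ler_pM => //; rewrite -pgE; exact: pgm.
have -> : T * (1 + `|lambda| * T) * (L + (a + T * (c * u1))) =
   (L * T) + T * (`|lambda| * (L * T) + a + T * (c * u1 + `|lambda| * a + `|lambda| * T * (c * u1))) by ring.
rewrite LT mulr1 lerD2l -[- T]mulr1 mulNr -mulrN ler_wpM2l//.
have u10 : 0 <= u1 := mulr_ge0 pl0 (mulr_ge0 C0 B0).
have h : c * u1 + `|lambda| * a + `|lambda| * T * (c * u1) <= Y.
  rewrite /Y lerD//; first rewrite lerD//.
  - by rewrite ler_wpM2r// ler_norm.
  - by rewrite ler_wpM2l// ler_norm.
  - have cu1 : `|c * u1| = `|c| * u1 by rewrite normrM (ger0_norm u10).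
    rewrite -mulrA ler_wpM2l// (le_trans (ler_norm _))// normrM (ger0_norm T0') cu1.
    by apply: ler_piMl => //; exact: (mulr_ge0 (normr_ge0 c) u10).
have : T * (c * u1 + `|lambda| * a + `|lambda| * T * (c * u1)) <= T * Y by rewrite ler_wpM2l.
move: TY al; move: (T * Y) (T * (_ + _)) => t1 t2.
lra.
Qed.

(** Near a fixed nonzero point the Green kernel is Lipschitz, so a rescaled profile acts on it like
    a point mass at 0. The radius is divided by [M + 1] to fit the rescaled disc. *)
Lemma near_point (z : R * R) : z != 0 -> exists K e1 : R, [/\ 0 <= K, 0 < e1 &
  forall eps s S, 0 < eps -> eps <= e1 -> bsupp s -> (forall y, `|s y| <= S) ->
    `|green_mean q (rescale eps s) z - gr q z * \int[leb2]_y s y| <= K * eps * S].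
Proof.
move=> z0; have [K [e1 [K0 e10 H]]] := gr_local q0 z0.
exists (K * M * B), (e1 / (M + 1)); have M1 : 0 < M + 1 by rewrite ltr_wpDl.
split; [by rewrite !mulr_ge0// ltW|by rewrite divr_gt0|].
move=> eps s S e0 ee1 bs sS; rewrite (green_mean_rescale q0 z e0 bs.1).
have [ms _] := bs.1.
pose D (y : R * R) := \1_disc y * (gr q ((eps * y.1, eps * y.2) - z) - gr q z).
have mD : measurable_fun setT D.
  apply: measurable_funM => //; apply: measurable_funB => //.
  apply: (measurableT_comp (@measurable_gr R q)).
  have := measurable_linear2 eps 0 (- z.1) 0 eps (- z.2).
  by apply: eq_measurable_fun => y _; congr pair; rewrite /=; ring.
have DK y : `|D y| <= K * (eps * M).
  rewrite /D indicE; case: (boolP (y \in disc)) => yM; last first.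
    by rewrite mul0r normr0 !mulr_ge0// ltW.
  rewrite inE in yM; rewrite mul1r.
  have my : modulus (eps * y.1, eps * y.2) <= eps * M by rewrite modulus_scale ?(ltW e0)// ler_wpM2l// ltW.
  apply: (le_trans (H _ _)); last by rewrite ler_wpM2l// ltW.
  apply: (le_trans my); rewrite -[leRHS](divfK (lt0r_neq0 M1)).
  by apply: ler_pM => //; [exact: ltW|rewrite lerDl].
have bD : bmeas D by split => //; exists (K * (eps * M)).
have bDs := bsuppM bD bs.
have E (y : R * R) : gr q ((eps * y.1, eps * y.2) - z) * s y = D y * s y + gr q z * s y.
  rewrite /D; case: (leP (modulus y) M) => yM; first by rewrite indicE mem_set// mul1r -mulrDl subrK.
  have sy := bs.2 y yM; move: (gr q (_ - z)) (gr q z) (\1_disc y : R) => v1 v2 v3.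
  by rewrite sy; ring.
have -> : \int[leb2]_y (gr q ((eps * y.1, eps * y.2) - z) * s y) =
    \int[leb2]_y (D y * s y + gr q z * s y) by apply: eq_Rintegral => y _; exact: E.
rewrite (RintegralD measurableT (bsupp_integrable bDs) (bsupp_integrable (bsuppZ (gr q z) bs))).
rewrite (RintegralZl _ measurableT (bsupp_integrable bs)) addrK.
have DsS y : `|D y * s y| <= K * (eps * M) * S by rewrite normrM ler_pM.
apply: (le_trans (Rintegral_bsupp_le bDs DsS)).
by rewrite le_eqVlt; apply/orP; left; apply/eqP; rewrite /B; ring.
Qed.

#[local] Opaque killed_mean.

Section Perturbation.
Context {d : measure_display} {Omega : measurableType d}.
Variables (P : probability Omega R) (z : R * R) (W : R -> Omega -> R * R).
Hypothesis WB : is_brownian2 P z W.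
Hypothesis z0 : z != 0.

Lemma killed_mean_green (V h : R * R -> R) : bmeas V ->
  (occupation P z W V (kill q) (cst 1%E) < +oo)%E -> bmeas h ->
  killed_mean P z W V q h = green_mean q h z +
    killed_mean P z W V q (fun x => V x * green_mean q h x).
Proof.
move=> bV mass bh; have [mV [K VK]] := bV.
pose hp x := Num.max (h x) 0; pose hn x := Num.max (- h x) 0.
have bp : bmeas hp := bmeas_max0 bh.
have bn : bmeas hn := bmeas_max0 (bmeasN bh).
have hp0 x : 0 <= hp x by rewrite le_max lexx orbT.
have hn0 x : 0 <= hn x by rewrite le_max lexx orbT.
have D k : bmeas k -> (forall x, 0 <= k x) -> killed_mean P z W V q k = green_mean q k z +
    killed_mean P z W V q (fun x => V x * green_mean q k x).
  move=> bk k0; rewrite (km_duhamel WB mV VK q0 mass bk k0) (green_meanE q0 z bk k0) /=.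
  congr (_ + killed_mean P z W V q _); apply/funext => x.
  by rewrite (green_meanE q0 x bk k0).
have hE : h = (fun x => hp x - hn x).
  apply/funext => y; rewrite /hp /hn; have [v|v] := leP 0 (h y).
    by rewrite max_r ?subr0// oppr_le0.
  by rewrite max_l ?sub0r ?opprK// oppr_ge0 ltW.
have bVp := bmeasM bV (bmeas_green_mean q0 bp).
have bVn := bmeasM bV (bmeas_green_mean q0 bn).
rewrite hE (kmB WB mV VK mass bp bn) (D _ bp hp0) (D _ bn hn0) (green_meanB q0 z bp bn).
have -> : (fun x => V x * green_mean q (fun x => hp x - hn x) x) =
   (fun x => V x * green_mean q hp x - V x * green_mean q hn x).
  by apply/funext => x; rewrite (green_meanB q0 x bp bn) mulrBr.
by rewrite (kmB WB mV VK mass bVp bVn) opprD addrACA.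
Qed.

Variable g : R * R -> R.
Hypothesis bg : bmeas g.

Let V (eps T : R) (x : R * R) : R := coup T * rescale eps (U T) x.
Let bV eps T : bmeas (V eps T).
Proof. by apply: bmeasM; [exact: bmeas_cst|exact: bmeas_rescale (bU T).1]. Qed.

Variables (K e1 : R).
Hypotheses (K0 : 0 <= K) (e10 : 0 < e1).
Hypothesis nearK : forall eps s S, 0 < eps -> eps <= e1 -> bsupp s -> (forall y, `|s y| <= S) ->
    `|green_mean q (rescale eps s) z - gr q z * \int[leb2]_y s y| <= K * eps * S.

Let g0 := green_mean q g 0.
(** [ec] is what the ansatz [L + psi] leaves over, and [Mc] is the multiple of the ansatz for which
    it cancels [g0]. [K2] bounds the occupation of the absolute potential; [K3] and [K4] control the
    error at [z]. *)
Let ec := e + c + lambda.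
Let Mc := - g0 / ec.
Let K2 := pl * (gr q z * (CU * B) + K * CU).
Let K3 := `|Mc| * (pl * (K * (C + S1))).
Let K4 := `|Mc| * (gr q z * pi * (`|lambda| + IB + `|lambda| * IB)).

Lemma perturbation_bound eps T delta : ec != 0 -> 0 < eps -> eps <= 1 -> eps <= e1 ->
  ln eps^-1 * T = 1 -> 0 < T -> T <= 1 -> eps * k4 * CU * B <= 1 -> 0 <= ln eps^-1 + c ->
  T * Y <= 1 -> a + `|lambda| <= -2 ->
  (forall x, modulus x <= M -> `|green_mean q g (eps * x.1, eps * x.2) - g0| <= delta) ->
  (occupation P z W (V eps T) (kill q) (cst 1%E) < +oo)%E /\
  `|killed_mean P z W (V eps T) q g - (green_mean q g z + pi * Mc * gr q z)| <=
    (delta + `|Mc| * XB * T) * K2 + (K3 * eps + K4 * T).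
Proof.
move=> ec0 e0 e01 ee1 LT T0 T1 er Lc TY al Hd.
set L := ln eps^-1 in LT Lc *; have T0' := ltW T0.
have bVT := bV eps T; have [mV [KV VK]] := bVT.
have bVa := bmeas_abs bVT.
have Va0 x : 0 <= `|V eps T x| by [].
have en : eps != 0 by rewrite gt_eqF.
have Vsupp w : V eps T w != 0 -> exists2 x, modulus x <= M & w = (eps * x.1, eps * x.2).
  move=> Vw; exists (eps^-1 * w.1, eps^-1 * w.2).
    rewrite leNgt; apply/negP => Mx; move/eqP : Vw; apply.
    by rewrite /V /rescale ((bU T).2 _ Mx) !mulr0.
  by rewrite [LHS]surjective_pairing; congr pair; rewrite /= mulVKf.
have GVE x : green_op q (fun x => `|V eps T x|%:E) x =
    (green_mean q (fun x => `|V eps T x|) x)%:E by exact: (green_meanE q0 x bVa Va0).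
have small x : V eps T x != 0 -> (green_op q (fun x => `|V eps T x|%:E) x <= (1 - T)%:E)%E.
  move=> /Vsupp [y yM ->]; rewrite GVE lee_fin.
  exact: (small_le e0 LT T0 T1 yM er Lc TY al).
have th0 : 0 <= 1 - T by rewrite subr_ge0.
have th1 : 1 - T < 1 by rewrite gtrBl.
have mass : (occupation P z W (V eps T) (kill q) (cst 1%E) < +oo)%E.
  by apply: (occupation_kill_fin WB mV VK q0 th0 th1 small); rewrite GVE ltry.
split; first exact: mass.
have gz0 := gr_ge0 q z.
have CU0 : 0 <= CU := addr_ge0 C0 (mulr_ge0 pl0 C0).
(* As [z] is fixed and nonzero, this resolvent is of order [T], which compensates the factor
   [(1 - (1 - T))^-1] of the a priori bound. *)
have Gz : green_mean q (fun x => `|V eps T x|) z <= T * K2.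
  have -> : (fun x => `|V eps T x|) = (fun w => `|coup T| * rescale eps (fun y => `|U T y|) w).
    apply/funext => w; rewrite normrM /rescale; congr (_ * _).
    by rewrite normrM ger0_norm// invr_ge0 exprn_ge0// ltW.
  have bA := bsupp_abs (bU T).
  rewrite (green_meanZ q0 _ _ (bmeas_rescale eps bA.1)).
  have UB y : `| `|U T y| | <= CU by rewrite normr_id; exact: U_le.
  have H := le_trans (ler_norm _) (nearK e0 ee1 bA UB).
  have J := le_trans (ler_norm _) (Rintegral_bsupp_le bA UB).
  have h1 : gr q z * \int[leb2]_y `|U T y| <= gr q z * (CU * B) by rewrite ler_wpM2l.
  have h2 : K * eps * CU <= K * CU by rewrite mulrAC ler_piMr// mulr_ge0.
  have h3 : green_mean q (rescale eps (fun y => `|U T y|)) z <= gr q z * (CU * B) + K * CU.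
    by rewrite -lerBlDl (le_trans _ h2)// (le_trans _ H)// lerB.
  rewrite /K2 mulrA [T * pl]mulrC; apply: ler_pM => //; last exact: coup_le.
  apply: Rintegral_ge0 => y _; rewrite mulr_ge0 ?gr_ge0// /rescale mulr_ge0//.
  by rewrite invr_ge0 exprn_ge0// ltW.
have kV : killed_mean P z W (V eps T) q (fun x => `|V eps T x|) <= K2.
  have H := occupation_absV_le WB mV VK q0 th0 th1 small.
  have E : occupation P z W (V eps T) (kill q) (fun x => `|V eps T x|%:E) =
     (killed_mean P z W (V eps T) q (fun x => `|V eps T x|))%:E.
    exact: (km_occ WB mV VK mass bVa Va0).
  move: H; rewrite E GVE -EFinM lee_fin => /le_trans; apply.
  have -> : 1 - (1 - T) = T by ring.
  by rewrite ler_pdivrMl.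
pose k (w : R * R) := Mc * (L + psi (eps^-1 * w.1, eps^-1 * w.2)).
have bk : bmeas k.
  apply: bmeasM; first exact: bmeas_cst.
  by apply: bmeasD; [exact: bmeas_cst|exact: bmeas_scale bmeas_psi].
have bVk := bmeasM bVT bk.
pose sig y := U T y * (L + psi y).
have sE : sig = (fun y => L * f0 y + sg T y) by apply/funext => y; exact: sigmaE.
have bs : bsupp sig by rewrite sE; exact: bsuppD (bsuppZ L bf0) (bsg T).
have VkE w : green_mean q (fun x => V eps T x * k x) w =
    Mc * (coup T * green_mean q (rescale eps sig) w).
  have -> : (fun x => V eps T x * k x) = (fun x => (Mc * coup T) * rescale eps sig x).
    by apply/funext => x; rewrite /V /k /rescale /sig; ring.
  rewrite (green_meanZ q0 _ _ (bmeas_rescale eps bs.1)); exact/esym/mulrA.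
(* Duhamel's formula for [g + V * k]; the mean of [V * k] on the left is moved into the last
   bracket. *)
have id1 : killed_mean P z W (V eps T) q g = green_mean q g z +
    green_mean q (fun x => V eps T x * k x) z +
    killed_mean P z W (V eps T) q (fun x => V eps T x *
      (green_mean q g x + green_mean q (fun x => V eps T x * k x) x - k x)).
  have bh := bmeasD bg bVk.
  have := killed_mean_green bVT mass bh.
  rewrite (kmD WB mV VK mass bg bVk) (green_meanD q0 z bg bVk).
  have bgm := bmeas_green_mean q0 bg; have bgk := bmeas_green_mean q0 bVk.
  have -> : (fun x => V eps T x * (green_mean q g x + green_mean q (fun x => V eps T x * k x) x - k x)) =
     (fun x => V eps T x * green_mean q (fun x => g x + V eps T x * k x) x - V eps T x * k x).
    by apply/funext => x; rewrite (green_meanD q0 x bg bVk) mulrBr.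
  rewrite (kmB WB mV VK mass (bmeasM bVT (bmeas_green_mean q0 bh)) bVk).
  move=> H; rewrite addrA -H; ring.
have Mce : Mc * ec = - g0 by rewrite /Mc divfK.
pose eta := delta + `|Mc| * XB * T.
have bb : bmeas (fun x => V eps T x *
      (green_mean q g x + green_mean q (fun x => V eps T x * k x) x - k x)).
  apply: bmeasM => //; apply: bmeasB => //; apply: bmeasD; exact: bmeas_green_mean.
have bE w : `|V eps T w * (green_mean q g w + green_mean q (fun x => V eps T x * k x) w - k w)|
    <= eta * `|V eps T w|.
  have [->|Vw] := eqVneq (V eps T w) 0; first by rewrite mul0r normr0 mulr0.
  have [x xM wx] := Vsupp w Vw.
  rewrite normrM mulrC ler_wpM2r// VkE.
  have kw : k w = Mc * (L + psi x).
    by rewrite /k wx /= !mulKf// -surjective_pairing.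
  have br := bracket_le e0 e01 LT T0 T1 xM; rewrite -/L -wx -/sig -/ec in br.
  have gd := Hd x xM; rewrite -wx in gd.
  set A := coup T * _ in br *.
  (* Since [Mc * ec = - g0], the bracket splits into the oscillation of the resolvent of [g], at
     most [delta], and [Mc] times the defect estimated by [bracket_le]. *)
  have -> : green_mean q g w + Mc * A - k w =
     (green_mean q g w - g0) + Mc * (A - (L + psi x) - ec).
    by rewrite kw mulrBr Mce; ring.
  apply: (le_trans (ler_normD _ _)); apply: lerD; first exact: gd.
  rewrite normrM -(mulrA `|Mc|); apply: ler_wpM2l; first exact: normr_ge0.
  by rewrite (mulrC XB); exact: br.
have eta0 : 0 <= eta.
  have d0 : 0 <= delta by apply: le_trans (Hd 0 _); rewrite // /modulus/= expr0n/= addr0 sqrtr0.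
  rewrite addr_ge0// -mulrA mulr_ge0// mulrC.
  apply: le_trans (bracket_le (x := 0) e0 e01 LT T0 T1 _); first exact: normr_ge0.
  by rewrite /modulus/= expr0n/= addr0 sqrtr0.
have rest : `|killed_mean P z W (V eps T) q (fun x => V eps T x *
      (green_mean q g x + green_mean q (fun x => V eps T x * k x) x - k x))| <= eta * K2.
  have bev : bmeas (fun x => eta * `|V eps T x|) by apply: bmeasM => //; exact: bmeas_cst.
  apply: (le_trans (km_norm_le WB mV VK mass bb bev bE)).
  by rewrite (kmZ WB mV VK mass eta bVa) ler_wpM2l.
have sB y : `|sig y| <= L * C + S1.
  have L0 : 0 <= L by rewrite -(pmulr_lge0 _ T0) LT.
  rewrite sE (le_trans (ler_normD _ _))// lerD//; last by apply: sg_le.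
  by rewrite normrM (ger0_norm L0) ler_wpM2l.
have zH := nearK e0 ee1 bs sB.
have sI : \int[leb2]_y sig y = L + \int[leb2]_y sg T y.
  rewrite sE (RintegralD measurableT (bsupp_integrable (bsuppZ L bf0)) (bsupp_integrable (bsg T))).
  by rewrite (RintegralZl _ measurableT (bsupp_integrable bf0)) f01 mulr1.
set I := \int[leb2]_y sg T y in sI.
have Ie : `|I - e| <= T * R1 by exact: sg_int.
have IIB : `|I| <= IB.
  rewrite -[I](subrK e) (le_trans (ler_normD _ _))// /IB addrC lerD2l.
  by rewrite (le_trans Ie)// ler_piMl.
rewrite sI in zH; set gz := green_mean q (rescale eps sig) z in zH.
(* [sig] has total mass [L + I] and acts like a point mass at 0, so [coup T * gz] is [pi * gr q z]
   up to errors of order [T] and [eps]. *)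
have main : `|Mc * (coup T * gz) - pi * Mc * gr q z| <= K3 * eps + K4 * T.
  have -> : Mc * (coup T * gz) - pi * Mc * gr q z =
     Mc * (coup T * (gz - gr q z * (L + I))) +
     Mc * (gr q z * pi * (T * (lambda + I + lambda * T * I))).
    have -> : coup T * (gz - gr q z * (L + I)) = coup T * gz -
       gr q z * pi * ((L * T) + lambda * T * (L * T) + T * I + lambda * T ^+ 2 * I).
      by rewrite /coup; ring.
    by rewrite LT; ring.
  rewrite (le_trans (ler_normD _ _))// lerD//.
    rewrite normrM /K3 -mulrA ler_wpM2l// normrM.
    apply: (@le_trans _ _ (pl * T * (K * eps * (L * C + S1)))).
      by rewrite ler_pM// coup_le.
    have -> : pl * T * (K * eps * (L * C + S1)) = pl * (K * ((L * T) * C + T * S1)) * eps by ring.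
    rewrite LT mul1r ler_wpM2r ?(ltW e0)// ler_wpM2l// ler_wpM2l// lerD2l.
    exact: ler_piMl.
  have X0 : 0 <= gr q z * pi := mulr_ge0 gz0 (pi_ge0 R).
  have hw : `|T * (lambda + I + lambda * T * I)| <= (`|lambda| + IB + `|lambda| * IB) * T.
    rewrite normrM (ger0_norm T0') mulrC; apply: ler_wpM2r => //.
    apply: (le_trans (ler_normD _ _)); apply: lerD.
      by apply: (le_trans (ler_normD _ _)); apply: lerD.
    rewrite -mulrA normrM; apply: ler_wpM2l; first exact: normr_ge0.
    by rewrite normrM (ger0_norm T0') (le_trans _ IIB)// ler_piMl.
  have -> : K4 * T = `|Mc| * ((gr q z * pi) * ((`|lambda| + IB + `|lambda| * IB) * T)).
    by rewrite /K4 -!mulrA.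
  rewrite normrM; apply: ler_wpM2l; first exact: normr_ge0.
  by rewrite normrM (ger0_norm X0); apply: ler_wpM2l.
rewrite id1 VkE -/gz -/eta.
have -> : green_mean q g z + Mc * (coup T * gz) +
   killed_mean P z W (V eps T) q (fun x => V eps T x *
      (green_mean q g x + green_mean q (fun x => V eps T x * k x) x - k x)) -
   (green_mean q g z + pi * Mc * gr q z) =
   killed_mean P z W (V eps T) q (fun x => V eps T x *
      (green_mean q g x + green_mean q (fun x => V eps T x * k x) x - k x)) +
   (Mc * (coup T * gz) - pi * Mc * gr q z) by ring.
by rewrite (le_trans (ler_normD _ _))// lerD.
Qed.
End Perturbation.

Let mul_small (x Z A : R) : 0 <= x -> 0 <= A -> x <= A / (`|Z| + 1) -> x * Z <= A.
Proof.
move=> x0 A0 xA; have Z1 : 0 < `|Z| + 1 by rewrite ltr_wpDl.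
apply: (@le_trans _ _ (x * (`|Z| + 1))).
  by rewrite ler_wpM2l// (le_trans (ler_norm _))// lerDl.
by rewrite -ler_pdivlMr.
Qed.

Lemma near_inv_log (tau : R) : 0 < tau -> \forall eps \near (0 : R)^'+,
  [/\ ln eps^-1 * (ln eps^-1)^-1 = 1, 0 < (ln eps^-1)^-1 & (ln eps^-1)^-1 <= tau].
Proof.
move=> tau0; near=> eps.
have e0 : 0 < eps by near: eps; exact: nbhs_right_gt.
have ee : eps < expR (- tau^-1) by near: eps; apply: nbhs_right_lt; exact: expR_gt0.
have L : tau^-1 < ln eps^-1.
  rewrite lnV ?posrE// ltrNr -(expRK (- tau^-1)) ltr_ln ?posrE//; exact: expR_gt0.
have L0 : 0 < ln eps^-1 by apply: lt_trans L; rewrite invr_gt0.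
split; [by rewrite divff// gt_eqF|by rewrite invr_gt0|].
by rewrite -[leRHS]invrK lef_pV2 ?posrE ?invr_gt0// ltW.
Unshelve. all: by end_near. Qed.

Lemma couplingE eps : coupling lambda eps = pi * ((ln eps^-1)^-1 + lambda * (ln eps^-1)^-1 ^+ 2).
Proof. by rewrite /coupling exprVn; ring. Qed.

Lemma killed_limit (d : measure_display) (Omega : measurableType d)
  (P : probability Omega R) (z : R * R) (W : R -> Omega -> R * R) (g : R * R -> R) :
  is_brownian2 P z W -> z != 0 -> bmeas g ->
  energy_const + log_const q + lambda != 0 ->
  log_const q + pl * (C * B) + log_bound * (C + pl * C) * B + 1 + `|lambda| <= -2 ->
  let V eps := fun x => coupling lambda eps *
    rescale eps (fun x => f0 x + coupling lambda eps * f1 x) x in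
  (\forall eps \near (0 : R)^'+,
    (occupation P z W (V eps) (kill q) (cst 1%E) < +oo)%E) /\
  killed_mean P z W (V eps) q g @[eps --> 0^'+] -->
   green_mean q g z + pi * (- green_mean q g 0 / (energy_const + log_const q + lambda)) * gr q z.
Proof.
move=> WB z0 bg ec0 al V.
have [K [e1 [K0 e10 nearK]]] := near_point z0.
set Mc := - green_mean q g 0 / _.
pose K2 := pl * (gr q z * (CU * B) + K * CU).
pose K3 := `|Mc| * (pl * (K * (C + S1))).
pose K4 := `|Mc| * (gr q z * pi * (`|lambda| + IB + `|lambda| * IB)).
have K20 : 0 <= K2.
  have CU0 : 0 <= CU := addr_ge0 C0 (mulr_ge0 pl0 C0).
  exact: (mulr_ge0 pl0 (addr_ge0 (mulr_ge0 (gr_ge0 q z) (mulr_ge0 CU0 B0)) (mulr_ge0 K0 CU0))).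
have key (tol : R) : 0 < tol -> \forall eps \near (0 : R)^'+,
    (occupation P z W (V eps) (kill q) (cst 1%E) < +oo)%E /\
    `|killed_mean P z W (V eps) q g - (green_mean q g z + pi * Mc * gr q z)| <= tol.
  (* A quarter of the tolerance for each of the four error terms of [perturbation_bound]; [delta] is
     fixed first, and its continuity radius then constrains [eps]. *)
  move=> tol0; have tol4 : 0 < tol / 4 by rewrite divr_gt0.
  have pos1 (u : R) : 0 < `|u| + 1 by rewrite ltr_wpDl.
  pose delta := tol / 4 / (`|K2| + 1).
  have delta0 : 0 < delta by rewrite divr_gt0.
  have [r r0 Hr] := green_mean_continuous0 q0 bg delta0.
  have nT (u v : R) : 0 < v -> \forall eps \near (0 : R)^'+, (ln eps^-1)^-1 <= v / (`|u| + 1).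
    move=> v0; have h : 0 < v / (`|u| + 1) by rewrite divr_gt0.
    by have := near_inv_log h; apply: filterS => ? [].
  near=> eps.
  have e0 : 0 < eps by near: eps; exact: nbhs_right_gt.
  have le1 : eps <= 1 by near: eps; exact: nbhs_right_ltW.
  have lee1 : eps <= e1 by near: eps; exact: nbhs_right_ltW.
  have T1 : [/\ ln eps^-1 * (ln eps^-1)^-1 = 1, 0 < (ln eps^-1)^-1 & (ln eps^-1)^-1 <= 1] by near: eps; exact: near_inv_log.
  have Tc : (ln eps^-1)^-1 <= 1 / (`|c| + 1).
    by near: eps; exact: nT.
  have TY : (ln eps^-1)^-1 <= 1 / (`|Y| + 1).
    by near: eps; exact: nT.
  have TX : (ln eps^-1)^-1 <= tol / 4 / (`| `|Mc| * XB * K2| + 1).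
    by near: eps; exact: nT.
  have TK4 : (ln eps^-1)^-1 <= tol / 4 / (`|K4| + 1).
    by near: eps; exact: nT.
  have eK3 : eps <= tol / 4 / (`|K3| + 1).
    by near: eps; apply: nbhs_right_ltW; rewrite divr_gt0.
  have er : eps <= 1 / (`|k4 * CU * B| + 1).
    by near: eps; apply: nbhs_right_ltW; rewrite divr_gt0.
  have eM : eps <= r / (`|M| + 1).
    by near: eps; apply: nbhs_right_ltW; rewrite divr_gt0.
  set T := (ln eps^-1)^-1 in T1 Tc TY TX TK4.
  have [LT T0 T11] := T1; have T0' := ltW T0; have e0' := ltW e0.
  have er' : eps * k4 * CU * B <= 1 by rewrite -2!(mulrA eps); exact: mul_small.
  have TY' : T * Y <= 1 by exact: mul_small.
  have Lc : 0 <= ln eps^-1 + c.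
    have h : `|c| + 1 <= ln eps^-1.
      have h0 : T * (`|c| + 1) <= 1 by rewrite -ler_pdivlMr.
      by rewrite -(ler_pM2r T0) LT mulrC.
    have := ler_norm (- c); rewrite normrN => h2.
    by rewrite -lerBlDr sub0r (le_trans h2)// (le_trans _ h)// lerDl.
  have Hd x : modulus x <= M -> `|green_mean q g (eps * x.1, eps * x.2) - green_mean q g 0| <= delta.
    move=> xM; apply: Hr; rewrite modulus_scale//.
    by apply: (@le_trans _ _ (eps * M)); [rewrite ler_wpM2l|apply: mul_small => //; exact: ltW].
  have H := perturbation_bound WB bg K0 nearK ec0 e0 le1 lee1 LT T0 T11 er' Lc TY' al Hd.
  have VE : V eps = (fun x => coup T * rescale eps (U T) x).
    by apply/funext => x; rewrite /V couplingE.
  rewrite VE; have [mass bound] := H; split; first exact: mass.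
  apply: (le_trans bound).
  have h1 : delta * K2 <= tol / 4 by apply: mul_small; [exact: ltW|exact: ltW|exact: lexx].
  have h2 : T * (`|Mc| * XB * K2) <= tol / 4 by apply: mul_small => //; exact: ltW.
  have h3 : eps * K3 <= tol / 4 by apply: mul_small => //; exact: ltW.
  have h4 : T * K4 <= tol / 4 by apply: mul_small => //; exact: ltW.
  apply: (@le_trans _ _ (delta * K2 + T * (`|Mc| * XB * K2) + (eps * K3 + T * K4))).
    by rewrite le_eqVlt; apply/orP; left; apply/eqP; rewrite /K2 /K3 /K4; ring.
  move: h1 h2 h3 h4; move: (delta * K2) (T * (_ * K2)) (eps * K3) (T * K4) => u1' u2 u3 u4; lra.
split; first by have := key 1 ltr01; apply: filterS => eps [].
apply/cvgrPdist_le => tol tol0; have := key tol tol0; apply: filterS => eps [_].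
by rewrite distrC.
Unshelve. all: by end_near. Qed.
End FixedRate.

Lemma log_constE q : 0 < q -> log_const q = - euler_mascheroni R - ln (q / 2) / 2.
Proof.
move=> q0; rewrite /log_const; congr (_ - _).
have k0 := kap_gt0 q0.
have -> : q / 2 = kap q ^+ 2 by rewrite /kap sqr_sqrtr// divr_ge0// ltW.
by rewrite lnXn// mulr2n; field.
Qed.

Lemma core_limit (beta : R) : 0 < beta ->
  ln beta / 2 = energy_const + ln 2 / 2 + lambda - euler_mascheroni R ->
  exists qm : R, forall q, beta < q -> qm < q ->
  forall (d : measure_display) (Omega : measurableType d)
  (P : probability Omega R) (z : R * R) (W : R -> Omega -> R * R) (g : R * R -> R),
  is_brownian2 P z W -> z != 0 -> bmeas g ->
  let V eps := fun x => coupling lambda eps *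
    rescale eps (fun x => f0 x + coupling lambda eps * f1 x) x in
  (\forall eps \near (0 : R)^'+,
    (occupation P z W (V eps) (kill q) (cst 1%E) < +oo)%E) /\
  killed_mean P z W (V eps) q g @[eps --> 0^'+] -->
   green_mean q g z + 2 * pi / ln (q / beta) * gr q z * green_mean q g 0.
Proof.
move=> beta0 betaE.
(* The size condition of [killed_limit] solved for [ln (q / 2)], through [log_constE]. It involves
   only the profiles and [lambda], so the threshold is chosen before the starting point and [g]. *)
pose h := 2 * (pl * (C * B) + log_bound * (C + pl * C) * B + 3 + `|lambda| - euler_mascheroni R).
exists (2 * expR h) => q bq hq d Omega P z W g WB z0 bg V.
have q0 : 0 < q by exact: lt_trans bq.
have q20 : 0 < q / 2 by rewrite divr_gt0.
have lq : h < ln (q / 2).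
  by rewrite -[h]expRK ltr_ln ?posrE ?expR_gt0// ltr_pdivlMr// mulrC.
have qb : 1 < q / beta by rewrite ltr_pdivlMr// mul1r.
have lqb : 0 < ln (q / beta) by rewrite ln_gt0.
(* The definition of [beta] enters here: it is the rate at which the constant left over by the
   ansatz would vanish. *)
have ecE : energy_const + log_const q + lambda = - (ln (q / beta) / 2).
  rewrite log_constE// ln_div ?posrE// ln_div ?posrE//.
  by move: betaE; move: (ln q) (ln beta) (ln 2) energy_const => u v w e'; lra.
have ec0 : energy_const + log_const q + lambda != 0.
  by rewrite ecE oppr_eq0 gt_eqF// divr_gt0.
have al : log_const q + pl * (C * B) + log_bound * (C + pl * C) * B + 1 + `|lambda| <= -2.
  rewrite log_constE//; move: lq; rewrite /h.
  move: (ln _) (pl * _) (log_bound * _ * B) (`|lambda|) (euler_mascheroni R) => u v w x y; lra.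
have [H1 H2] := killed_limit q0 WB z0 bg ec0 al; split; first exact: H1.
have -> : 2 * pi / ln (q / beta) * gr q z * green_mean q g 0 =
   pi * (- green_mean q g 0 / (energy_const + log_const q + lambda)) * gr q z; last exact: H2.
by rewrite ecE; field; rewrite gt_eqF.
Qed.
End Core.
End Potential.

Opaque gr green.

(** * Radial averages *)

Section RadialAverage.
Context {R : realType}.
Local Notation mu := (@lebesgue_measure R).
Local Notation leb := (@leb2_sfm R).
Local Notation circle := (`[- pi, pi]%classic : set R).

Lemma polar_rot (r al th : R) : polar r (al + th) = rot (cos th) (sin th) (polar r al).
Proof. by rewrite /polar /rot cosD sinD; congr pair; rewrite /=; ring. Qed.

Lemma modulus_polar (r th : R) : 0 <= r -> modulus (polar r th) = r.
Proof.
move=> r0; rewrite /modulus /polar/= !exprMn -mulrDr cos2Dsin2 mulr1 sqrtr_sqr.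
exact: ger0_norm.
Qed.

Lemma polar_exists (z : R * R) : exists2 al : R, 0 <= al <= 2 * pi & z = polar (modulus z) al.
Proof.
have [->|z0] := eqVneq z 0.
  exists 0; first by rewrite lexx mulr_ge0// pi_ge0.
  by rewrite /polar /modulus/= expr0n/= addr0 sqrtr0 !mul0r.
have r0 := modulus_gt0 z0; set r := modulus z in r0 *; pose x := z.1 / r.
have rn : r != 0 by rewrite gt_eqF.
have x1 : -1 <= x <= 1.
  by rewrite -ler_norml normrM normfV (gtr0_norm r0) ler_pdivrMr// mul1r normr1_le_modulus.
have cx : cos (acos x) = x by rewrite acosK.
have sx : sin (acos x) = `|z.2| / r.
  rewrite sin_acos//; have -> : 1 - x ^+ 2 = (z.2 / r) ^+ 2.
    rewrite /x !exprMn exprVn -[1](@divff _ (r ^+ 2)) ?expf_neq0// -mulrBl; congr (_ / _).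
    by rewrite /r modulus_sqr; ring.
  by rewrite sqrtr_sqr normrM normfV (gtr0_norm r0).
have a0 := acos_ge0 x1; have api := acos_lepi x1; have p0 := pi_ge0 R.
case: (leP 0 z.2) => z2.
  exists (acos x); first by apply/andP; split => //; lra.
  by rewrite [LHS]surjective_pairing /polar cx sx ger0_norm// /x !(mulrCA r) !divff// !mulr1.
exists (2 * pi - acos x); first by apply/andP; split; lra.
have cE : cos (2 * pi - acos x) = x by rewrite cosB mulr_natl cos2pi sin2pi mul1r mul0r addr0 cx.
have sE : sin (2 * pi - acos x) = z.2 / r.
  by rewrite sinB mulr_natl cos2pi sin2pi mul0r mul1r sub0r sx ltr0_norm// mulNr opprK.
by rewrite [LHS]surjective_pairing /polar cE sE /x !(mulrCA r) !divff// !mulr1.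
Qed.

(** The part of the shifted circle beyond [pi] is moved back by one period. With [al] within one
    period, a single cut suffices. *)
Lemma ge0_periodic_shift (h : R -> \bar R) (al : R) : measurable_fun setT h ->
  (forall u, (0 <= h u)%E) -> (forall u, h (u + 2 * pi) = h u) -> 0 <= al <= 2 * pi ->
  (\int[mu]_(t in circle) h (al + t)%R = \int[mu]_(t in circle) h t)%E.
Proof.
move=> mh h0 per /andP[al0 al2]; have p0 := pi_gt0 R.
have shift (b x y : R) : (\int[mu]_(t in `]x, y]) h (t + b)%R = \int[mu]_(t in `](x + b)%R, (y + b)%R]) h t)%E.
  have mg : measurable_fun setT (h \_ `](x + b)%R, (y + b)%R]).
    by apply/(measurable_restrictT _ _).1 => //; exact: measurable_funTS.
  rewrite [RHS]integral_mkcond -(ge0_integral_shift b mg); last first.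
    by move=> u; rewrite patchE; case: ifP.
  rewrite integral_mkcond; apply: eq_integral => t _; rewrite !patchE.
  have -> : (t \in `]x, y]%classic) = ((t + b) \in `](x + b)%R, (y + b)%R]%classic).
    by apply/idP/idP; rewrite !inE/= !in_itv/= ltrD2r lerD2r.
  by [].
have oc (f : R -> \bar R) (x y : R) : measurable_fun setT f ->
    (\int[mu]_(t in `[x, y]) f t = \int[mu]_(t in `]x, y]) f t)%E.
  by move=> mf; rewrite integral_itv_obnd_cbnd//; exact: measurable_funTS.
have split_at (x y w : R) : x <= y -> y <= w ->
    (\int[mu]_(t in `]x, w]) h t = \int[mu]_(t in `]x, y]) h t + \int[mu]_(t in `]y, w]) h t)%E.
  move=> xy yw.
  have -> : `]x, w]%classic = `]x, y] `|` `]y, w] :> set R.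
    apply/seteqP; split => t /=; rewrite !in_itv/=.
      by move=> /andP[xt tw]; case: (leP t y) => ty; [left; rewrite xt|right].
    move=> [/andP[-> ty]|/andP[yt ->]]; first by rewrite (le_trans ty).
    by rewrite (le_lt_trans xy).
  rewrite ge0_integral_setU//; first exact: measurable_funTS.
  rewrite disj_set2E; apply/eqP/seteqP; split => t //= []; rewrite /= !in_itv/=.
  by move=> /andP[_ ty] /andP[/(le_lt_trans ty)]; rewrite ltxx.
have ms : measurable_fun setT (fun t : R => h (al + t)).
  apply: (measurableT_comp mh).
  by apply: measurable_funD.
rewrite (oc _ _ _ ms) (oc _ _ _ mh).
transitivity (\int[mu]_(t in `](- pi)%R, pi]) h (t + al)%R)%E.
  by apply: eq_integral => t _; rewrite (addrC al (t : R)).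
rewrite shift (split_at (- pi + al) pi (pi + al)); [|lra|lra].
rewrite [RHS](split_at (- pi) (- pi + al) pi); [|lra|lra].
rewrite addeC; congr (_ + _)%E.
have -> : (\int[mu]_(t in `](- pi)%R, (- pi + al)%R]) h t =
    \int[mu]_(t in `](- pi)%R, (- pi + al)%R]) h (t + 2 * pi)%R)%E.
  by apply: eq_integral => t _; rewrite (per (t : R)).
rewrite shift; have -> : - pi + 2 * pi = pi :> R by ring.
by have -> : - pi + al + 2 * pi = pi + al by ring.
Qed.

Let mpolar : measurable_fun setT (fun p : (R * R) * R => polar (modulus p.1) p.2).
Proof.
have m1 : measurable_fun setT (fun p : (R * R) * R => modulus p.1).
  exact: measurableT_comp (@measurable_modulus R) measurable_fst.
have mc : measurable_fun setT (fun p : (R * R) * R => cos p.2).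
  apply: measurableT_comp; last exact: measurable_snd.
  exact: continuous_measurable_fun (@continuous_cos R).
have ms : measurable_fun setT (fun p : (R * R) * R => sin p.2).
  apply: measurableT_comp; last exact: measurable_snd.
  exact: continuous_measurable_fun (@continuous_sin R).
by apply: measurable_fun_pair; exact: measurable_funM.
Qed.

Let mrot2 : measurable_fun setT (fun p : (R * R) * R => rot (cos p.2) (sin p.2) p.1).
Proof.
have m1 : measurable_fun setT (fun p : (R * R) * R => p.1.1).
  exact: measurableT_comp measurable_fst measurable_fst.
have m2 : measurable_fun setT (fun p : (R * R) * R => p.1.2).
  exact: measurableT_comp measurable_snd measurable_fst.
have mc : measurable_fun setT (fun p : (R * R) * R => cos p.2).
  apply: measurableT_comp; last exact: measurable_snd.
  exact: continuous_measurable_fun (@continuous_cos R).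
have ms : measurable_fun setT (fun p : (R * R) * R => sin p.2).
  apply: measurableT_comp; last exact: measurable_snd.
  exact: continuous_measurable_fun (@continuous_sin R).
apply: measurable_fun_pair.
  by apply: measurable_funB; exact: measurable_funM.
by apply: measurable_funD; exact: measurable_funM.
Qed.

Lemma circle_measure : mu circle = (2 * pi)%:E.
Proof.
rewrite lebesgue_measure_itv/= lte_fin; have p0 := pi_gt0 R.
by rewrite ifT; [rewrite -EFinB; congr EFin; ring|lra].
Qed.

Lemma integrable_circle (k : R -> R) (C : R) : measurable_fun setT k -> (forall t, `|k t| <= C) ->
  mu.-integrable circle (EFin \o k).
Proof.
move=> mk kC; apply: integrable_le_cst.
- exact: measurable_itv.
- by rewrite [X in (X < _)%E]circle_measure ltry.
- exact: measurable_funTS.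
- by move=> t _; exact: kC.
Qed.

Lemma measurable_on_circle (z : R * R) (f : R * R -> R) : measurable_fun setT f ->
  measurable_fun setT (fun t : R => f (polar (modulus z) t)).
Proof. by move=> mf; exact: (measurableT_comp mf (measurableT_comp mpolar (pair1_measurable z))). Qed.

Lemma radial_avg_le (f : R * R -> R) (C : R) z : measurable_fun setT f ->
  (forall x, `|f x| <= C) -> `|radial_avg f z| <= C.
Proof.
move=> mf fC; have p0 := pi_gt0 R.
have mk : measurable_fun setT (fun t : R => f (polar (modulus z) t)).
  exact: (measurableT_comp mf (measurableT_comp mpolar (pair1_measurable z))).
have C0 := le_trans (normr_ge0 _) (fC 0).
have p20 : 0 < 2 * pi :> R by rewrite mulr_gt0.
rewrite /radial_avg normrM (ger0_norm (ltW _)) ?invr_gt0// ler_pdivrMl// mulrC.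
have ik := integrable_circle mk (fun t => fC _).
have ic : mu.-integrable circle (EFin \o (fun=> C)) by apply: (@integrable_circle _ C) => // t; rewrite ger0_norm.
apply: le_trans; first by apply: le_normr_Rintegral; [exact: measurable_itv|exact: ik].
apply: (@le_trans _ _ (\int[mu]_(t in circle) C)).
  apply: le_Rintegral; [exact: measurable_itv|exact: (integrable_norm ik)|exact: ic|].
  by move=> t _; exact: fC.
by rewrite Rintegral_cst//= circle_measure.
Qed.

Lemma measurable_radial_avg (f : R * R -> R) : measurable_fun setT f ->
  measurable_fun setT (radial_avg f).
Proof.
move=> mf; apply: measurable_funM => //.
exact: (measurable_Rintegral mu (E := circle) (measurable_itv _) (measurableT_comp mf mpolar)).
Qed.

Variable M : R.
Local Notation bsuppM := (@bsupp R M).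

Lemma bsupp_radial_avg (f : R * R -> R) : bsuppM f -> bsuppM (radial_avg f).
Proof.
move=> [[mf [C fC]] f0]; split.
  split; first exact: measurable_radial_avg.
  by exists C => x; exact: radial_avg_le.
move=> x Mx; rewrite /radial_avg.
have E (t : R) : f (polar (modulus x) t) = 0.
  by apply: f0; rewrite modulus_polar ?modulus_ge0.
have -> : \int[mu]_(t in circle) f (polar (modulus x) t) = \int[mu]_(t in circle) 0.
  by apply: eq_Rintegral => t _; exact: E.
by rewrite Rintegral_cst//= mul0r mulr0.
Qed.

Lemma radial_avg_ge0 (f : R * R -> R) (z : R * R) : (forall x, 0 <= f x) -> 0 <= radial_avg f z.
Proof.
move=> f0; rewrite mulr_ge0//; first by rewrite invr_ge0 mulr_ge0// pi_ge0.
by apply: Rintegral_ge0 => t _; exact: f0.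
Qed.

Lemma radial_avgB (f g : R * R -> R) (z : R * R) : bmeas f -> bmeas g ->
  radial_avg (fun x => f x - g x) z = radial_avg f z - radial_avg g z.
Proof.
move=> [mf [C fC]] [mg [D gD]]; rewrite /radial_avg -mulrBr; congr (_ * _).
have mk := measurable_on_circle z.
have iF := integrable_circle (mk _ mf) (fun t => fC _).
have iG := integrable_circle (mk _ mg) (fun t => gD _).
by rewrite -RintegralB; [by []|exact: measurable_itv|exact: iF|exact: iG].
Qed.

(** Rotating a point by all angles runs through its circle, and its own angle drops out by
    periodicity, so the radial average is an average of [f] over rotations. Tonelli's theorem brings
    the plane integral inside, where rotation invariance applies. *)
Lemma ge0_Rintegral_radial_avg (f : R * R -> R) : bsuppM f -> (forall x, 0 <= f x) ->
  \int[leb2]_z radial_avg f z = \int[leb2]_z f z.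
Proof.
move=> bf f0; have [[mf [C fC]] _] := bf; have p0 := pi_gt0 R.
have p20 : 0 < 2 * pi :> R by rewrite mulr_gt0.
have mfE : measurable_fun setT (fun x => (f x)%:E) by apply/measurable_EFinP.
have f0E x : (0 <= (f x)%:E)%E by rewrite lee_fin.
rewrite /Rintegral; congr fine.
have mF : measurable_fun setT (fun p : (R * R) * R => (f (rot (cos p.2) (sin p.2) p.1))%:E).
  exact: (measurableT_comp mfE mrot2).
have mI : measurable_fun setT (fun z : R * R => (\int[mu]_(t in circle) (f (rot (cos t) (sin t) z))%:E)%E).
  exact: (measurable_ge0_integral mu (E := circle) (measurable_itv _) mF (fun _ => f0E _)).
have i0 (z : R * R) : (0 <= \int[mu]_(t in circle) (f (rot (cos t) (sin t) z))%:E)%E.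
  by apply: integral_ge0 => t _; exact: f0E.
have avgE (z : R * R) : ((radial_avg f z)%:E =
   ((2 * pi)^-1)%:E * \int[mu]_(t in circle) (f (rot (cos t) (sin t) z))%:E)%E.
  have [al al1 zE] := polar_exists z.
  have mk : measurable_fun setT (fun t : R => (f (polar (modulus z) t))%:E).
    exact: (measurableT_comp mfE (measurableT_comp mpolar (pair1_measurable z))).
  have per (u : R) : (f (polar (modulus z) (u + 2 * pi)))%:E = (f (polar (modulus z) u))%:E.
    by rewrite /polar mulr_natl cosD sinD cos2pi sin2pi !mulr1 !mulr0 subr0 addr0.
  have := ge0_periodic_shift mk (fun _ => f0E _) per al1 => sh.
  have mk' : measurable_fun setT (fun t : R => f (polar (modulus z) t)).
    exact: (measurableT_comp mf (measurableT_comp mpolar (pair1_measurable z))).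
  rewrite /radial_avg EFinM /Rintegral fineK; last first.
    have ik := integrable_circle mk' (fun t => fC _).
  by apply: integrable_fin_num; [exact: measurable_itv|exact: ik].
  congr (_ * _)%E; rewrite -sh; apply: eq_integral => t _.
  by rewrite polar_rot -zE.
transitivity (\int[leb]_z (((2 * pi)^-1)%:E * \int[mu]_(t in circle) (f (rot (cos t) (sin t) z))%:E))%E.
  by apply: eq_integral => z _; exact: avgE.
have k0 : (0 <= ((2 * pi)^-1)%:E :> \bar R)%E by rewrite lee_fin invr_ge0 ltW.
rewrite (ge0_integralZl leb measurableT mI (fun z _ => i0 z) k0).
rewrite (@ge0_fubini_domain _ _ _ _ _ leb mu setT circle
  (fun p => (f (rot (cos p.2) (sin p.2) p.1))%:E) measurableT (measurable_itv _) mF (fun _ => f0E _)).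
have [I IE] : exists I, I = (\int[leb2]_z (f z)%:E)%E by eexists.
have rE (t : R) : (\int[leb]_z (f (rot (cos t) (sin t) z))%:E = I)%E.
  by rewrite IE; exact: (ge0_leb2_rot (cos2Dsin2 t) mfE f0E).
apply: (etrans _ IE); transitivity (((2 * pi)^-1)%:E * \int[mu]_(t in circle) cst I t)%E.
  apply: (f_equal (fun u => ((2 * pi)^-1)%:E * u)%E).
  by apply: eq_integral => t _; exact: (rE t).
rewrite integral_cst//= [X in (_ * (_ * X))%E]circle_measure muleCA -EFinM mulVf ?mule1//.
by rewrite gt_eqF.
Qed.

Lemma Rintegral_radial_avg (f : R * R -> R) : bsuppM f ->
  \int[leb2]_z radial_avg f z = \int[leb2]_z f z.
Proof.
move=> bf; pose fp x := Num.max (f x) 0; pose fn x := Num.max (- f x) 0.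
have bp : bsuppM fp.
  by split; [exact: bmeas_max0 bf.1|move=> x /bf.2; rewrite /fp => ->; rewrite maxxx].
have bn : bsuppM fn.
  by split; [exact: bmeas_max0 (bmeasN bf.1)|move=> x /bf.2; rewrite /fn => ->; rewrite oppr0 maxxx].
have fp0 x : 0 <= fp x by rewrite le_max lexx orbT.
have fn0 x : 0 <= fn x by rewrite le_max lexx orbT.
have fE : f = (fun x => fp x - fn x).
  apply/funext => y; rewrite /fp /fn; have [v|v] := leP 0 (f y).
    by rewrite max_r ?subr0// oppr_le0.
  by rewrite max_l ?sub0r ?opprK// oppr_ge0 ltW.
have -> : radial_avg f = (fun z => radial_avg fp z - radial_avg fn z).
  by apply/funext => z; rewrite -(radial_avgB z bp.1 bn.1) -fE.
rewrite (RintegralB measurableT (bsupp_integrable (bsupp_radial_avg bp)) (bsupp_integrable (bsupp_radial_avg bn))).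
rewrite (ge0_Rintegral_radial_avg bp fp0) (ge0_Rintegral_radial_avg bn fn0).
rewrite -(RintegralB measurableT (bsupp_integrable bp) (bsupp_integrable bn)).
by congr (Rintegral _ _ _); rewrite -fE.
Qed.

End RadialAverage.

(** * Energy of a profile, of its radial average and of the corrector *)

Section EnergySplit.
Context {R : realType}.
Variable M : R.
Local Notation mu := (@lebesgue_measure R).
Local Notation leb := (@leb2_sfm R).
Local Notation circle := (`[- pi, pi]%classic : set R).
Local Notation bsuppM := (@bsupp R M).

Lemma logpot_rot (c s : R) (f : R * R -> R) (x : R * R) : c ^+ 2 + s ^+ 2 = 1 ->
  measurable_fun setT f -> (forall y, f (rot c s y) = f y) ->
  logpot f (rot c s x) = logpot f x.
Proof.
move=> cs mf fr.
have mk : measurable_fun setT (fun y : R * R => - ln (modulus (rot c s x - y)) * f y).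
  apply: measurable_funM => //; apply: measurableT_comp => //.
  exact: (measurableT_comp (@measurable_ln_modulus R) (pair1_measurable (rot c s x))).
transitivity (\int[leb2]_y (- ln (modulus (rot c s x - rot c s y)) * f (rot c s y))).
  by symmetry; exact: (Rintegral_leb2_rot cs mk).
apply: eq_Rintegral => y _; rewrite fr; congr (- ln _ * _).
rewrite -(modulus_rot (x - y) cs); congr modulus.
by rewrite /rot; congr pair; rewrite /=; ring.
Qed.

Lemma logpot_radial_polar (f : R * R -> R) (z : R * R) (t : R) : measurable_fun setT f ->
  logpot (radial_avg f) (polar (modulus z) t) = logpot (radial_avg f) z.
Proof.
move=> mf; have [al _ zE] := polar_exists z.
have -> : polar (modulus z) t = rot (cos (t - al)) (sin (t - al)) z.
  by rewrite {2}zE -polar_rot addrC subrK.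
apply: logpot_rot; first exact: cos2Dsin2.
  exact: measurable_radial_avg.
by move=> y; rewrite /radial_avg modulus_rot// cos2Dsin2.
Qed.

Lemma radial_avgZ (f k : R * R -> R) (z : R * R) : bmeas f ->
  (forall t, k (polar (modulus z) t) = k z) ->
  radial_avg (fun x => f x * k x) z = k z * radial_avg f z.
Proof.
move=> [mf [C fC]] kz; rewrite /radial_avg mulrCA; congr (_ * _).
have i := integrable_circle (measurable_on_circle z mf) (fun t => fC (polar (modulus z) t)).
transitivity (\int[mu]_(t in circle) (k z * f (polar (modulus z) t))).
  by apply: eq_Rintegral => t _; rewrite kz mulrC.
by apply: RintegralZl; [exact: measurable_itv|exact: i].
Qed.

Lemma bsupp_mul_logpot (f g : R * R -> R) : bsuppM f -> bsuppM g ->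
  bsuppM (fun x => f x * logpot g x).
Proof.
move=> [[mf [C fC]] f0] bg; have [[mg [D gD]] _] := bg; split; last by move=> x /f0 ->; rewrite mul0r.
split; first exact: measurable_funM mf (measurable_logpot mg).
exists (C * `|log_bound M * D * (area M + 2^-1)|) => x.
have C0 := le_trans (normr_ge0 _) (fC 0).
have [xM|Mx] := leP (modulus x) M; last by rewrite f0// mul0r normr0 mulr_ge0.
rewrite normrM ler_pM//; exact: le_trans (logpot_le bg gD xM) (ler_norm _).
Qed.

Lemma integral_mul_logpot (f g : R * R -> R) (x : R * R) : bsuppM f -> bsuppM g ->
  (\int[leb]_y (f x * (- ln (modulus (x - y)) * g y))%:E = (f x * logpot g x)%:E)%E.
Proof.
move=> bf bg; have [xM|Mx] := leP (modulus x) M; last first.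
  rewrite bf.2// mul0r; apply: integral0_eq => y _; by rewrite mul0r.
have i := tame_integrable (tame_Nln xM) bg.
have i' : leb.-integrable setT (fun y => (f x * (- ln (modulus (x - y)) * g y))%:E).
  exact: (integrableZl measurableT (f x) i).
rewrite /logpot -(RintegralZl (f x) measurableT i) /Rintegral fineK//.
exact: (integrable_fin_num measurableT i').
Qed.

(** Fubini's theorem for a symmetric kernel. Absolute integrability holds because the inner integral
    is at most a constant times the absolute value of [f x]. *)
Lemma logpot_sym (f g : R * R -> R) : bsuppM f -> bsuppM g ->
  \int[leb2]_x (f x * logpot g x) = \int[leb2]_x (g x * logpot f x).
Proof.
move=> bf bg; have [[mf [C fC]] _] := bf; have [[mg [D gD]] _] := bg.
pose F (p : (R * R) * (R * R)) := f p.1 * (- ln (modulus (p.1 - p.2)) * g p.2).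
have mF : measurable_fun setT (EFin \o F).
  apply/measurable_EFinP; apply: measurable_funM; first exact: measurableT_comp mf measurable_fst.
  apply: measurable_funM; last exact: measurableT_comp mg measurable_snd.
  exact: measurableT_comp _ (@measurable_ln_modulus R).
pose B := `|log_bound M * D * (area M + 2^-1)|.
have inner (x : R * R) : (\int[leb]_y `|(EFin \o F) (x, y)| <= (B * `|f x|)%:E)%E.
  have [xM|Mx] := leP (modulus x) M; last first.
    rewrite bf.2// normr0 mulr0 integral0_eq// => y _.
    by rewrite /F/= bf.2// mul0r normr0.
  have [A0 mK KA] := tame_Nln xM.
  have tK : tame M x (log_bound M) (fun y => `|- ln (modulus (x - y))|).
    by split => //; [exact: measurableT_comp|move=> y yM; rewrite normr_id; exact: KA].
  have bg' := bsupp_abs bg.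
  have i := tame_integrable tK bg'.
  have i' : leb.-integrable setT (fun y => (`|f x| * (`|- ln (modulus (x - y))| * `|g y|))%:E).
    exact: (integrableZl measurableT `|f x| i).
  have -> : (\int[leb]_y `|(EFin \o F) (x, y)| =
      \int[leb]_y (`|f x| * (`|- ln (modulus (x - y))| * `|g y|))%:E)%E.
    by apply: eq_integral => y _; rewrite /F/= !normrM.
  rewrite -(fineK (integrable_fin_num measurableT i')) lee_fin.
  have := RintegralZl `|f x| measurableT i; rewrite {1}/Rintegral => ->.
  rewrite mulrC ler_wpM2r//.
  apply: le_trans (ler_norm _) _.
  apply: le_trans (tame_Rintegral_le tK bg' (C := D) _) (ler_norm _).
  by move=> y; rewrite normr_id.
have iF : (leb \x leb)%E.-integrable setT (EFin \o F).
  apply/(integrable12ltyP leb leb mF).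
  have mi : measurable_fun setT (fun x => \int[leb]_y `|(EFin \o F) (x, y)|)%E.
    apply: (measurable_ge0_integral leb (E := setT) measurableT (f := fun p => `|(EFin \o F) p|%E)).
      exact: measurableT_comp mF.
    by move=> p; exact: abse_ge0.
  have ia : leb.-integrable setT (fun x => (B * `|f x|)%:E).
    exact: (integrableZl measurableT B (bsupp_integrable (bsupp_abs bf))).
  have fin := integrable_fin_num measurableT ia.
  apply: (@le_lt_trans _ _ (\int[leb]_x (B * `|f x|)%:E)%E); last by rewrite ltey_eq fin.
  apply: ge0_le_integral; first exact: measurableT.
  - by move=> x _; apply: integral_ge0 => y _; exact: abse_ge0.
  - exact: mi.
  - exact: (measurable_int _ ia).
  - by move=> x _; exact: inner.
have := Fubini iF => fub.
transitivity (fine (\int[leb]_x \int[leb]_y (EFin \o F) (x, y))%E).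
  rewrite /Rintegral; congr fine; apply: eq_integral => x _.
  by rewrite -(integral_mul_logpot x bf bg).
rewrite fub /Rintegral; congr fine; apply: eq_integral => y _.
rewrite -(integral_mul_logpot y bg bf); apply: eq_integral => x _.
rewrite /F/= -opprB modulusN; congr EFin; ring.
Qed.

(** The potential of a radial function is constant on circles, so it leaves the angular average. In
    other words [radial_hat f] is orthogonal to radial potentials. *)
Lemma logpot_radialE (f : R * R -> R) : bsuppM f ->
  \int[leb2]_x (f x * logpot (radial_avg f) x) =
  \int[leb2]_x (radial_avg f x * logpot (radial_avg f) x).
Proof.
move=> bf; have ba := bsupp_radial_avg bf.
rewrite -(Rintegral_radial_avg (bsupp_mul_logpot bf ba)).
apply: eq_Rintegral => x _; rewrite [RHS]mulrC.
exact: (radial_avgZ bf.1 (fun t => logpot_radial_polar x t bf.1.1)).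
Qed.

(** At 0 the conventions for the inverse and the logarithm make both sides 0, which covers the
    diagonal in the energy. *)
Lemma lnV_ge0 (x : R) : 0 <= x -> ln x^-1 = - ln x.
Proof.
rewrite le_eqVlt => /orP[/eqP<-|x0]; first by rewrite invr0 ln0// oppr0.
by rewrite lnV.
Qed.

Lemma energy_logpot (f : R * R -> R) : bsuppM f ->
  pi * energy f = \int[leb2]_x (f x * logpot f x).
Proof.
move=> bf; have p0 := pi_gt0 R.
rewrite /energy -[RHS]mul1r -(@divff _ (pi : R)) ?gt_eqF// -mulrA; congr (_ * _).
rewrite -(RintegralZl _ measurableT (bsupp_integrable (bsupp_mul_logpot bf bf))).
apply: eq_Rintegral => x _.
have [xM|Mx] := leP (modulus x) M; last first.
  have -> : f x = 0 by rewrite bf.2.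
  rewrite mul0r mulr0; transitivity (\int[leb2]_(y in [set: R * R]) (0 : R)).
    by apply: eq_Rintegral => y _; rewrite mulr0.
  by rewrite /Rintegral integral0_eq.
rewrite mulrA /logpot -(RintegralZl _ measurableT (tame_integrable (tame_Nln xM) bf)).
apply: eq_Rintegral => y _; rewrite lnV_ge0 ?modulus_ge0// -(opprB x y) modulusN; ring.
Qed.

(** Exhibits the corrector as an angular average of a function supported in the disc, so that its
    plane integral is [pi^-1] times the logarithmic energy of [radial_hat f]. *)
Lemma radial_checkE (f : R * R -> R) : bsuppM f ->
  radial_check f = radial_avg (fun x => pi^-1 * (radial_hat f x * logpot (radial_hat f) x)).
Proof.
move=> bf; apply/funext => z; rewrite /radial_check /radial_avg; congr (_ * _).
have bh : bsuppM (radial_hat f).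
  have := bsuppD bf (bsuppZ (-1) (bsupp_radial_avg bf)); congr (bsupp M).
  by apply/funext => x; rewrite mulN1r.
apply: eq_Rintegral => t _; set p := polar _ _.
have [pM|Mp] := leP (modulus p) M; last by rewrite bh.2// !(mulr0, mul0r).
rewrite !mulNr -mulrA -!mulrN; congr (_ * (_ * _)).
rewrite /logpot -mulN1r -(RintegralZl (-1) measurableT).
  by apply: eq_Rintegral => y _; ring.
have := tame_integrable (tame_ln pM) bh; congr (integrable _ _ _).
by apply/funext => y; rewrite /= mulrC.
Qed.

Lemma bsupp_radial_hat (f : R * R -> R) : bsuppM f -> bsuppM (radial_hat f).
Proof.
move=> bf; have := bsuppD bf (bsuppZ (-1) (bsupp_radial_avg bf)); congr (bsupp M).
by apply/funext => x; rewrite mulN1r.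
Qed.

Lemma bsupp_radial_check (f : R * R -> R) : bsuppM f -> bsuppM (radial_check f).
Proof.
move=> bf; rewrite (radial_checkE bf); apply: bsupp_radial_avg; apply: bsuppZ.
by apply: bsupp_mul_logpot; exact: bsupp_radial_hat.
Qed.

(** Bilinear expansion of the energy of [radial_hat f] plus [radial_avg f]. The cross terms vanish
    by [logpot_radialE] and symmetry; the corrector accounts for the first square, the radial
    profile for the second. *)
Lemma energy_const_radial (f : R * R -> R) : bsuppM f ->
  energy_const (radial_avg f) (radial_check f) = pi * energy f.
Proof.
move=> bf; have ba := bsupp_radial_avg bf; have bh := bsupp_radial_hat bf.
have p0 := pi_gt0 R; rewrite (energy_logpot bf) /energy_const.
have int g h (bg : bsuppM g) (bk : bsuppM h) := bsupp_integrable (bsupp_mul_logpot bg bk).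
have -> : pi * \int[leb2]_x radial_check f x =
    \int[leb2]_x (radial_hat f x * logpot (radial_hat f) x).
  rewrite (radial_checkE bf) (Rintegral_radial_avg (bsuppZ _ (bsupp_mul_logpot bh bh))).
  by rewrite (RintegralZl _ measurableT (int _ _ bh bh)) mulrA divff ?mul1r// gt_eqF.
have fE x : f x = radial_hat f x + radial_avg f x by rewrite subrK.
have splitl h : bsuppM h -> \int[leb2]_x (f x * logpot h x) =
    \int[leb2]_x (radial_hat f x * logpot h x) + \int[leb2]_x (radial_avg f x * logpot h x).
  move=> bk; rewrite -(RintegralD measurableT (int _ _ bh bk) (int _ _ ba bk)).
  by apply: eq_Rintegral => x _; rewrite [f x]fE mulrDl.
have crossz : \int[leb2]_x (radial_hat f x * logpot (radial_avg f) x) = 0.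
  have /esym/eqP := splitl _ ba.
  by rewrite (logpot_radialE bf) -subr_eq0 addrK => /eqP.
have splitr h : bsuppM h -> \int[leb2]_x (h x * logpot f x) =
    \int[leb2]_x (h x * logpot (radial_hat f) x) + \int[leb2]_x (h x * logpot (radial_avg f) x).
  move=> bk; apply: (etrans (logpot_sym bk bf)); apply: (etrans (splitl _ bk)).
  exact: (f_equal2 +%R (logpot_sym bh bk) (logpot_sym ba bk)).
apply: esym; apply: (etrans (splitl _ bf)).
apply: (etrans (f_equal2 +%R (splitr _ bh) (splitr _ ba))).
apply: (etrans (f_equal2 +%R (f_equal2 +%R (erefl _) crossz)
  (f_equal2 +%R (etrans (logpot_sym ba bh) crossz) (erefl _)))).
by rewrite addr0 add0r.
Qed.

End EnergySplit.

(** * From the resolvent to occupation integrals, and the conclusion *)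

Section Resolvent.
Context {R : realType} {d : measure_display} {Omega : measurableType d}.
Local Notation mu := (@lebesgue_measure R).

Lemma measurable_path (P : probability Omega R) (z : R * R) (W : R -> Omega -> R * R) :
  is_brownian2 P z W -> measurable_fun setT (fun p : R * Omega => W (Num.max p.1 0) p.2).
Proof.
move=> WB.
have t0 (t : R) : 0 <= Num.max t 0 by rewrite le_max lexx orbT.
have m t := iffLR (measurable_fun_pairP _) (brownian2_measurable WB (t0 t)).
apply/measurable_fun_pairP; split.
  apply: (measurable_fun_caratheodory (X := fun t w => (W (Num.max t 0) w).1)).
    by move=> t; exact: (m t).1.
  by move=> w t; exact: (cvg_comp _ _ (@continuous_at_max0 _ _ _ _ _ _ WB w t) cvg_fst).
apply: (measurable_fun_caratheodory (X := fun t w => (W (Num.max t 0) w).2)).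
  by move=> t; exact: (m t).2.
by move=> w t; exact: (cvg_comp _ _ (@continuous_at_max0 _ _ _ _ _ _ WB w t) cvg_snd).
Qed.

(** Almost surely [W] and [trajectory] agree at all nonnegative times simultaneously, hence also
    inside the additive functional. *)
Lemma expectation_weight (P : probability Omega R) (z : R * R) (W : R -> Omega -> R * R)
    (V g : R * R -> R) (t : R) : is_brownian2 P z W -> bmeas V -> bmeas g -> 0 <= t ->
  ('E_P[fun w => (expR (additive_functional W V t w) * g (W t w))%R] =
   \int[P]_w (weight z W V t w * g (trajectory z W t w))%:E)%E.
Proof.
move=> WB [mV [K VK]] [mg _] t0; rewrite unlock.
pose Y (p : R * Omega) := W (Num.max p.1 0) p.2.
have mY : measurable_fun setT Y by exact: measurable_path WB.
have AE w : additive_functional W V t w = primitive (fun s => V (Y (s, w))) t.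
  rewrite /additive_functional /primitive; apply: eq_Rintegral => s.
  by rewrite inE/= in_itv/= => /andP[s0 _]; rewrite /Y/= max_l.
have YE w : W t w = Y (t, w) by rewrite /Y/= max_l.
have m1 : measurable_fun setT
    (fun w => (expR (primitive (fun s => V (Y (s, w))) t) * g (Y (t, w)))%:E).
  apply/measurable_EFinP; apply: measurable_funM.
    exact: (measurableT_comp (measurable_weight_of mV VK mY) (pair1_measurable t)).
  exact: (measurableT_comp mg (measurableT_comp mY (pair1_measurable t))).
have m2 : measurable_fun setT (fun w => (weight z W V t w * g (trajectory z W t w))%:E).
  apply/measurable_EFinP; apply: measurable_funM.
    exact: (measurableT_comp (measurable_weight WB mV VK) (pair1_measurable t)).
  exact: (measurableT_comp mg (measurable_trajectory WB t)).
transitivity (\int[P]_w (expR (primitive (fun s => V (Y (s, w))) t) * g (Y (t, w)))%:E)%E.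
  by apply: eq_integral => w _; rewrite /= AE YE.
apply: ae_eq_integral; [exact: measurableT|exact: m1|exact: m2|].
apply: filterS (trajectory_ae WB) => w XE _; rewrite -YE XE// /weight.
congr (expR _ * _)%:E; apply: eq_Rintegral => s; rewrite inE/= in_itv/= => /andP[s0 _].
by rewrite XE// /Y/= max_l.
Qed.

Lemma resolventE (P : R * R -> probability Omega R) (z : R * R) (W : R -> Omega -> R * R)
    (q : R) (V g : R * R -> R) : is_brownian2 (P z) z W -> bmeas V -> bmeas g ->
  (forall x, 0 <= g x) ->
  resolvent P W q V g z = occupation (P z) z W V (kill q) (EFin \o g).
Proof.
move=> WB bV bg g0; have [mV [K VK]] := bV; have [mg _] := bg.
pose H (t : R) := (\int[P z]_w ((kill q t * weight z W V t w)%:E *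
  (EFin \o g) (trajectory z W t w)))%E.
have mw : measurable_fun setT (fun p : R * Omega => kill q p.1 * weight z W V p.1 p.2).
  apply: measurable_funM; last exact: (measurable_weight WB mV VK).
  exact: (measurableT_comp (measurable_kill q) measurable_fst).
have mH : measurable_fun setT H.
  apply: (measurable_ge0_integral (P z) (E := setT) measurableT
    (f := fun p : R * Omega => ((kill q p.1 * weight z W V p.1 p.2)%:E *
      (EFin \o g) (trajectory z W p.1 p.2))%E)).
    apply: emeasurable_funM; last exact: measurableT_comp (bmeas_EFin bg) (measurable_trajectory2 WB).
    apply/measurable_EFinP; exact: mw.
  move=> p; apply: mule_ge0; rewrite lee_fin; last exact: g0.
  by apply: mulr_ge0; exact: expR_ge0.
transitivity (\int[mu]_(t in `[0%R, +oo[) H t)%E; last first.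
  by symmetry; apply: integral_itv_obnd_cbnd; exact: measurable_funTS.
apply: eq_integral => t; rewrite inE/= in_itv/= andbT => t0.
rewrite (expectation_weight WB bV bg t0) -ge0_integralZl.
- by apply: eq_integral => w _; rewrite -!EFinM mulrA.
- exact: measurableT.
- apply/measurable_EFinP; apply: measurable_funM.
    exact: (measurableT_comp (measurable_weight WB mV VK) (pair1_measurable t)).
  exact: (measurableT_comp mg (measurable_trajectory WB t)).
- by move=> w _; rewrite lee_fin; apply: mulr_ge0 => //; exact: expR_ge0.
- by rewrite lee_fin expR_ge0.
Qed.

(** The perturbed theory with zero potential: smallness holds with [theta = 0], and the last term of
    Duhamel's formula vanishes. *)
Lemma resolvent0 (P : R * R -> probability Omega R) (z : R * R) (W : R -> Omega -> R * R)
    (q : R) (g : R * R -> R) : is_brownian2 (P z) z W -> 0 < q -> bmeas g ->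
  (forall x, 0 <= g x) ->
  resolvent P W q (fun=> 0) g z = (green_mean q g z)%:E.
Proof.
move=> WB q0 bg g0; pose V0 : R * R -> R := fun=> 0.
have bV : bmeas V0 := bmeas_cst 0.
have VK x : `|V0 x| <= 0 by rewrite normr0.
have G0 : (green_op q (fun x => `|V0 x|%:E) z < +oo)%E.
  have -> : (fun x => `|V0 x|%:E) = EFin \o V0 by apply/funext => x; rewrite /= normr0.
  by rewrite (green_meanE q0 z bV (fun=> lexx 0)) ltry.
have small x : V0 x != 0 -> (green_op q (fun x0 => `|V0 x0|%:E) x <= 0%:E)%E by rewrite eqxx.
have fin := occupation_kill_fin WB bV.1 VK q0 (lexx 0) ltr01 small G0.
rewrite (resolventE q WB bV bg g0) (km_occ WB bV.1 VK fin bg g0).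
rewrite (killed_mean_green q0 WB bV fin bg).
have -> : (fun x => V0 x * green_mean q g x) = (fun x => 0 * V0 x).
  by apply/funext => x; rewrite /V0 !mul0r.
by rewrite (kmZ WB bV.1 VK fin 0 bV) mul0r addr0.
Qed.

End Resolvent.

(** One coordinate plays the role of time and the other that of the outcome in the joint
    measurability lemma. *)
Lemma continuous_plane_measurable (R : realType) (f : R * R -> R) :
  continuous f -> measurable_fun setT f.
Proof.
move=> cf; have -> : f = (fun p : R * R => f (p.1, p.2)) by apply/funext => -[].
apply: (measurable_fun_caratheodory (X := fun t w => f (t, w))) => [t|w].
  apply: continuous_measurable_fun => w.
  have H : (fun w' : R => (t, w')) @ w --> (t, w).
    move=> U [[A B] /= [At Bw] AB]; apply: filterS Bw => y By; apply: AB.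
    by split => //; exact: nbhs_singleton At.
  exact: (cvg_comp _ _ H (cf (t, w))).
move=> t; have H : (fun t' : R => (t', w)) @ t --> (t, w).
  move=> U [[A B] /= [At Bw] AB]; apply: filterS At => y By; apply: AB.
  by split => //; exact: nbhs_singleton Bw.
exact: (cvg_comp _ _ H (cf (t, w))).
Qed.

Lemma bsupp_compact (R : realType) (f : R * R -> R) : continuous f -> compactly_supported f ->
  exists2 M, 0 <= M & bsupp M f.
Proof.
move=> cf sf; have [B [_ HB]] := compact_bounded sf.
have [C [_ HC]] := compact_bounded (continuous_compact (continuous_subspaceT cf) sf).
have inA x : f x != 0 -> closure [set z | f z != 0] x by move=> h; apply: subset_closure.
pose N := `|B| + 1.
have N0 : 0 <= N by rewrite addr_ge0.
have BN : B < N by rewrite (le_lt_trans (ler_norm B))// ltrDl.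
(* Compactness bounds the sup norm of the support by [N]; the Euclidean modulus is at most
   [Num.sqrt 2] times larger. *)
exists (2 * N); first by rewrite mulr_ge0.
split; last first.
  move=> x; apply: contraPeq => /inA /(HB _ BN) xN; apply/negP; rewrite -leNgt.
  have x1 : `|x.1| <= N by apply: le_trans xN; rewrite prod_normE le_max lexx.
  have x2 : `|x.2| <= N by apply: le_trans xN; rewrite prod_normE le_max lexx orbT.
  rewrite -(ler_pXn2r (n := 2))// ?nnegrE ?modulus_ge0 ?mulr_ge0//.
  rewrite modulus_sqr -(real_normK (num_real x.1)) -(real_normK (num_real x.2)).
  have := ler_pM (normr_ge0 _) (normr_ge0 _) x1 x1.
  have := ler_pM (normr_ge0 _) (normr_ge0 _) x2 x2.
  by rewrite -!expr2; move: (`|x.1|) (`|x.2|) => a b; rewrite exprMn => ? ?; have := sqr_ge0 N; lra.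
split; first exact: continuous_plane_measurable.
exists (`|C| + 1) => x; have [->|fx] := eqVneq (f x) 0; first by rewrite normr0 addr_ge0.
apply: (HC (`|C| + 1)); first by rewrite (le_lt_trans (ler_norm C))// ltrDl.
by exists x => //; exact: inA.
Qed.

Theorem theorem2p12 (R : realType)
  (d : measure_display) (Omega : measurableType d)
  (P : R * R -> probability Omega R) (W : R -> Omega -> R * R)
  (W_brownian : forall z : R * R, is_brownian2 (P z) z W)
  (phi : R * R -> R) (phi_continuous : continuous phi)
  (phi_ge0 : forall z : R * R, 0 <= phi z)
  (phi_support : compactly_supported phi)
  (phi_int1 : \int[leb2]_z phi z = 1)
  (lambda : R)
  (beta : R) (beta_gt0 : 0 < beta)
  (beta_def : ln beta / 2 =
     pi * energy phi + ln 2 / 2 + lambda - euler_mascheroni R) :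
  exists q0 : R, forall q : R, beta < q -> q0 < q ->
    forall g : R * R -> R, (forall z : R * R, 0 <= g z) ->
      measurable_fun setT g -> [bounded g z | z in [set: R * R]] ->
    forall z : R * R, z != 0 ->
      resolvent P W q
        (fun x => coupling lambda eps *
                  rescale eps (corrected_profile phi lambda eps) x) g z
        @[eps --> 0^'+] -->
      (resolvent P W q (fun=> 0%R) g z +
       (2 * pi / ln (q / beta))%R%:E * green q z *
       resolvent P W q (fun=> 0%R) g 0%R)%E.
Proof.
have [M M0 bphi] := bsupp_compact phi_continuous phi_support.
have ba := bsupp_radial_avg bphi; have bc := bsupp_radial_check bphi.
have [C1 h1] := ba.1.2; have [C2 h2] := bc.1.2.
have l1 x : `|radial_avg phi x| <= Num.max C1 C2 by rewrite le_max h1.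
have l2 x : `|radial_check phi x| <= Num.max C1 C2 by rewrite le_max h2 orbT.
have a0 x : 0 <= radial_avg phi x by exact: radial_avg_ge0.
have int1 : \int[leb2]_x radial_avg phi x = 1 by rewrite (Rintegral_radial_avg bphi).
have bdef : ln beta / 2 = energy_const (radial_avg phi) (radial_check phi) + ln 2 / 2
    + lambda - euler_mascheroni R by rewrite (energy_const_radial bphi).
(* The abstract construction with leading profile [radial_avg phi] and corrector [radial_check phi];
   the threshold is obtained before [g] and [z]. *)
have [qm Hq] := core_limit ba bc a0 l1 l2 int1 M0 beta_gt0 bdef.
exists qm => q bq qmq g g0 mg [B [_ gB]] z z0.
have bg : bmeas g.
  split => //; exists (`|B| + 1) => x; apply: (gB (`|B| + 1)) => //.
  by rewrite (le_lt_trans (ler_norm B))// ltrDl.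
have q0 := lt_trans beta_gt0 bq.
have [fin lim] := Hq q bq qmq _ _ (P z) z W g (W_brownian z) z0 bg.
rewrite (resolvent0 (W_brownian z) q0 bg g0) (resolvent0 (W_brownian 0) q0 bg g0).
have [-> _] := green_log q0 z0; rewrite -!EFinM -EFinD.
pose V (eps : R) (x : R * R) := coupling lambda eps *
  rescale eps (corrected_profile phi lambda eps) x.
have EV : \forall eps \near 0^'+,
    resolvent P W q (V eps) g z = (killed_mean (P z) z W (V eps) q g)%:E.
  apply: filterS fin => eps feps.
  have bV : bmeas (V eps).
    exact: (bmeasM (bmeas_cst _) (bmeas_rescale eps (bsuppD ba (bsuppZ _ bc)).1)).
  have [mV [K VK]] := bV.
  rewrite (resolventE q (W_brownian z) bV bg g0).
  exact: (km_occ (W_brownian z) mV VK feps bg g0).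
(* Convergence in the extended reals to a real limit needs finiteness for small [eps], which
   [core_limit] supplies together with the limit. *)
apply/fine_cvgP; split.
  by apply: filterS EV => eps; rewrite /V => ->.
apply: cvg_trans lim; apply: near_eq_cvg.
by apply: filterS EV => eps; rewrite /V /= => ->.
Qed.
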